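(* Let $E$ be a complete metric locally compact space, $m$ a $\sigma$-finite positive Radon measure on $E$, and $P^0$ the Poisson measure on the configuration space $\Omega$ over $E$ with intensity $m$. Let $\varphi$ be a bounded continuous function on $E$ with $0<\varphi\le M$ and $\sigma^2:=\int_E\varphi^2\,\mathrm{d}m<+\infty$. Set $c=\sigma^2/M$. Then $$\frac1M\,h_c\big(W_{1,d_\varphi}(Q,P^0)\big)\le H(Q\,|\,P^0)\qquad\text{for all }Q\in\mathcal{M}_1(\Omega).$$
   Context: The configuration space over $E$ is $\Omega=\{\omega=\sum_i\delta_{x_i}\ \text{Radon measure};\ x_i\in E\}$ with the vague topology (coarsest making $\omega\mapsto\int f\,\mathrm{d}\omega$ continuous for every continuous compactly supported $f$) and $\sigma$-field generated by $\omega\mapsto\omega(B)$. The Poisson measure $P^0$ with intensity $m$ is the law on $\Omega$ such that $\omega(B)$ is Poisson distributed with mean $m(B)$ for each Borel $B$, and $\omega(B_1),\dots,\omega(B_n)$ are independent for disjoint $B_1,\dots,B_n$. $d_\varphi(\omega,\omega')=\int_E\varphi\,\mathrm{d}|\omega-\omega'|$, where $|\nu|=\nu^++\nu^-$. For a lower semicontinuous metric $d$ on a Polish space $\mathcal{X}$ and probability measures $\mu,\nu$, $W_{1,d}(\mu,\nu)=\inf_\pi\int\!\!\int d(x,y)\,\mathrm{d}\pi(x,y)$, the infimum over all couplings $\pi$ of $\mu$ and $\nu$. The relative entropy is $H(\nu|\mu)=\int\log\frac{\mathrm{d}\nu}{\mathrm{d}\mu}\,\mathrm{d}\nu$ if $\nu\ll\mu$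 and $+\infty$ otherwise. $\mathcal{M}_1(\mathcal{X})$ is the set of probability measures on $\mathcal{X}$. $h(r)=(1+r)\log(1+r)-r$ and $h_c(r)=c\,h(r/c)$ for $c>0$, $r\ge0$ (with $h_c(+\infty)=+\infty$). *)

(* Defs.v *)
From HB Require Import structures.
From mathcomp Require Import all_boot all_order all_algebra.
From mathcomp Require Import all_classical all_reals all_analysis.
From mathcomp Require Import measurable_realfun.
Set Implicit Arguments. Unset Strict Implicit. Unset Printing Implicit Defensive.
Import Order.TTheory GRing.Theory Num.Theory.
Import numFieldNormedType.Exports.
Local Open Scope classical_set_scope.
Local Open Scope ring_scope.

Notation borel E := (g_sigma_algebraType (@open E)).

Section Defs.
Context {R : realType} {E : ptopologicalType}.

(* A point configuration w = sum_i delta_{x_i} is encoded by its multiplicity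
   function E -> nat; w(B) is the (possibly infinite) number of points in B. *)
Definition cnt (w : E -> nat) (B : set E) : \bar R :=
  (\esum_(x in B) ((w x)%:R)%:E)%E.

Definition radon_config (w : E -> nat) : Prop :=
  forall K : set E, compact K -> (cnt w K < +oo)%E.

End Defs.

Definition config (R : realType) (E : ptopologicalType) :=
  {w : E -> nat | @radon_config R E w}.

Section Config.
Context {R : realType} {E : ptopologicalType}.

Lemma radon_config0 : @radon_config R E (fun=> 0%N).
Proof. by move=> K _; rewrite /cnt esum1 // ltry. Qed.

HB.instance Definition _ := gen_eqMixin (config R E).
HB.instance Definition _ := gen_choiceMixin (config R E).
HB.instance Definition _ := isPointed.Build (config R E)
  (exist _ (fun=> 0%N) radon_config0).

Definition cfg_cnt (w : config R E) (B : set E) : \bar R := cnt (proj1_sig w) B.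

Definition config_gen : set (set (config R E)) :=
  [set [set w | cfg_cnt w B \in A] | B in [set B | (@open E).-sigma.-measurable B]
     & A in [set A : set (\bar R) | measurable A]].

End Config.

Notation Omega R E := (g_sigma_algebraType (@config_gen R E)).

Section Defs2.
Context {R : realType} {E : ptopologicalType}.

(* d_phi(w,w') = int phi d|w - w'| ; for point measures |w - w'| has
   atom |w(x) - w'(x)| at each x *)
Definition d_phi (phi : E -> R) (w w' : Omega R E) : \bar R :=
  (\esum_(x in [set: E]) (phi x * `|((proj1_sig w x)%:R - (proj1_sig w' x)%:R : R)|)%:E)%E.

End Defs2.

Section Wasserstein.
Context {R : realType} {d : measure_display} {T : measurableType d}.

Definition coupling (pi : probability (T * T)%type R) (mu nu : probability T R) :=
  (forall A, measurable A -> pi (A `*` setT) = mu A) /\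
  (forall B, measurable B -> pi (setT `*` B) = nu B).

Definition W1 (dist : T -> T -> \bar R) (mu nu : probability T R) : \bar R :=
  ereal_inf [set (\int[pi]_z dist z.1 z.2)%E
            | pi in [set pi : probability (T * T)%type R | coupling pi mu nu]].

Definition abs_cont (nu mu : probability T R) :=
  forall A, measurable A -> mu A = 0%E -> nu A = 0%E.

Definition is_density (nu mu : probability T R) (f : T -> R) :=
  measurable_fun setT f /\ (forall x, 0 <= f x) /\
  forall A, measurable A -> nu A = (\int[mu]_(x in A) (f x)%:E)%E.

Definition rel_entropy (nu mu : probability T R) : \bar R :=
  if `[< abs_cont nu mu >] then
    (\int[nu]_x (ln (xget (fun=> 0) (is_density nu mu) x))%:E)%E
  else +oo%E.

End Wasserstein.

Section hfun.
Context {R : realType}.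
Definition h (r : R) : R := (1 + r) * ln (1 + r) - r.
Definition hc (c : R) (r : \bar R) : \bar R :=
  match r with
  | r%:E => (c * h (r / c))%:E
  | _ => +oo%E
  end.
End hfun.

Definition radon_measure (R : realType) (E : ptopologicalType)
    (m : {measure set (borel E) -> \bar R}) :=
  (forall K : set E, compact K -> (m K < +oo)%E) /\
  (forall B : set E, (@open E).-sigma.-measurable B ->
     m B = ereal_sup [set m K | K in [set K : set E | compact K /\ K `<=` B]]).

Definition poisson_measure (R : realType) (E : ptopologicalType)
    (m : {measure set (borel E) -> \bar R}) (P : probability (Omega R E) R) :=
  (forall B : set E, (@open E).-sigma.-measurable B -> (m B < +oo)%E ->
     forall k : nat,
       P [set w | cfg_cnt w B = (k%:R)%:E] =
       (expR (- fine (m B)) * (fine (m B)) ^+ k / (k`!)%:R)%:E) /\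
  (forall (n : nat) (B : 'I_n -> set E) (A : 'I_n -> set (\bar R)),
     (forall i, (@open E).-sigma.-measurable (B i)) ->
     (forall i j, i != j -> B i `&` B j = set0) ->
     (forall i, measurable (A i)) ->
     P (\bigcap_(i in [set: 'I_n]) [set w | cfg_cnt w (B i) \in A i]) =
     (\prod_(i < n) fine (P [set w | cfg_cnt w (B i) \in A i]))%:E).

(* Main.v *)
(* By Legendre duality it suffices to find, for all s, delta > 0, a coupling of
   Q and P0 with
     s E d_phi <= H(Q|P0) + int h*(s phi) dm + delta,   h*(t) = e^t - t - 1;
   since h*(s phi) <= (phi / M)^2 h*(s M), the choice s = ln(1 + W / c) / M then
   gives the claim.

   Cut E into cells A_i, each inside a compact set and such that every compact
   set meets finitely many of them, and write m as the sum of w_i m|A_i.  P0 is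
   then the image, under superposition T of points, of a product of laws P_i of
   Poisson point lists: both laws have the same Laplace functional, from which
   the counting probabilities are recovered as power series coefficients.
   Lift Q = f P0 to the density f o T on the product and transport coordinate by
   coordinate (Marton): given the past, the n-th conditional density g is coupled
   to P_n by the maximal coupling, whose cost for the weight
   psi_n = sum of s phi over the points of the n-th list is, by Young's
   inequality t |u - 1| <= (u ln u - u + 1) + h*(t), at most
   Ent(g) + int h*(psi_n) dP_n.  The entropies add up to H(Q|P0) by the chain
   rule, and int h*(psi_n) dP_n exceeds w_n int_(A_n) h*(s phi) dm only by
   h*(w_n a_n), a_n = int_(A_n) (e^(s phi) - 1) dm; splitting A_n into many
   copies of small weight w_n makes the sum of these excesses at most delta. *)

Require Import Defs.
From HB Require Import structures.
From mathcomp Require Import all_boot all_order all_algebra.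
From mathcomp Require Import all_classical all_reals all_analysis.
From mathcomp Require Import measurable_realfun zify ring lra.
Set Implicit Arguments. Unset Strict Implicit. Unset Printing Implicit Defensive.
Import Order.TTheory GRing.Theory Num.Theory.
Import numFieldNormedType.Exports HBNNSimple.
Local Open Scope classical_set_scope.
Local Open Scope ring_scope.

(** * Sequence spaces *)

(** Every conditional law is given by a density with respect to a fixed probability, so the coupling
    is an Ionescu-Tulcea chain of densities and no disintegration is invoked; a flag brings the
    maximal coupling, which charges the diagonal, under this scheme. The coordinates are whole point
    lists because these are independent under the product law. The price is that two lists which are
    not coupled to be equal are charged with all points of both; this is why an exponential moment
    of psi_n appears instead of one of s phi. The excess is quadratic in w_n, while the number of
    copies of a cell grows like 1 / w_n, so splitting makes it small. The cells cannot come from an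
    exhaustion of E by compact sets, since E need not be sigma-compact: sigma-finiteness and inner
    regularity give countably many compact sets that carry m, and these are enlarged to an
    increasing sequence whose union is open and closed, which makes the cells locally finite.
    Entropy enters through u ln u - u + 1 >= 0, so that only nonnegative functions are integrated
    and infinite values are covered. *)

Definition coord_gen {d : measure_display} {T : measurableType d} :
    set (set (nat -> T)) :=
  [set (fun w : nat -> T => w i) @^-1` A | i in [set: nat] & A in measurable].

Notation Seq T := (g_sigma_algebraType (@coord_gen _ T)).

Definition seq_upd {T : Type} (n : nat) (w : nat -> T) (t : T) : nat -> T :=
  fun i => if i == n then t else w i.

Definition seq_splice {T : Type} (n : nat) (x z : nat -> T) : nat -> T :=
  fun i => if (i < n)%N then x i else z i.

(** The pointwise form of measurability with respect to the first n coordinates; with [U := Prop] it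
    applies to sets, hence to cylinders. *)
Definition dep_lt {T U : Type} (n : nat) (F : (nat -> T) -> U) : Prop :=
  forall x y, (forall i, (i < n)%N -> x i = y i) -> F x = F y.

Section functions.
Context {d} {T : measurableType d} {R : realType}.
Local Open Scope ereal_scope.

(** The standard machine, for functionals such as iterated kernels that are only known to be
    additive, homogeneous and continuous along increasing sequences. *)
Lemma ge0_measurable_fun_ind (P : (T -> \bar R) -> Prop) :
  (forall A, measurable A -> P (EFin \o \1_A)) ->
  (forall F G, measurable_fun setT F -> (forall x, 0 <= F x) ->
     measurable_fun setT G -> (forall x, 0 <= G x) -> P F -> P G ->
     P (F \+ G)) ->
  (forall c F, (0 <= c)%R -> measurable_fun setT F -> (forall x, 0 <= F x) ->
     P F -> P (fun x => c%:E * F x)) ->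
  (forall F : (T -> \bar R)^nat, (forall n, measurable_fun setT (F n)) ->
     (forall n x, 0 <= F n x) -> (forall x, nondecreasing_seq (F ^~ x)) ->
     (forall n, P (F n)) -> P (fun x => limn (F ^~ x))) ->
  forall F, measurable_fun setT F -> (forall x, 0 <= F x) -> P F.
Proof.
move=> P1 PD PZ Plim F mF F0.
have Psf (f : {nnsfun T >-> R}) : P (EFin \o f).
  have -> : EFin \o f = fun x => \sum_(r \in range f) (r * \1_(f @^-1` [set r]) x)%:E.
    apply/funext => x /=; rewrite fsumEFin//; congr (_%:E).
    exact: fimfunE.
  (* Measurability and sign of the partial sums travel with the induction because [PD] asks for
     them. *)
  have Hgen : forall s : seq R, uniq s -> (forall r, r \in s -> 0 <= r)%R ->
      P (fun x => \sum_(r <- s) (r * \1_(f @^-1` [set r]) x)%:E) /\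
      measurable_fun setT (fun x => \sum_(r <- s) (r * \1_(f @^-1` [set r]) x)%:E)
      /\ forall x, 0 <= \sum_(r <- s) (r * \1_(f @^-1` [set r]) x)%:E.
    elim=> [_ _|r s ih /=/andP[_ us] hs].
      split; last first.
        split; first by under eq_fun do rewrite big_nil; exact: measurable_cst.
        by move=> x; rewrite big_nil.
      (* The zero function is reached as 0 times the indicator of the empty set. *)
      rewrite (_ : (fun x => _) = (fun x => 0%R%:E * (EFin \o \1_(set0 : set T)) x)).
        apply: PZ => //; last exact: P1.
          by apply/measurable_EFinP; exact: measurable_indic.
        by move=> x; rewrite lee_fin.
      by apply/funext => x; rewrite big_nil mul0e.
    have [|Ps [ms s0]] := ih us.
      by move=> x xs; apply: hs; rewrite inE xs orbT.
    have r0 : (0 <= r)%R by apply: hs; rewrite mem_head.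
    have m1 : measurable_fun setT (EFin \o \1_(f @^-1` [set r]) : T -> \bar R).
      by apply/measurable_EFinP; exact: measurable_indic.
    have E : (fun x => \sum_(r <- r :: s) (r * \1_(f @^-1` [set r]) x)%:E) =
      (fun x => r%:E * (EFin \o \1_(f @^-1` [set r])) x) \+
      (fun x => \sum_(r <- s) (r * \1_(f @^-1` [set r]) x)%:E).
      by apply/funext => x; rewrite big_cons EFinM.
    have mr : measurable_fun setT
        (fun x : T => r%:E * (EFin \o \1_(f @^-1` [set r])) x : \bar R).
      exact: measurable_funeM.
    have r1 x : 0 <= r%:E * (EFin \o \1_(f @^-1` [set r])) x :> \bar R.
      by apply: mule_ge0; rewrite lee_fin.
    rewrite E; split.
      apply: PD => //; apply: PZ => //; first by move=> x; rewrite lee_fin.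
      exact: P1.
    split; first exact: emeasurable_funD.
    by move=> x; rewrite big_cons EFinM; exact: (adde_ge0 (r1 x) (s0 x)).
  have [|r|Ps _] := @Hgen (finmap.enum_fset (fset_set (range f))).
  - exact: finmap.fset_uniq.
  - rewrite in_fset_set// inE => -[x _ <-]; exact: fun_ge0.
  - have -> // : (fun x => \sum_(r \in range f) (r * \1_(f @^-1` [set r]) x)%:E) =
      (fun x => \sum_(r <- finmap.enum_fset (fset_set (range f))) (r * \1_(f @^-1` [set r]) x)%:E).
    by apply/funext => x; rewrite fsbig_finite.
pose g := nnsfun_approx measurableT mF.
have -> : F = fun x => limn ((fun n => EFin \o g n) ^~ x).
  apply/funext => x; apply/esym/cvg_lim => //.
  exact: cvg_nnsfun_approx.
apply: Plim => //.
- by move=> n; exact/measurable_EFinP.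
- by move=> n x; rewrite lee_fin fun_ge0.
- by move=> x m n mn; rewrite lee_fin; exact/lefP/nd_nnsfun_approx.
Qed.

End functions.

Section seq_space.
Context {d} {T : measurableType d}.

Lemma measurable_coord (i : nat) :
  measurable_fun [set: Seq T] (fun w : Seq T => w i).
Proof.
by move=> _ A mA; rewrite setTI; apply: sub_sigma_algebra; exists i => //; exists A.
Qed.

Lemma measurable_to_seq d' (X : measurableType d') (f : X -> Seq T) :
  (forall i, measurable_fun setT (fun x => f x i)) ->
  measurable_fun setT f.
Proof.
move=> mf; apply: (@measurability _ _ X (Seq T) setT f (@coord_gen _ T)) => //.
move=> _ [_ [i _ [A mA <-]] <-].
by have := mf i measurableT A mA.
Qed.

Lemma measurable_seq_upd n :
  measurable_fun setT (fun z : Seq T * T => seq_upd n z.1 z.2 : Seq T).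
Proof.
apply: measurable_to_seq => i; rewrite /seq_upd.
case: (i == n); first exact: measurable_snd.
exact: (measurableT_comp (measurable_coord i) measurable_fst).
Qed.

Lemma measurable_seq_splice n :
  measurable_fun setT (fun z : Seq T * Seq T => seq_splice n z.1 z.2 : Seq T).
Proof.
apply: measurable_to_seq => i; rewrite /seq_splice.
case: (i < n)%N; first exact: (measurableT_comp (measurable_coord i) measurable_fst).
exact: (measurableT_comp (measurable_coord i) measurable_snd).
Qed.

End seq_space.

(** * Ionescu-Tulcea measures given by densities *)

Section ionescu_tulcea.
Context {d} {T : measurableType d} {R : realType}.
Context (P : nat -> probability T R) (rho : nat -> Seq T * T -> R).
Context (rho_ge0 : forall n z, 0 <= rho n z).
Context (mrho : forall n, measurable_fun setT (rho n)).
Context (rho_dep : forall n t, dep_lt n (fun w => rho n (w, t))).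
Context (rho1 : forall n (w : Seq T), (\int[P n]_t (rho n (w, t))%:E = 1)%E).
Local Open Scope ereal_scope.
Implicit Types (F G : Seq T -> \bar R) (w : Seq T).

(** The transition operator at time n, acting on functions of the whole sequence; its kernel has
    density [rho n (w, .)], which by [rho_dep] sees only the past. *)
Definition it_step n (F : Seq T -> \bar R) (w : Seq T) : \bar R :=
  \int[P n]_t (F (seq_upd n w t) * (rho n (w, t))%:E).

(** The recursion peels the outermost coordinate n; [stepsS] peels the innermost one. *)
Fixpoint it_steps n m (F : Seq T -> \bar R) : Seq T -> \bar R :=
  if m is m'.+1 then it_step n (it_steps n.+1 m' F) else F.

Lemma step_ge0 n F : (forall w, 0 <= F w) -> forall w, 0 <= it_step n F w.
Proof.
by move=> F0 w; apply: integral_ge0 => t _; rewrite mule_ge0// lee_fin.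
Qed.

Lemma measurable_step_integrand n F : measurable_fun setT F ->
  measurable_fun setT
    (fun z : Seq T * T => F (seq_upd n z.1 z.2) * (rho n z)%:E).
Proof.
move=> mF; apply: emeasurable_funM; last exact/measurable_EFinP.
exact: (measurableT_comp mF (measurable_seq_upd n)).
Qed.

Lemma measurable_step_section n F w : measurable_fun setT F ->
  measurable_fun setT (fun t => F (seq_upd n w t) * (rho n (w, t))%:E).
Proof.
move=> mF.
exact: (measurableT_comp (measurable_step_integrand n mF) (pair1_measurable w)).
Qed.

Lemma measurable_step n F : measurable_fun setT F -> (forall w, 0 <= F w) ->
  measurable_fun setT (it_step n F).
Proof.
move=> mF F0; rewrite /it_step.
apply: (@measurable_fun_fubini_tonelli_F _ _ _ _ _ (P n)
  (fun z : Seq T * T => F (seq_upd n z.1 z.2) * (rho n z)%:E)).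
  exact: measurable_step_integrand.
by move=> z; rewrite mule_ge0// lee_fin.
Qed.

Lemma steps_ge0 m n F : (forall w, 0 <= F w) -> forall w, 0 <= it_steps n m F w.
Proof. by elim: m n => [//|m ih] n F0 /=; apply: step_ge0; apply: ih. Qed.

Lemma measurable_steps m n F : measurable_fun setT F -> (forall w, 0 <= F w) ->
  measurable_fun setT (it_steps n m F).
Proof.
elim: m n => [//|m ih] n mF F0 /=; apply: measurable_step; first exact: ih.
exact: steps_ge0.
Qed.

Lemma stepD n F G : measurable_fun setT F -> (forall w, 0 <= F w) ->
  measurable_fun setT G -> (forall w, 0 <= G w) ->
  it_step n (F \+ G) = it_step n F \+ it_step n G.
Proof.
move=> mF F0 mG G0; apply/funext => w; rewrite /it_step /=.
rewrite -ge0_integralD//; first last.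
- exact: measurable_step_section.
- by move=> t _; rewrite mule_ge0// lee_fin.
- exact: measurable_step_section.
- by move=> t _; rewrite mule_ge0// lee_fin.
by apply: eq_integral => t _; rewrite ge0_muleDl.
Qed.

Lemma stepZ n c F : (0 <= c)%R -> measurable_fun setT F -> (forall w, 0 <= F w) ->
  it_step n (fun w => c%:E * F w) = fun w => c%:E * it_step n F w.
Proof.
move=> c0 mF F0; apply/funext => w; rewrite /it_step -ge0_integralZl//.
- by apply: eq_integral => t _; rewrite muleA.
- exact: measurable_step_section.
- by move=> t _; rewrite mule_ge0// lee_fin.
Qed.

Lemma le_step n F G : measurable_fun setT F -> (forall w, 0 <= F w) ->
  measurable_fun setT G -> (forall w, F w <= G w) ->
  forall w, it_step n F w <= it_step n G w.
Proof.
move=> mF F0 mG FG w; apply: ge0_le_integral => //.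
- by move=> t _; rewrite mule_ge0// lee_fin.
- exact: measurable_step_section.
- exact: measurable_step_section.
- by move=> t _; rewrite lee_wpmul2r// lee_fin.
Qed.

Lemma step_lim n (F : (Seq T -> \bar R)^nat) :
  (forall k, measurable_fun setT (F k)) -> (forall k w, 0 <= F k w) ->
  (forall w, nondecreasing_seq (F ^~ w)) ->
  it_step n (fun w => limn (F ^~ w)) = fun w => limn (fun k => it_step n (F k) w).
Proof.
move=> mF F0 ndF; apply/funext => w; rewrite /it_step.
rewrite -monotone_convergence//; first last.
- by move=> t _ k l kl; rewrite lee_wpmul2r ?lee_fin//; exact: ndF.
- by move=> k t _; rewrite mule_ge0// lee_fin.
- by move=> k; exact: measurable_step_section.
apply: eq_integral => t _; rewrite muleC; apply/esym/cvg_lim => //.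
under eq_fun do rewrite muleC.
apply: cvgeZl => //.
by apply: ereal_nondecreasing_is_cvgn; exact: ndF.
Qed.

Lemma stepsD m n F G : measurable_fun setT F -> (forall w, 0 <= F w) ->
  measurable_fun setT G -> (forall w, 0 <= G w) ->
  it_steps n m (F \+ G) = it_steps n m F \+ it_steps n m G.
Proof.
elim: m n => [//|m ih] n mF F0 mG G0 /=; rewrite ih// stepD//;
  by [exact: measurable_steps|exact: steps_ge0].
Qed.

Lemma stepsZ m n c F : (0 <= c)%R -> measurable_fun setT F ->
  (forall w, 0 <= F w) ->
  it_steps n m (fun w => c%:E * F w) = fun w => c%:E * it_steps n m F w.
Proof.
elim: m n => [//|m ih] n c0 mF F0 /=; rewrite ih// stepZ//;
  by [exact: measurable_steps|exact: steps_ge0].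
Qed.

Lemma le_steps m n F G : measurable_fun setT F -> (forall w, 0 <= F w) ->
  measurable_fun setT G -> (forall w, F w <= G w) ->
  forall w, it_steps n m F w <= it_steps n m G w.
Proof.
elim: m n => [|m ih] n mF F0 mG FG; first exact: FG.
have G0 w : 0 <= G w by exact: le_trans (F0 w) (FG w).
apply: le_step; [exact: measurable_steps|exact: steps_ge0|
  exact: measurable_steps|exact: ih].
Qed.

Lemma steps_lim m n (F : (Seq T -> \bar R)^nat) :
  (forall k, measurable_fun setT (F k)) -> (forall k w, 0 <= F k w) ->
  (forall w, nondecreasing_seq (F ^~ w)) ->
  it_steps n m (fun w => limn (F ^~ w)) = fun w => limn (fun k => it_steps n m (F k) w).
Proof.
elim: m n => [//|m ih] n mF F0 ndF /=; rewrite ih// step_lim//.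
- by move=> k; exact: measurable_steps.
- by move=> k; exact: steps_ge0.
- move=> w k l kl; apply: le_steps => //.
  by move=> v; exact: ndF.
Qed.

(** The kernel has total mass one, so integrating a coordinate on which F does not depend changes
    nothing. This is the source of consistency. *)
Lemma step_dep n F : dep_lt n F -> measurable_fun setT F ->
  (forall w, 0 <= F w) -> it_step n F = F.
Proof.
move=> dF mF F0; apply/funext => w; rewrite /it_step.
transitivity (\int[P n]_t (F w * (rho n (w, t))%:E)).
  apply: eq_integral => t _; congr (_ * _); apply: dF => i.
  by rewrite /seq_upd; case: eqP => // ->; rewrite ltnn.
rewrite ge0_integralZl ?rho1 ?mule1//.
  apply/measurable_EFinP.
  exact: (measurableT_comp (mrho n) (pair1_measurable w)).
by move=> t _; rewrite lee_fin.
Qed.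

Lemma dep_step n F : dep_lt n.+1 F -> dep_lt n (it_step n F).
Proof.
move=> dF x y xy; apply: eq_integral => t _; congr (_ * _%:E).
  apply: dF => i; rewrite /seq_upd ltnS leq_eqVlt.
  by case: eqP => //= _; exact: xy.
exact: rho_dep.
Qed.

Lemma dep_steps m n F : dep_lt (n + m) F -> dep_lt n (it_steps n m F).
Proof.
elim: m n => [|m ih] n; first by rewrite addn0.
by rewrite addnS -addSn => dF /=; apply: dep_step; exact: ih.
Qed.

Lemma dep_ltW n m U (F : Seq T -> U) : (n <= m)%N -> dep_lt n F -> dep_lt m F.
Proof. by move=> nm dF x y xy; apply: dF => i /leq_trans/(_ nm); exact: xy. Qed.

Lemma stepsS n m F : it_steps n m.+1 F = it_steps n m (it_step (n + m) F).
Proof.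
elim: m n => [|m ih] n; first by rewrite /= addn0.
by rewrite addnS -addSn [LHS]/= -/(it_steps n.+1 m.+1 F) ih.
Qed.

(** Consistency of the finite-dimensional laws: steps beyond the dependence of F act trivially. *)
Lemma steps_dep_eq n N m F : dep_lt N F -> measurable_fun setT F ->
  (forall w, 0 <= F w) -> (N <= n + m)%N ->
  forall k, it_steps n (m + k) F = it_steps n m F.
Proof.
move=> dF mF F0 Nnm; elim=> [|k ih]; first by rewrite addn0.
rewrite addnS stepsS step_dep//; apply: dep_ltW dF.
by rewrite addnA (leq_trans Nnm)// leq_addr.
Qed.

Lemma steps_dep_eq2 n N m m' F : dep_lt N F -> measurable_fun setT F ->
  (forall w, 0 <= F w) -> (N <= n + m)%N -> (N <= n + m')%N ->
  it_steps n m F = it_steps n m' F.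
Proof.
move=> dF mF F0 h h'.
have [mm'|/ltnW mm'] := leqP m m'.
  by rewrite -(subnKC mm') (steps_dep_eq dF mF F0 h).
by rewrite -(subnKC mm') (steps_dep_eq dF mF F0 h').
Qed.

End ionescu_tulcea.

(** * Extension from cylinders to a probability on sequences *)

Section cylinders.
Context {d} {T : measurableType d}.

(** An alias of its own for the sequences, so that it can carry the algebra of cylinders while
    [Seq T] carries the generated sigma-algebra. *)
Definition cylinder_type : Type := nat -> T.

HB.instance Definition _ := Pointed.on cylinder_type.

Definition cylinder : set (set cylinder_type) :=
  [set A | measurable (A : set (Seq T)) /\ exists n, dep_lt n A].

Lemma cylinder0 : cylinder set0.
Proof. by split; [exact: measurable0|exists 0%N]. Qed.

Lemma cylinderU : setU_closed cylinder.
Proof.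
move=> A B [mA [n dA]] [mB [m dB]]; split; first exact: measurableU.
exists (maxn n m) => x y xy; rewrite /setU /mkset.
by rewrite (dA x y) ?(dB x y)// => i im; apply: xy; rewrite leq_max im ?orbT.
Qed.

Lemma cylinderC : setC_closed cylinder.
Proof.
move=> A [mA [n dA]]; split; first exact: measurableC.
by exists n => x y xy; rewrite /setC /mkset (dA x y).
Qed.

HB.instance Definition _ := isAlgebraOfSets.Build d cylinder_type
  cylinder0 cylinderU cylinderC.

Lemma cylinder_sigma :
  (<<s cylinder >> : set (set (Seq T))) = (@measurable _ (Seq T)).
Proof.
rewrite eqEsubset; split.
  apply: smallest_sub; first exact: sigma_algebra_measurable.
  by move=> A [].
apply: sub_sigma_algebra2 => _ [i _ [A mA <-]]; split.
  by rewrite -[X in measurable X]setTI; exact: measurable_coord.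
by exists i.+1 => x y xy; rewrite /preimage /mkset xy.
Qed.

Lemma dep_lt_indic {R : realType} n (A : set (nat -> T)) : dep_lt n A ->
  dep_lt n (EFin \o \1_A : (nat -> T) -> \bar R).
Proof.
move=> dA x y xy; rewrite /= !indicE; congr (_%:R%:E).
by congr (nat_of_bool _); apply/idP/idP; rewrite !inE (dA x y).
Qed.

End cylinders.
Arguments cylinder_type {d} T.

Section ionescu_tulcea_measure.
Context {d} {T : measurableType d} {R : realType}.
Context (P : nat -> probability T R) (rho : nat -> Seq T * T -> R).
Context (rho_ge0 : forall n z, 0 <= rho n z).
Context (mrho : forall n, measurable_fun setT (rho n)).
Context (rho_dep : forall n t, dep_lt n (fun w => rho n (w, t))).
Context (rho1 : forall n (w : Seq T), (\int[P n]_t (rho n (w, t))%:E = 1)%E).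
Context (w0 : Seq T).
Local Open Scope ereal_scope.
Implicit Types (F G : Seq T -> \bar R) (w : Seq T).

Local Notation step := (it_step P rho).
Local Notation steps := (it_steps P rho).
Local Notation ind A := (EFin \o \1_A : Seq T -> \bar R).

(** Some bound on the coordinates that A depends on, not necessarily the least; by [cyl_valE] all
    bounds lead to the same value. *)
Definition level (A : set (Seq T)) : nat := xget 0%N [set n | dep_lt n A].

(** The conditional probability of A given the first n coordinates: started at n, [level A] steps
    reach past every coordinate that A depends on. *)
Definition cyl_val n (A : set (Seq T)) : Seq T -> \bar R :=
  steps n (level A) (ind A).

Definition cyl_content (A : set (cylinder_type T)) : \bar R := cyl_val 0 A w0.

Lemma levelP (A : set (Seq T)) : (exists n, dep_lt n A) -> dep_lt (level A) A.
Proof. by move=> ex; apply: (xgetPex (P := [set n | dep_lt n A]) 0%N ex). Qed.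

Lemma measurable_ind (A : set (Seq T)) : measurable A ->
  measurable_fun setT (ind A).
Proof. by move=> mA; apply/measurable_EFinP; exact: measurable_indic. Qed.

Lemma ind_ge0 (A : set (Seq T)) w : 0 <= ind A w.
Proof. by rewrite lee_fin. Qed.
Hint Resolve ind_ge0 : core.

Lemma cyl_valE n m N (A : set (Seq T)) : measurable A -> dep_lt N A ->
  (N <= n + m)%N -> cyl_val n A = steps n m (ind A).
Proof.
move=> mA dA Nnm; rewrite /cyl_val.
have dl : dep_lt (level A) A by apply: levelP; exists N.
have mi := measurable_ind mA.
have h M : dep_lt M A -> forall m1 m2, (M <= n + m1)%N -> (M <= n + m2)%N ->
    steps n m1 (ind A) = steps n m2 (ind A).
  move=> dM m1 m2 h1 h2.
  exact: (steps_dep_eq2 rho_ge0 mrho rho1 (dep_lt_indic dM) mi (@ind_ge0 A)).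
have l1 : (level A <= n + level A)%N by rewrite leq_addl.
have l2 : (level A <= n + (m + level A))%N by rewrite addnA leq_addl.
have l3 : (N <= n + (m + level A))%N by rewrite addnA (leq_trans Nnm)// leq_addr.
by rewrite (h _ dl _ _ l1 l2) (h _ dA _ _ l3 Nnm).
Qed.

Lemma cyl_val_step n (A : set (Seq T)) : measurable A -> (exists N, dep_lt N A) ->
  cyl_val n A = step n (cyl_val n.+1 A).
Proof.
move=> mA exA; have dl := levelP exA.
by rewrite (@cyl_valE n (level A).+1 (level A))//; lia.
Qed.

Lemma cyl_val_ge0 n (A : set (Seq T)) w : 0 <= cyl_val n A w.
Proof. exact: steps_ge0. Qed.
Hint Resolve cyl_val_ge0 : core.

Lemma measurable_cyl_val n (A : set (Seq T)) : measurable A ->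
  measurable_fun setT (cyl_val n A).
Proof. by move=> mA; apply: measurable_steps => //; exact: measurable_ind. Qed.

Lemma dep_cyl_val n (A : set (Seq T)) : (exists N, dep_lt N A) ->
  dep_lt n (cyl_val n A).
Proof.
move=> exA; rewrite /cyl_val; apply: dep_steps => //.
by apply: (dep_ltW (leq_addl n _)); exact/dep_lt_indic/levelP.
Qed.

Lemma cyl_val_late n N (A : set (Seq T)) : measurable A -> dep_lt N A ->
  (N <= n)%N -> cyl_val n A = ind A.
Proof.
move=> mA dA Nn; rewrite (@cyl_valE n 0 N)// addn0//.
Qed.

Lemma cyl_content_ge0 A : 0 <= cyl_content A.
Proof. exact: cyl_val_ge0. Qed.

Lemma cyl_content_semi_additive : measure_function.semi_additive cyl_content.
Proof.
move=> F n mF tF _.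
have Hgen : forall k, (k <= n)%N ->
    cyl_content (\big[setU/set0]_(i < k) F i) = \sum_(i < k) cyl_content (F i).
  elim=> [_|k ih kn].
    rewrite !big_ord0 /cyl_content (@cyl_valE 0 0 0)//=.
    by rewrite indic0.
  rewrite !big_ord_recr /= -ih; last exact: ltnW.
  set U := \big[setU/set0]_(i < k) F i.
  have cU : measurable (U : set (cylinder_type T)).
    by apply: bigsetU_measurable => i _; exact: mF.
  have [mU [a da]] := cU; have [mk [b db]] := mF k.
  have [mUk [c dc]] : measurable (U `|` F k : set (cylinder_type T)).
    exact: measurableU.
  rewrite /cyl_content (@cyl_valE 0 (a + b + c) c)//; last by lia.
  rewrite (@cyl_valE 0 (a + b + c) a)//; last by lia.
  rewrite (@cyl_valE 0 (a + b + c) b)//; last by lia.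
  have -> : ind (U `|` F k) = ind U \+ ind (F k).
    apply/funext => w /=; rewrite -EFinD; congr (_%:E).
    rewrite !indicE in_setU; case: (boolP (w \in U)) => wU; last by rewrite add0r.
    case: (boolP (w \in F k)) => wF; last by rewrite addr0.
    move: wU; rewrite inE /U -bigcup_mkord => -[i /= ik Fi].
    have : i = k by apply: (tF i k I I); exists w; split => //; rewrite inE in wF.
    by move=> ik'; rewrite ik' ltnn in ik.
  rewrite stepsD //; exact: measurable_ind.
exact: Hgen.
Qed.

HB.instance Definition _ := isContent.Build d (cylinder_type T) R cyl_content
  cyl_content_ge0 cyl_content_semi_additive.


(** By monotone convergence the martingale property of [cyl_val_step] passes to countable sums. *)
Lemma cyl_val_series_step n (F : (set (Seq T))^nat) :
  (forall k, measurable (F k)) -> (forall k, exists N, dep_lt N (F k)) ->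
  (fun w => \sum_(k <oo) cyl_val n (F k) w) =
  step n (fun w => \sum_(k <oo) cyl_val n.+1 (F k) w).
Proof.
move=> mF dF; apply/funext => w; rewrite /it_step.
transitivity (\int[P n]_t
    \sum_(k <oo) (cyl_val n.+1 (F k) (seq_upd n w t) * (rho n (w, t))%:E)).
  rewrite integral_nneseries//; first last.
  - by move=> k t _; rewrite mule_ge0// lee_fin.
  - move=> k; apply: measurable_step_section => //.
    exact: measurable_cyl_val.
  by apply: eq_eseriesr => k _; rewrite (cyl_val_step n (mF k) (dF k)).
apply: eq_integral => t _; rewrite muleC -nneseriesZl//.
by apply: eq_eseriesr => k _; rewrite muleC.
Qed.

Lemma measurable_cyl_val_series n (F : (set (Seq T))^nat) :
  (forall k, measurable (F k)) ->
  measurable_fun setT (fun w => \sum_(k <oo) cyl_val n (F k) w).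
Proof.
by move=> mF; apply: ge0_emeasurable_sum => // k _; exact: measurable_cyl_val.
Qed.

(* If the inequality failed at time 0, it would fail along a path built one
   coordinate at a time, hence at the limit path, where both sides are
   indicators. *)
Lemma cyl_content_sigma_subadditive :
  measurable_subset_sigma_subadditive cyl_content.
Proof.
move=> A F cF [mA dA] AF.
have mF k : measurable (F k : set (Seq T)) by have [] := cF k.
have dF k : exists N, dep_lt N (F k) by have [] := cF k.
rewrite leNgt; apply/negP => h0.
pose V n w := cyl_val n A w.
pose E n w := \sum_(k <oo) cyl_val n (F k) w.
have E0 n w : 0 <= E n w by apply: nneseries_ge0.
have mE n : measurable_fun setT (E n) by exact: measurable_cyl_val_series.
(* If every t gave the reverse inequality at time n + 1, integrating against the kernel would give
   it at time n. The implication form makes the statement total, as [choice] requires. *)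
have nxt n w : exists w', (E n w < V n w -> E n.+1 w' < V n.+1 w') /\
    exists t, w' = seq_upd n w t.
  have [[t ht]|nex] := pselect (exists t, E n.+1 (seq_upd n w t) <
                                          V n.+1 (seq_upd n w t)).
    by exists (seq_upd n w t); split => //; exists t.
  exists (seq_upd n w point); split; last by exists point.
  rewrite ltNge => /negP; case.
  have -> : E n w = step n (E n.+1) w.
    exact: (congr1 (@^~ w) (cyl_val_series_step n mF dF)).
  rewrite /V (cyl_val_step n mA dA) /it_step.
  apply: ge0_le_integral => //.
  - by move=> t _; rewrite mule_ge0// lee_fin.
  - by apply: measurable_step_section => //; exact: measurable_cyl_val.
  - by apply: measurable_step_section => //; exact: mE.
  - move=> t _; rewrite lee_wpmul2r ?lee_fin// leNgt; apply/negP => h.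
    by apply: nex; exists t.
have /choice[g gP] : forall nw : nat * Seq T, exists w' : Seq T,
    (E nw.1 nw.2 < V nw.1 nw.2 -> E nw.1.+1 w' < V nw.1.+1 w') /\
    exists t, w' = seq_upd nw.1 nw.2 t by move=> [n w]; exact: nxt.
pose W := fix W n : Seq T := if n is m.+1 then g (m, W m) else w0.
have hW n : E n (W n) < V n (W n).
  by elim: n => [//|n ih] /=; apply: (proj1 (gP (n, W n))).
have WS n i : i != n -> W n.+1 i = W n i.
  move=> ni /=; have [_ [t ->]] := gP (n, W n).
  by rewrite /seq_upd /= (negbTE ni).
have Wst n i : (i < n)%N -> W n i = W i.+1 i.
  elim: n => [//|n ih]; rewrite ltnS leq_eqVlt => /orP[/eqP -> //|ni].
  by rewrite WS ?ih// ltn_eqF.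
(* Coordinate i is set in the passage from [W i] to [W i.+1] and never changes afterwards. *)
pose Winf : Seq T := fun i => W i.+1 i.
have hinf n : E n Winf < V n Winf.
  have agr i : (i < n)%N -> W n i = Winf i by move=> ni; rewrite Wst.
  have VE : V n (W n) = V n Winf by apply: dep_cyl_val.
  have EE : E n (W n) = E n Winf.
    by apply: eq_eseriesr => k _; exact: (dep_cyl_val (dF k) agr).
  by rewrite -VE -EE.
have [a da] := dA.
have AW : A Winf.
  have := hinf a; rewrite /V (cyl_val_late mA da)// /= indicE.
  case: (boolP (Winf \in A)) => [/set_mem//|_].
  by rewrite ltNge E0.
have [k _ FkW] := AF _ AW.
have [b db] := dF k.
have := hinf (maxn a b); rewrite ltNge => /negP; apply.
rewrite /V (cyl_val_late mA da) ?leq_maxl// /= indicE mem_set//=.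
apply: (@le_trans _ _ (cyl_val (maxn a b) (F k) Winf)).
  by rewrite (cyl_val_late (mF k) db) ?leq_maxr//= indicE mem_set.
rewrite /E; apply: le_trans (nneseries_lim_ge k.+1 _) => //=.
rewrite big_nat_recr//= leeDr// sume_ge0//.
Qed.

HB.instance Definition _ := Content_SigmaSubAdditive_isMeasure.Build d R
  (cylinder_type T) cyl_content cyl_content_sigma_subadditive.

Definition it_measure (A : set (Seq T)) : \bar R :=
  measure_extension (cyl_content : {measure set (cylinder_type T) -> \bar R}) A.

Let it_measure0 : it_measure set0 = 0.
Proof. by rewrite /it_measure measure0. Qed.

Let it_measure_ge0 A : 0 <= it_measure A.
Proof. exact: measure_ge0. Qed.

Let it_measure_sigma_additive : semi_sigma_additive it_measure.
Proof.
move=> F mF tF mUF; apply: (@measure_semi_sigma_additive _ _ _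
  (measure_extension (cyl_content : {measure set (cylinder_type T) -> \bar R})))
  => //.
- by move=> i; have := mF i; rewrite -cylinder_sigma.
- by move: mUF; rewrite -cylinder_sigma.
Qed.

HB.instance Definition _ := isMeasure.Build _ (Seq T) R it_measure
  it_measure0 it_measure_ge0 it_measure_sigma_additive.

Lemma it_measure_cylinder n (A : set (Seq T)) : measurable A -> dep_lt n A ->
  it_measure A = steps 0 n (ind A) w0.
Proof.
move=> mA dA; rewrite -(@cyl_valE 0 n n A)// -/(cyl_content A).
by rewrite /it_measure /measure_extension measurable_mu_extE//; split => //; exists n.
Qed.

Let it_measure_setT : it_measure setT = 1.
Proof.
rewrite (@it_measure_cylinder 0)//.
by rewrite /= indicT.
Qed.

HB.instance Definition _ := Measure_isProbability.Build _ _ R it_measure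
  it_measure_setT.

Definition it_prob : probability (Seq T) R := it_measure.

Lemma integral_it_dep n F : measurable_fun setT F -> (forall w, 0 <= F w) ->
  dep_lt n F -> \int[it_prob]_w F w = steps 0 n F w0.
Proof.
move=> mF F0 dF.
(* Composition with [tr] makes any function depend on the first n coordinates only, so the induction
   can run over all measurable functions instead of that restricted class. *)
pose tr (w : Seq T) : Seq T := seq_splice n w w0.
have mtr : measurable_fun setT tr.
  apply: (measurableT_comp (measurable_seq_splice n)
           (g := fun w : Seq T => (w, w0))).
  exact: measurable_fun_pair.
have Ftr : F = F \o tr.
  by apply/funext => w; apply: dF => i ni; rewrite /tr /seq_splice ni.
rewrite Ftr.
have dtr U (G : Seq T -> U) : dep_lt n (G \o tr).
  move=> x y xy /=; congr G; apply/funext => i; rewrite /tr /seq_splice.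
  by case: ifP => // /xy.
move: F mF F0 {dF Ftr}; apply: ge0_measurable_fun_ind.
- move=> A mA.
  have mtA : measurable (tr @^-1` A) by rewrite -[X in measurable X]setTI; exact: mtr.
  have -> : (EFin \o \1_A) \o tr = ind (tr @^-1` A) by [].
  rewrite (integral_indic it_prob measurableT mtA) setIT.
  exact: (it_measure_cylinder mtA (@dtr _ A)).
- move=> F G mF F0 mG G0 hF hG.
  have -> : (F \+ G) \o tr = (F \o tr) \+ (G \o tr) by [].
  rewrite ge0_integralD//=; [|exact: measurableT_comp|exact: measurableT_comp].
  rewrite stepsD//; [|exact: measurableT_comp|exact: measurableT_comp].
  by rewrite hF hG.
- move=> c F c0 mF F0 hF.
  have mFt : measurable_fun setT (F \o tr) by exact: measurableT_comp.
  have -> : (fun x => c%:E * F x) \o tr = (fun x => c%:E * (F \o tr) x) by [].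
  rewrite ge0_integralZl//; last by move=> x _; exact: F0.
  have F0t w : 0 <= (F \o tr) w by exact: F0.
  rewrite (stepsZ P rho_ge0 mrho n 0 c0 mFt F0t); congr (_ * _); exact: hF.
- move=> F mF F0 ndF hF.
  have mFt k : measurable_fun setT (F k \o tr) by exact: measurableT_comp.
  transitivity (limn (fun k => \int[it_prob]_w (F k \o tr) w)).
    rewrite -monotone_convergence//; first by move=> k w _; exact: F0.
    by move=> w _; exact: ndF.
  rewrite (_ : (fun w => _) \o tr = fun w => limn ((fun k => F k \o tr) ^~ w))//.
  rewrite (steps_lim P rho_ge0 mrho)//; last by move=> w; exact: ndF.
    by under eq_fun do rewrite hF.
  by move=> k w; exact: F0.
Qed.

Lemma integral_it_step n F : measurable_fun setT F -> (forall w, 0 <= F w) ->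
  dep_lt n.+1 F -> \int[it_prob]_w F w = \int[it_prob]_w step n F w.
Proof.
move=> mF F0 dF; rewrite (integral_it_dep mF F0 dF) stepsS add0n.
rewrite (@integral_it_dep n)//; first exact: measurable_step.
- exact: step_ge0.
- exact: dep_step.
Qed.

End ionescu_tulcea_measure.

(** * Infinite product measures *)

Section seq_product.
Context {d} {T : measurableType d} {R : realType} (P : nat -> probability T R).

Let one (n : nat) (z : Seq T * T) : R := 1.
Let one_ge0 n z : 0 <= one n z. Proof. by []. Qed.
Let mone n : measurable_fun setT (one n). Proof. exact: measurable_cst. Qed.
Let one_dep n t : dep_lt n (fun w => one n (w, t)). Proof. by []. Qed.
Let one1 n (w : Seq T) : (\int[P n]_t (one n (w, t))%:E = 1)%E.
Proof.
transitivity (\int[P n]_t (cst 1%E t))%E; first by [].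
by rewrite integral_cst// mul1e; exact: probability_setT.
Qed.

(** The product law is the chain whose transition densities are identically one. *)
Definition seq_prod : probability (Seq T) R :=
  it_prob one_ge0 mone one_dep one1 point.

Definition rect (A : nat -> set T) m : set (Seq T) :=
  [set w | forall i, (i < m)%N -> A i (w i)].

Lemma rectS A m : rect A m.+1 = rect A m `&` [set w | A m (w m)].
Proof.
apply/seteqP; split => [w h|w [h hm] i].
  by split => [i im|]; apply: h => //; rewrite ltnW.
by rewrite ltnS leq_eqVlt => /orP[/eqP ->//|]; exact: h.
Qed.

Lemma measurable_rect A m : (forall i, measurable (A i)) -> measurable (rect A m).
Proof.
move=> mA; elim: m => [|m ih].
  by rewrite (_ : rect A 0 = setT)//; apply/seteqP; split.
rewrite rectS; apply: measurableI => //.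
by rewrite -[X in measurable X]setTI; exact: (measurable_coord m measurableT (mA m)).
Qed.

Lemma seq_prod_rect A m : (forall i, measurable (A i)) ->
  seq_prod (rect A m) = (\prod_(i < m) fine (P i (A i)))%:E.
Proof.
move=> mA; elim: m => [|m ih].
  rewrite big_ord0 (_ : rect A 0 = setT) ?probability_setT//.
  by apply/seteqP; split.
have dA k : dep_lt k (rect A k).
  move=> x y xy; apply/propext; split => h i ik; [rewrite -xy//|rewrite xy//];
  exact: h.
have mr k := measurable_rect k mA.
transitivity (\int[seq_prod]_w (\1_(rect A m.+1) w)%:E)%E.
  by rewrite integral_indic// setIT.
rewrite (@integral_it_step _ _ _ P one one_ge0 mone one_dep one1 point m)//; first last.
- exact/dep_lt_indic.
- by apply/measurable_EFinP; exact: measurable_indic.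
transitivity (\int[seq_prod]_w ((\1_(rect A m) w)%:E * P m (A m)))%E.
  apply: eq_integral => w _; rewrite /it_step.
  rewrite -[in RHS](setIT (A m)) -[X in (_ * X)%E](integral_indic (P m) measurableT (mA m)).
  rewrite -ge0_integralZl//; last by apply/measurable_EFinP; exact: measurable_indic.
  apply: eq_integral => t _; rewrite mule1 -EFinM; congr (_%:E).
  have E : rect A m.+1 (seq_upd m w t) = (rect A m w /\ A m t).
    rewrite rectS /setI /mkset; congr (_ /\ _); last by rewrite /seq_upd eqxx.
    apply: dA => i im; rewrite /seq_upd; case: eqP => // ie.
    by rewrite ie ltnn in im.
  have E' : (seq_upd m w t \in rect A m.+1) = (w \in rect A m) && (t \in A m).
    apply/idP/andP; first by move=> /set_mem; rewrite E => -[h1 h2]; rewrite !mem_set.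
    by move=> [/set_mem h1 /set_mem h2]; apply/mem_set; rewrite E.
  by rewrite !indicE E' -natrM mulnb.
rewrite ge0_integralZr//; last by apply/measurable_EFinP; exact: measurable_indic.
rewrite big_ord_recr/= EFinM fineK; last exact: fin_num_measure.
by congr (_ * _)%E; rewrite integral_indic// setIT; exact: ih.
Qed.

Lemma rect_sigma : @measurable _ (Seq T) =
  <<s [set B : set (Seq T) | exists A m, (forall i, measurable (A i)) /\
        B = rect A m] >>.
Proof.
apply/seteqP; split.
  apply: sub_sigma_algebra2 => _ [i _ [A mA <-]].
  exists (fun j => if j == i then A else setT), i.+1; split.
    by move=> j; case: ifP.
  apply/seteqP; split => [w Aw j ji|w /(_ i (ltnSn i))]; last by rewrite eqxx.
  by case: ifP => // /eqP ->.
apply: smallest_sub; first exact: sigma_algebra_measurable.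
by move=> _ [A [m [mA ->]]]; exact: measurable_rect.
Qed.

Lemma rect_unique (mu nu : probability (Seq T) R) :
  (forall A m, (forall i, measurable (A i)) -> mu (rect A m) = nu (rect A m)) ->
  forall B, measurable B -> mu B = nu B.
Proof.
move=> munu B mB.
apply: (@measure_unique _ R (Seq T) _ (fun=> setT) rect_sigma _ _ _ mu nu _ _ B mB) => //.
- move=> _ _ [A [m [mA ->]]] [A' [m' [mA' ->]]].
  exists (fun i => (if (i < m)%N then A i else setT) `&`
                   (if (i < m')%N then A' i else setT)), (maxn m m'); split.
    by move=> i; apply: measurableI; case: ifP.
  apply/seteqP; split => [w [h h'] i _|w h].
    by split; case: ifP => //; [exact: h|exact: h'].
  split => i im.
    by have := h i; rewrite leq_max im => /(_ isT)[].
  by have := h i; rewrite leq_max im orbT => /(_ isT)[].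
- by move=> _; exists (fun=> setT), 0%N; split => //; apply/seteqP; split.
- by rewrite bigcup_const//; exists point.
- by move=> _ [A [m [mA ->]]]; exact: munu.
- by move=> _; rewrite [X in (X < _)%E](_ : _ = 1%E) ?ltry//; exact: probability_setT.
Qed.

End seq_product.

(** * Images of probabilities and change of variables *)

Section transfer.
Context {d1 d2} {X : measurableType d1} {Y : measurableType d2} {R : realType}.

Lemma push_prob_exists (P : probability X R) (phi : X -> Y) :
  measurable_fun setT phi ->
  exists Q : probability Y R, forall A, Q A = P (phi @^-1` A).
Proof.
move=> mphi.
pose m1 := isMeasurableFun.Build _ _ _ _ _ mphi.
pose phi' : {mfun X >-> Y} := HB.pack phi m1.
by exists (distribution P phi').
Qed.

Lemma ge0_integral_transfer (P : probability X R)
    (Q : {measure set Y -> \bar R}) (phi : X -> Y) :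
  measurable_fun setT phi ->
  (forall A, measurable A -> Q A = P (phi @^-1` A)) ->
  forall F : Y -> \bar R, measurable_fun setT F -> (forall y, 0 <= F y)%E ->
  (\int[Q]_y F y = \int[P]_x F (phi x))%E.
Proof.
move=> mphi QP F mF F0.
pose m1 := isMeasurableFun.Build _ _ _ _ _ mphi.
pose phi' : {mfun X >-> Y} := HB.pack phi m1.
transitivity (\int[distribution P phi']_y F y)%E.
  by apply: eq_measure_integral => A mA _; rewrite QP.
exact: ge0_integral_distribution.
Qed.

End transfer.

Section seq_product_invariance.
Context {d} {T : measurableType d} {R : realType} (P : nat -> probability T R).
Local Notation Pt := (seq_prod P).

(** Resampling one coordinate independently preserves the product law: the image of [Pt \x P n]
    under [seq_upd] agrees with [Pt] on rectangles. This form of Fubini singles out a coordinate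
    without splitting the space. *)
Lemma seq_prod_upd n (F : Seq T -> \bar R) :
  measurable_fun setT F -> (forall w, 0 <= F w)%E ->
  (\int[Pt]_w F w = \int[Pt]_w \int[P n]_t F (seq_upd n w t))%E.
Proof.
move=> mF F0.
have mu := @measurable_seq_upd _ T n.
have [Q QE] := push_prob_exists (Pt \x P n)%E mu.
have PQ : forall A, measurable A -> Pt A = Q A.
  apply: rect_unique => A m mA; rewrite QE.
  have -> : (fun z : Seq T * T => seq_upd n z.1 z.2 : Seq T) @^-1` rect A m =
      rect (fun i => if i == n then setT else A i) m `*`
      (if (n < m)%N then A n else setT).
    apply/seteqP; split => [[w t] /= h|[w t] /= [h ht] i im /=].
      split => [i im|].
        by have := h i im; rewrite /seq_upd; case: ifP.
      by case: ifP => // nm; have := h n nm; rewrite /seq_upd eqxx.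
    have := h i im; rewrite /seq_upd; case: (eqVneq i n) => // ie _.
    by rewrite ie in im *; rewrite im in ht.
  have mA' i : measurable (if i == n then setT else A i) by case: ifP.
  have mA2 : measurable (if (n < m)%N then A n else setT) by case: ifP.
  transitivity (Pt (rect (fun i => if i == n then setT else A i) m) *
      P n (if (n < m)%N then A n else setT))%E; last first.
    exact: esym (product_measure1E Pt (P n) (measurable_rect m mA') mA2).
  rewrite !seq_prod_rect//; case: ifPn => [nm|]; last first.
    rewrite -leqNgt => mn; rewrite probability_setT mule1; congr (_%:E).
    apply: eq_bigr => i _; rewrite ltn_eqF//.
    exact: (leq_trans (ltn_ord i) mn).
  rewrite -[P n (A n)]fineK; last exact: fin_num_measure.
  rewrite -EFinM; congr (_%:E).
  rewrite (bigD1 (Ordinal nm))//= [in RHS](bigD1 (Ordinal nm))//= eqxx.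
  rewrite probability_setT mul1r mulrC; congr (_ * _).
  by apply: eq_bigr => i; rewrite -val_eqE /= => /negbTE ->.
rewrite (@eq_measure_integral _ _ _ _ Q)//; last by move=> A mA _; exact: PQ.
rewrite (ge0_integral_transfer mu (fun A _ => QE A) mF F0).
by rewrite fubini_tonelli1//; exact: (measurableT_comp mF mu).
Qed.

(** Resampling the whole future from time n on preserves the product law; the inner integral is the
    conditional expectation given the first n coordinates. *)
Lemma seq_prod_splice n (F : Seq T -> \bar R) :
  measurable_fun setT F -> (forall w, 0 <= F w)%E ->
  (\int[Pt]_w F w = \int[Pt]_x \int[Pt]_z F (seq_splice n x z))%E.
Proof.
move=> mF F0.
have mu := @measurable_seq_splice _ T n.
have [Q QE] := push_prob_exists (Pt \x Pt)%E mu.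
have PQ : forall A, measurable A -> Pt A = Q A.
  apply: rect_unique => A m mA; rewrite QE.
  have -> : (fun z : Seq T * Seq T => seq_splice n z.1 z.2 : Seq T) @^-1` rect A m =
      rect (fun i => if (i < n)%N then A i else setT) m `*`
      rect (fun i => if (i < n)%N then setT else A i) m.
    apply/seteqP; split => [[w t] /= h|[w t] /= [h ht] i im /=].
      by split => i im; have := h i im; rewrite /seq_splice; case: ifP.
    by have := h i im; have := ht i im; rewrite /seq_splice; case: ifP.
  have mA1 i : measurable (if (i < n)%N then A i else setT) by case: ifP.
  have mA2 i : measurable (if (i < n)%N then setT else A i) by case: ifP.
  transitivity (Pt (rect (fun i => if (i < n)%N then A i else setT) m) *
      Pt (rect (fun i => if (i < n)%N then setT else A i) m))%E; last first.
    exact: esym (product_measure1E Pt Pt (measurable_rect m mA1)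
      (measurable_rect m mA2)).
  rewrite !seq_prod_rect// -EFinM; congr (_%:E).
  rewrite -big_split/=; apply: eq_bigr => i _.
  by case: ifP => _; rewrite probability_setT ?mul1r ?mulr1.
rewrite (@eq_measure_integral _ _ _ _ Q)//; last by move=> A mA _; exact: PQ.
rewrite (ge0_integral_transfer mu (fun A _ => QE A) mF F0).
by rewrite fubini_tonelli1//; exact: (measurableT_comp mF mu).
Qed.

Lemma measurable_seq_prodf n (F : nat -> T -> R) :
  (forall i, measurable_fun setT (F i)) ->
  measurable_fun setT (fun w : Seq T => \prod_(i < n) F i (w i)).
Proof.
move=> mF; elim: n => [|n ih].
  rewrite (_ : (fun _ => _) = cst 1); first exact: measurable_cst.
  by apply/funext => w; rewrite big_ord0.
rewrite (_ : (fun _ => _) =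
    (fun w : Seq T => \prod_(i < n) F i (w i)) \* (fun w : Seq T => F n (w n))).
  2: by apply/funext => w; rewrite big_ord_recr.
apply: measurable_funM => //.
exact: (measurableT_comp (mF n) (measurable_coord n)).
Qed.

Lemma seq_prod_prodf n (F : nat -> T -> R) (c : nat -> R) :
  (forall i, measurable_fun setT (F i)) -> (forall i x, 0 <= F i x) ->
  (forall i, \int[P i]_x (F i x)%:E = (c i)%:E)%E ->
  (\int[Pt]_w (\prod_(i < n) F i (w i))%:E = (\prod_(i < n) c i)%:E)%E.
Proof.
move=> mF F0 Fc; elim: n => [|n ih].
  under eq_integral do rewrite big_ord0.
  by rewrite big_ord0 integral_cst// mul1e; exact: probability_setT.
have mp k := @measurable_seq_prodf k F mF.
rewrite (seq_prod_upd n); first last.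
- by move=> w; rewrite lee_fin prodr_ge0.
- exact/measurable_EFinP.
transitivity (\int[Pt]_w ((\prod_(i < n) F i (w i))%:E * (c n)%:E))%E.
  apply: eq_integral => w _; rewrite -Fc -ge0_integralZl//; first last.
  - by rewrite lee_fin prodr_ge0.
  - by move=> x _; rewrite lee_fin.
  - exact/measurable_EFinP.
  apply: eq_integral => t _; rewrite big_ord_recr/= -EFinM; congr (_%:E).
  rewrite /seq_upd eqxx; congr (_ * _).
  by apply: eq_bigr => i _; rewrite ltn_eqF.
have c0 : (0 <= (c n)%:E)%E by rewrite -Fc; apply: integral_ge0 => x _; rewrite lee_fin.
rewrite ge0_integralZr//.
- by rewrite ih -EFinM big_ord_recr.
- exact/measurable_EFinP.
- by move=> x _; rewrite lee_fin prodr_ge0.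
Qed.

End seq_product_invariance.

(** * Maximal couplings *)

Section integral_helpers.
Context {d} {T : measurableType d} {R : realType} (mu : {measure set T -> \bar R}).
Local Open Scope ereal_scope.

Lemma ge0_integral_mul_eq0 (f F : T -> \bar R) :
  measurable_fun setT f -> (forall x, 0 <= f x) ->
  measurable_fun setT F -> (forall x, 0 <= F x) ->
  \int[mu]_x f x = 0 -> \int[mu]_x (f x * F x) = 0.
Proof.
move=> mf f0 mF F0 h.
have /ae_eq_integral_abs ae : \int[mu]_x `|f x| = 0.
  by rewrite -[RHS]h; apply: eq_integral => x _; rewrite gee0_abs.
rewrite (@ge0_ae_eq_integral _ _ _ mu setT _ (cst 0))//.
- by rewrite integral0.
- exact: emeasurable_funM.
- by move=> x _; rewrite mule_ge0.
- by apply: filterS (ae measurableT mf) => x /= fx _; rewrite fx// mul0e.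
Qed.

Lemma integral_prob_cst (P : probability T R) (c : \bar R) : \int[P]_x c = c.
Proof.
transitivity (\int[P]_x (cst c x)); first by [].
rewrite integral_cst//; transitivity (c * 1); last by rewrite mule1.
by congr (_ * _); exact: probability_setT.
Qed.

End integral_helpers.

Section tv_coupling.
Context {d} {S : measurableType d} {R : realType} (P : probability S R).

(** The diagonal part of the maximal coupling is in general singular to [P \x P], and the diagonal
    need not be measurable. A flag marking that part gives the coupling a density; when the flag is
    set, the first point serves as both. *)
Definition flagged : Type := (bool * (S * S))%type.

Definition flagged_prob : probability flagged R :=
  (bernoulli_prob (2^-1 : R) \x (P \x P))%E.

Definition fstpt (z : flagged) : S := z.2.1.
Definition sndpt (z : flagged) : S := if z.1 then z.2.1 else z.2.2.

(** The total variation distance between g P and P, which is the mass that the coupling puts off the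
    diagonal. *)
Definition cpl_excess (g : S -> R) : \bar R :=
  (\int[P]_x (Num.max (g x - 1) 0)%:E)%E.

(* Density, with respect to bernoulli x P x P, of the maximal coupling of g P
   and P: the flag records that both points coincide. *)
Definition cpl_density (g : S -> R) (z : flagged) : R :=
  2 * (if z.1 then Num.min (g z.2.1) 1 else
    (fine (cpl_excess g))^-1 * Num.max (g z.2.1 - 1) 0 * Num.max (1 - g z.2.2) 0).

Lemma measurable_fstpt : measurable_fun setT fstpt.
Proof. exact: measurableT_comp measurable_fst measurable_snd. Qed.

Lemma measurable_sndpt : measurable_fun setT sndpt.
Proof.
apply: measurable_fun_ifT; first exact: measurable_fst.
  exact: measurable_fstpt.
exact: measurableT_comp measurable_snd measurable_snd.
Qed.

Context (g : S -> R) (mg : measurable_fun setT g) (g0 : forall x, 0 <= g x)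
  (g1 : (\int[P]_x (g x)%:E = 1)%E).

Let gp x := Num.max (g x - 1) 0.
Let gm x := Num.max (1 - g x) 0.
Let gn x := Num.min (g x) 1.
Let k := (fine (cpl_excess g))^-1.

Let gp0 x : 0 <= gp x. Proof. by rewrite le_max lexx orbT. Qed.
Let gm0 x : 0 <= gm x. Proof. by rewrite le_max lexx orbT. Qed.
Let gn0 x : 0 <= gn x. Proof. by rewrite le_min g0 ler01. Qed.
Let mgp : measurable_fun setT gp.
Proof. by apply: measurable_maxr => //; exact: measurable_funB. Qed.
Let mgm : measurable_fun setT gm.
Proof. by apply: measurable_maxr => //; exact: measurable_funB. Qed.
Let mgn : measurable_fun setT gn.
Proof. exact: measurable_minr. Qed.
Let emgp : measurable_fun setT (EFin \o gp). Proof. exact/measurable_EFinP. Qed.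
Let emgm : measurable_fun setT (EFin \o gm). Proof. exact/measurable_EFinP. Qed.
Let emgn : measurable_fun setT (EFin \o gn). Proof. exact/measurable_EFinP. Qed.
Let gE x : g x = gn x + gp x.
Proof. by rewrite /gn /gp minEle maxEle; case: ifPn => h; case: ifPn => h'; lra. Qed.
Let oneE x : 1 = gn x + gm x.
Proof. by rewrite /gn /gm minEle maxEle; case: ifPn => h; case: ifPn => h'; lra. Qed.
Let absE x : `|g x - 1| = gp x + gm x.
Proof.
rewrite /gp /gm !maxEle; case: ifPn => h; case: ifPn => h'.
- have -> : g x = 1 by lra.
  by rewrite subrr normr0 addr0.
- by rewrite ler0_norm//; lra.
- by rewrite ger0_norm; lra.
- by lra.
Qed.
Local Open Scope ereal_scope.

Let egp0 x : 0 <= (gp x)%:E. Proof. by rewrite lee_fin gp0. Qed.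
Let egm0 x : 0 <= (gm x)%:E. Proof. by rewrite lee_fin gm0. Qed.
Let egn0 x : 0 <= (gn x)%:E. Proof. by rewrite lee_fin gn0. Qed.
Hint Resolve egp0 egm0 egn0 : core.

Let k0 : (0 <= k)%R.
Proof.
rewrite invr_ge0 fine_ge0// /cpl_excess; apply: integral_ge0 => x _.
exact: egp0.
Qed.

Let intgn_gp : \int[P]_x (gn x)%:E + \int[P]_x (gp x)%:E = 1.
Proof.
rewrite -ge0_integralD//.
by rewrite -[RHS]g1; apply: eq_integral => x _; rewrite -EFinD -gE.
Qed.

Let intgn_gm : \int[P]_x (gn x)%:E + \int[P]_x (gm x)%:E = 1.
Proof.
rewrite -ge0_integralD//.
rewrite -[RHS](integral_prob_cst P).
by apply: eq_integral => x _; rewrite -EFinD -oneE.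
Qed.

Let intgn_fin : \int[P]_x (gn x)%:E \is a fin_num.
Proof.
have i0 : 0 <= \int[P]_x (gn x)%:E by apply: integral_ge0.
rewrite ge0_fin_numE//; apply: (@le_lt_trans _ _ 1); last by rewrite ltry.
by rewrite -intgn_gp leeDl//; apply: integral_ge0 => x _; exact: egp0.
Qed.

(** Both sides equal 1 minus the integral of min (g, 1), since g and 1 have the same mass. *)
Let intgp_eq_gm : \int[P]_x (gp x)%:E = \int[P]_x (gm x)%:E.
Proof.
have := intgn_gp; rewrite -intgn_gm => /(congr1 (fun x => x - \int[P]_x (gn x)%:E)).
by rewrite addeAC subee// add0e addeAC subee// add0e.
Qed.

Let intgp_fin : \int[P]_x (gp x)%:E \is a fin_num.
Proof.
have i0 : 0 <= \int[P]_x (gp x)%:E by apply: integral_ge0.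
rewrite ge0_fin_numE//; apply: (@le_lt_trans _ _ 1); last by rewrite ltry.
by rewrite -intgn_gp leeDr//; apply: integral_ge0 => x _; exact: egn0.
Qed.

Let kgp : \int[P]_x (gp x)%:E != 0 -> k%:E * \int[P]_x (gp x)%:E = 1.
Proof.
move=> t0; rewrite /k /cpl_excess -/gp -[X in _ * X]fineK// -EFinM mulVf//.
by apply: contra t0 => /eqP h; rewrite -(fineK intgp_fin) h.
Qed.

Lemma cpl_density_ge0 z : (0 <= cpl_density g z)%R.
Proof.
rewrite /cpl_density mulr_ge0//; case: ifP => _; first exact: gn0.
by rewrite !mulr_ge0//; [exact: gp0|exact: gm0].
Qed.

Lemma measurable_cpl_density : measurable_fun setT (cpl_density g).
Proof.
apply: measurable_funM; first exact: measurable_cst.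
apply: measurable_fun_ifT; first exact: measurable_fst.
  exact: (measurableT_comp mgn measurable_fstpt).
apply: measurable_funM; first apply: measurable_funM.
- exact: measurable_cst.
- exact: (measurableT_comp mgp measurable_fstpt).
- apply: (measurableT_comp mgm).
  exact: measurableT_comp measurable_snd measurable_snd.
Qed.

(** The factor 2 of the density cancels the weight 1/2 of each value of the flag. *)
Lemma integral_cpl_density (H : flagged -> \bar R) :
  measurable_fun setT H -> (forall z, 0 <= H z) ->
  \int[flagged_prob]_z ((cpl_density g z)%:E * H z) =
  \int[P]_x \int[P]_y ((gn x)%:E * H (true, (x, y))) +
  \int[P]_x \int[P]_y ((k * gp x * gm y)%:E * H (false, (x, y))).
Proof.
move=> mH H0.
have mD : measurable_fun setT (fun z : flagged => (cpl_density g z)%:E * H z).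
  apply: emeasurable_funM => //; apply/measurable_EFinP; exact: measurable_cpl_density.
have D0 z : 0 <= (cpl_density g z)%:E * H z.
  by rewrite mule_ge0// lee_fin cpl_density_ge0.
have mb b : measurable_fun setT (fun xy : S * S => (cpl_density g (b, xy))%:E * H (b, xy)).
  exact: (measurableT_comp mD (pair1_measurable b)).
rewrite /flagged_prob fubini_tonelli1//= integral_bernoulli_prob; last 2 first.
- by apply/andP; split; lra.
- by move=> b; apply: integral_ge0.
rewrite /fubini_F.
congr (_ + _).
- rewrite -ge0_integralZl//.
  rewrite fubini_tonelli1//; last 2 first.
  + by apply: measurable_funeM; exact: mb.
  + by move=> z; rewrite mule_ge0.
  apply: eq_integral => x _; apply: eq_integral => y _.
  by rewrite muleA -EFinM /cpl_density /= mulrA mulVf ?pnatr_eq0// mul1r.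
- rewrite -ge0_integralZl//; last by rewrite lee_fin /unstable.onem; lra.
  rewrite fubini_tonelli1//; last 2 first.
  + by apply: measurable_funeM; exact: mb.
  + by move=> z; rewrite mule_ge0// lee_fin /unstable.onem; lra.
  apply: eq_integral => x _; apply: eq_integral => y _.
  rewrite muleA -EFinM /cpl_density /= mulrA.
  have -> : (unstable.onem (2^-1 : R) * 2 = 1)%R by rewrite /unstable.onem; lra.
  by rewrite mul1r.
Qed.

Lemma integral_cpl_fstpt (F : S -> \bar R) :
  measurable_fun setT F -> (forall x, 0 <= F x) ->
  \int[flagged_prob]_z ((cpl_density g z)%:E * F (fstpt z)) =
  \int[P]_x ((g x)%:E * F x).
Proof.
move=> mF F0.
rewrite integral_cpl_density//; last first.
  exact: (measurableT_comp mF measurable_fstpt).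
rewrite /fstpt /=.
transitivity (\int[P]_x ((gn x)%:E * F x) + \int[P]_x ((gp x)%:E * F x)); last first.
  rewrite -ge0_integralD//; first last.
  - exact: emeasurable_funM.
  - by move=> x _; rewrite mule_ge0// lee_fin.
  - exact: emeasurable_funM.
  - by move=> x _; rewrite mule_ge0// lee_fin.
  apply: eq_integral => x _.
  by rewrite (gE x) EFinD ge0_muleDl// lee_fin.
congr (_ + _).
  by apply: eq_integral => x _; rewrite integral_prob_cst.
transitivity (\int[P]_x (((gp x)%:E * F x) * (k%:E * \int[P]_y (gm y)%:E))).
  apply: eq_integral => x _.
  rewrite muleA -ge0_integralZl//; last by rewrite !mule_ge0.
  apply: eq_integral => y _; rewrite !EFinM muleAC; congr (_ * _).
  by rewrite -muleA muleC.
rewrite -intgp_eq_gm ge0_integralZr//; first last.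
- by rewrite mule_ge0//; apply: integral_ge0.
- by move=> x _; rewrite mule_ge0.
- exact: emeasurable_funM.
have [t0|t0] := eqVneq (\int[P]_x (gp x)%:E) 0; last by rewrite kgp// mule1.
by rewrite t0 mule0 mule0 ge0_integral_mul_eq0.
Qed.

Lemma integral_cpl_sndpt (F : S -> \bar R) :
  measurable_fun setT F -> (forall x, 0 <= F x) ->
  \int[flagged_prob]_z ((cpl_density g z)%:E * F (sndpt z)) =
  \int[P]_x F x.
Proof.
move=> mF F0.
rewrite integral_cpl_density//; last first.
  exact: (measurableT_comp mF measurable_sndpt).
rewrite /sndpt /=.
transitivity (\int[P]_x ((gn x)%:E * F x) + \int[P]_x ((gm x)%:E * F x)); last first.
  rewrite -ge0_integralD//; first last.
  - exact: emeasurable_funM.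
  - by move=> x _; rewrite mule_ge0.
  - exact: emeasurable_funM.
  - by move=> x _; rewrite mule_ge0.
  apply: eq_integral => x _.
  by rewrite -ge0_muleDl// -EFinD -oneE mul1e.
congr (_ + _).
  by apply: eq_integral => x _; rewrite integral_prob_cst.
transitivity (\int[P]_x ((gp x)%:E * (k%:E * \int[P]_y ((gm y)%:E * F y)))).
  apply: eq_integral => x _.
  rewrite muleA -ge0_integralZl//; last by rewrite !mule_ge0.
  - by apply: eq_integral => y _; rewrite !EFinM [(gp x)%:E * _]muleC -!muleA.
  - exact: emeasurable_funM.
  - by move=> y _; rewrite mule_ge0.
have I0 : 0 <= \int[P]_y ((gm y)%:E * F y).
  by apply: integral_ge0 => y _; rewrite mule_ge0.
rewrite ge0_integralZr//; last by rewrite mule_ge0.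
have [t0|t0] := eqVneq (\int[P]_x (gp x)%:E) 0; last first.
  by rewrite muleA [X in X * _]muleC kgp// mul1e.
by rewrite t0 mul0e ge0_integral_mul_eq0// -intgp_eq_gm.
Qed.

(** Off the diagonal the two points are independent with densities proportional to (g - 1)^+ and (1
    - g)^+, whose common mass is cancelled by [k]; hence psi x contributes psi (g - 1)^+ and psi y
    contributes psi (1 - g)^+. *)
Lemma integral_cpl_cost (psi : S -> R) :
  measurable_fun setT psi -> (forall x, (0 <= psi x)%R) ->
  \int[flagged_prob]_z ((cpl_density g z)%:E *
     (if z.1 then 0%R else psi z.2.1 + psi z.2.2)%R%:E) <=
  \int[P]_x (psi x * `|g x - 1|)%R%:E.
Proof.
move=> mpsi psi0.
have mc : measurable_fun setT (fun z : flagged =>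
    (if z.1 then 0%R else psi z.2.1 + psi z.2.2)%R%:E).
  apply/measurable_EFinP; apply: measurable_fun_ifT.
  - exact: measurable_fst.
  - exact: measurable_cst.
  - apply: measurable_funD.
      exact: (measurableT_comp mpsi measurable_fstpt).
    apply: (measurableT_comp mpsi).
    exact: measurableT_comp measurable_snd measurable_snd.
rewrite integral_cpl_density//; last first.
  by move=> z; rewrite lee_fin; case: ifP => // _; rewrite addr_ge0.
rewrite /=.
under eq_integral do under eq_integral do rewrite mule0.
under eq_integral do rewrite integral0.
rewrite integral0 add0e.
have epsi0 x : 0 <= (psi x)%:E by rewrite lee_fin.
have empsi : measurable_fun setT (EFin \o psi) by exact/measurable_EFinP.
have mgmpsi : measurable_fun setT (fun x => (gm x)%:E * (psi x)%:E).
  exact: emeasurable_funM.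
have mgppsi : measurable_fun setT (fun x => (gp x)%:E * (psi x)%:E).
  exact: emeasurable_funM.
set tp := \int[P]_x (gp x)%:E.
have tp0 : 0 <= tp by apply: integral_ge0.
set A := \int[P]_x ((gp x)%:E * (psi x)%:E).
have A0 : 0 <= A by apply: integral_ge0 => x _; rewrite mule_ge0.
set B := \int[P]_x ((gm x)%:E * (psi x)%:E).
have B0 : 0 <= B by apply: integral_ge0 => x _; rewrite mule_ge0.
have -> : \int[P]_x (psi x * `|g x - 1|)%R%:E = A + B.
  rewrite -ge0_integralD//; [|by move=> x _; rewrite mule_ge0..].
  by apply: eq_integral => x _; rewrite absE EFinM muleC EFinD ge0_muleDl.
have -> : \int[P]_x \int[P]_y
    ((k * gp x * gm y)%:E * (psi x + psi y)%:E) = k%:E * tp * A + k%:E * tp * B.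
  transitivity (\int[P]_x ((gp x)%:E * (psi x)%:E * (k%:E * tp) +
                            (gp x)%:E * (k%:E * B))).
    apply: eq_integral => x _.
    rewrite {1}/tp intgp_eq_gm /B 2!muleA.
    rewrite -ge0_integralZl//; [|by rewrite !mule_ge0..].
    rewrite -[X in _ + X]ge0_integralZl//; first last.
    - by rewrite mule_ge0.
    - by move=> y _; rewrite mule_ge0.
    rewrite -ge0_integralD//; first last.
    - by apply: measurable_funeM.
    - by move=> y _; rewrite !mule_ge0.
    - by apply: measurable_funeM.
    - by move=> y _; rewrite !mule_ge0.
    apply: eq_integral => y _; rewrite -!EFinM -EFinD; congr (_%:E); ring.
  rewrite ge0_integralD//; first last.
  - exact: emeasurable_funM.
  - by move=> x _; rewrite !mule_ge0.
  - exact: emeasurable_funM.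
  - by move=> x _; rewrite !mule_ge0.
  rewrite ge0_integralZr//; last by rewrite mule_ge0.
    rewrite ge0_integralZr//; last by rewrite mule_ge0.
    by congr (_ + _); rewrite -/A -/tp; [rewrite muleC|rewrite muleCA muleA].
  by move=> x _; rewrite mule_ge0.
have [t0|t0] := eqVneq tp 0; first by rewrite t0 mule0 !mul0e adde0 adde_ge0.
by rewrite kgp// !mul1e.
Qed.

End tv_coupling.

(** * Entropy *)

Section entropy_function.
Context {R : realType}.
Implicit Types u a t : R.

(** For a density u the linear terms integrate to 0, so this nonnegative function has the same
    integral as u ln u. *)
Definition ent u : R := u * ln u - u + 1.

(** The inequality 1 + x <= e^x at x = t - ln u, multiplied by u. *)
Lemma ent_young t u : 0 <= u -> t * u <= u * ln u - u + expR t.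
Proof.
rewrite le_eqVlt => /predU1P[<-|u0].
  by rewrite mulr0 mul0r subr0 add0r expR_ge0.
have := expR_ge1Dx (t - ln u).
rewrite expRD expRN lnK ?posrE// => h.
have : u * (1 + (t - ln u)) <= u * (expR t / u) by rewrite ler_wpM2l// ltW.
by rewrite mulrCA divff ?mulr1 ?gt_eqF//; lra.
Qed.

Lemma ent_ge0 u : 0 <= u -> 0 <= ent u.
Proof. by move=> u0; have := ent_young 0 u0; rewrite expR0 mul0r /ent; lra. Qed.

(** Termwise comparison of the exponential series from degree two on. *)
Lemma exp_tail_le (x t C : R) : (forall k, x ^+ k.+2 <= C * t ^+ k.+2) ->
  expR x - 1 - x <= C * (expR t - 1 - t).
Proof.
move=> xt.
pose s (y : R) n := \sum_(0 <= i < n) exp_coeff y i.+2.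
have sE (y : R) : s y n @[n --> \oo] --> expR y - 1 - y.
  have E : s y = (fun n => series (exp_coeff y) (n + 2)%N - 1 - y).
    apply/funext => n; rewrite /s /series /= addn2 !big_nat_recl//= /exp_coeff /=.
    by rewrite expr0 expr1 fact0 !divr1; ring.
  rewrite E; apply: cvgB; last exact: cvg_cst.
  apply: cvgB; last exact: cvg_cst.
  by rewrite (cvg_shiftn 2 (series (exp_coeff y))); exact: is_cvg_series_exp_coeff.
have h : C * s t n @[n --> \oo] --> C * (expR t - 1 - t).
  by apply: cvgM; [exact: cvg_cst|exact: sE].
apply: (ler_cvg_to (sE x) h); near=> n.
rewrite /s mulr_sumr; apply: ler_sum => i _.
by rewrite /exp_coeff /= mulrA ler_wpM2r// invr_ge0.
Unshelve. all: by end_near. Qed.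

Lemma expRN_sub1_le t : 0 <= t -> expR (- t) - 1 + t <= expR t - 1 - t.
Proof.
move=> t0; have := @exp_tail_le (- t) t 1; rewrite mul1r opprK; apply => k.
rewrite mul1r exprNn; case: (odd k.+2) / boolP => o.
  by rewrite -signr_odd o expr1 mulN1r; rewrite (@le_trans _ _ 0) ?oppr_le0 ?exprn_ge0.
by rewrite -signr_odd (negbTE o) expr0 mul1r.
Qed.

(** All terms have degree at least two and r <= 1, so each gains r^2. With r = phi / M this produces
    sigma^2 / M^2; with r = 1 / k it measures the gain from splitting a cell into k copies. *)
Lemma exp_tail_scale r t : 0 <= r <= 1 -> 0 <= t ->
  expR (r * t) - 1 - r * t <= r ^+ 2 * (expR t - 1 - t).
Proof.
move=> /andP[r0 r1] t0; apply: exp_tail_le => k.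
rewrite exprMn ler_wpM2r ?exprn_ge0//.
by rewrite -addn2 exprD -[X in _ <= X]mul1r ler_wpM2r ?exprn_ge0// exprn_ile1.
Qed.

(** For u < 1 Young's inequality is used at - t, and [expRN_sub1_le] replaces the conjugate at - t
    by the one at t. *)
Lemma ent_young_abs t u : 0 <= t -> 0 <= u ->
  t * `|u - 1| <= ent u + (expR t - 1 - t).
Proof.
move=> t0 u0; rewrite /ent; have [u1|u1] := leP 1 u.
  by rewrite ger0_norm ?subr_ge0//; have := ent_young t u0; lra.
rewrite ltr0_norm ?subr_lt0//.
by have := ent_young (- t) u0; have := expRN_sub1_le t0; lra.
Qed.

(** The last term is linear in u and integrates to 0 when u has mean a; what remains is the chain
    rule for one conditioning step. *)
Lemma ent_tilt a u : 0 < a -> 0 <= u ->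
  ent u = a * ent (u / a) + ent a + (u - a) * ln a.
Proof.
move=> a0; rewrite le_eqVlt => /predU1P[<-|u0]; rewrite /ent.
  by rewrite !mul0r; ring.
rewrite ln_div ?posrE//.
by field; rewrite gt_eqF.
Qed.

Lemma measurable_ent : measurable_fun setT ent.
Proof.
apply: measurable_funD => //; apply: measurable_funB => //.
by apply: measurable_funM => //; exact: measurable_ln.
Qed.

End entropy_function.

Section jensen.
Context {d} {T : measurableType d} {R : realType} (P : probability T R).
Context (u : T -> R) (a : R) (mu : measurable_fun setT u)
  (u0 : forall x, 0 <= u x) (ua : (\int[P]_x (u x)%:E = a%:E)%E).
Local Open Scope ereal_scope.

Let a0 : (0 <= a)%R.
Proof. by rewrite -lee_fin -ua; apply: integral_ge0 => x _; rewrite lee_fin. Qed.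

Lemma integral_ent_tilt : (0 < a)%R ->
  (ent a)%:E + a%:E * \int[P]_x (ent (u x / a))%:E = \int[P]_x (ent (u x))%:E.
Proof.
move=> agt0.
(* The tilting term has no sign. Splitting ln a into positive and negative parts and moving one to
   each side leaves integrals of nonnegative functions; the finite extra terms are cancelled at the
   end, even if the entropy is infinite. *)
pose lp := Num.max (ln a) 0%R; pose ln' := Num.max (- ln a)%R 0%R.
have lp0 : (0 <= lp)%R by rewrite le_max lexx orbT.
have ln0' : (0 <= ln')%R by rewrite le_max lexx orbT.
have lE : ln a = (lp - ln')%R.
  by rewrite /lp /ln' !maxEle; case: ifPn => h; case: ifPn => h'; lra.
have ua0 x : (0 <= u x / a)%R by rewrite divr_ge0.
have m1 : measurable_fun setT (fun x => (ent (u x))%:E).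
  by apply/measurable_EFinP; exact: (measurableT_comp measurable_ent mu).
have m2 : measurable_fun setT (fun x => (ent (u x / a))%:E).
  apply/measurable_EFinP; apply: (measurableT_comp measurable_ent).
  exact: measurable_funM.
have mu' : measurable_fun setT (fun x => (u x)%:E) by exact/measurable_EFinP.
have pos1 x : 0 <= (ent (u x))%:E by rewrite lee_fin ent_ge0.
have pos2 x : 0 <= (ent (u x / a))%:E by rewrite lee_fin ent_ge0.
have posu x : 0 <= (u x)%:E by rewrite lee_fin.
have ea0 : (0 <= ent a)%R by rewrite ent_ge0.
have L : \int[P]_x ((ent (u x))%:E + ln'%:E * (u x)%:E + (lp * a)%:E) =
    \int[P]_x (ent (u x))%:E + (ln' * a)%:E + (lp * a)%:E.
  rewrite ge0_integralD//; first last.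
  - by move=> x _; rewrite lee_fin mulr_ge0.
  - by apply: emeasurable_funD => //; exact: measurable_funeM.
  - by move=> x _; rewrite adde_ge0// mule_ge0// lee_fin.
  rewrite integral_prob_cst ge0_integralD//; first last.
  - exact: measurable_funeM.
  - by move=> x _; rewrite mule_ge0// lee_fin.
  by rewrite ge0_integralZl// ?lee_fin// ua EFinM.
have Rr : \int[P]_x (a%:E * (ent (u x / a))%:E + (ent a + ln' * a)%:E + lp%:E * (u x)%:E)
    = a%:E * \int[P]_x (ent (u x / a))%:E + (ent a + ln' * a)%:E + (lp * a)%:E.
  rewrite ge0_integralD//; first last.
  - exact: measurable_funeM.
  - by move=> x _; rewrite mule_ge0// lee_fin.
  - by apply: emeasurable_funD => //; exact: measurable_funeM.
  - move=> x _; apply: adde_ge0; first by rewrite mule_ge0// lee_fin.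
    by rewrite lee_fin addr_ge0// mulr_ge0.
  rewrite ge0_integralD//; first last.
  - by move=> x _; rewrite lee_fin; apply: addr_ge0 => //; apply: mulr_ge0.
  - exact: measurable_funeM.
  - by move=> x _; rewrite mule_ge0// lee_fin.
  by rewrite !ge0_integralZl// ?lee_fin// ua integral_prob_cst EFinM.
have E : \int[P]_x (ent (u x))%:E + (ln' * a)%:E + (lp * a)%:E =
    a%:E * \int[P]_x (ent (u x / a))%:E + (ent a + ln' * a)%:E + (lp * a)%:E.
  rewrite -L -Rr; apply: eq_integral => x _.
  rewrite -!EFinM -!EFinD; congr (_%:E).
  by rewrite (ent_tilt agt0 (u0 x)) lE; ring.
move: E; rewrite [in RHS]EFinD [in RHS]addeA.
move=> /(congr1 (fun z => z - (lp * a)%:E - (ln' * a)%:E)).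
by rewrite !addeK// addeC => <-.
Qed.

Lemma jensen_ent : (ent a)%:E <= \int[P]_x (ent (u x))%:E.
Proof.
have [a_eq0|a_neq0] := eqVneq a 0%R; last first.
  have agt0 : (0 < a)%R by rewrite lt_neqAle eq_sym a_neq0.
  rewrite -integral_ent_tilt// leeDl// mule_ge0 ?lee_fin//.
  by apply: integral_ge0 => x _; rewrite lee_fin ent_ge0// divr_ge0.
(* With mean a = 0 no tilt by a is possible, but u = 0 = a almost everywhere and the two integrands
   agree. *)
rewrite -[X in X <= _](integral_prob_cst P).
have /ae_eq_integral_abs ae : \int[P]_x `|(u x)%:E| = 0.
  rewrite -[RHS]/(0%R%:E) -a_eq0 -ua.
  by apply: eq_integral => x _; rewrite gee0_abs// lee_fin.
rewrite (@ge0_ae_eq_integral _ _ _ P setT _ (fun x => (ent (u x))%:E))//.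
- by apply/measurable_EFinP; exact: (measurableT_comp measurable_ent mu).
- by move=> x _; rewrite lee_fin ent_ge0.
- by move=> x _; rewrite lee_fin ent_ge0.
- have mu' : measurable_fun setT (fun x => (u x)%:E) by exact/measurable_EFinP.
  by apply: filterS (ae measurableT mu') => x /= ux _; rewrite a_eq0;
    move: (ux I) => [->].
Qed.

End jensen.

(** * Sequential transport *)

Lemma measurable_invr (R : realType) : measurable_fun setT (@GRing.inv R : R -> R).
Proof.
pose f (x : R) : R := if 0 < x then expR (- ln x)
  else if x < 0 then - expR (- ln (- x)) else 0.
rewrite (_ : @GRing.inv R = f); last first.
  apply/funext => x; rewrite /f; case: ltgtP => x0.
  - by rewrite expRN lnK.
  - by rewrite expRN lnK ?posrE ?oppr_gt0// invrN opprK.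
  - by rewrite -x0 invr0.
apply: measurable_fun_ifT; first by apply: measurable_fun_ltr.
  apply: measurableT_comp; first exact: measurable_expR.
  by apply: measurableT_comp => //; exact: measurable_ln.
apply: measurable_fun_ifT; first by apply: measurable_fun_ltr.
  apply: measurableT_comp => //.
  apply: measurableT_comp; first exact: measurable_expR.
  apply: measurableT_comp => //.
  by apply: measurableT_comp; [exact: measurable_ln|].
exact: measurable_cst.
Qed.

Section finite_ae.
Context {d} {T : measurableType d} {R : realType} (P : {measure set T -> \bar R}).
Local Open Scope ereal_scope.

Lemma ge0_integral_fin_ae (f : T -> \bar R) : measurable_fun setT f ->
  (forall x, 0 <= f x) -> \int[P]_x f x < +oo -> {ae P, forall x, f x < +oo}.
Proof.
move=> mf f0 fi.
have fint : P.-integrable setT f.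
  apply/integrableP; split => //.
  by under eq_integral do rewrite gee0_abs//.
apply: filterS (integrable_ae measurableT fint) => x /= /(_ I).
by rewrite ge0_fin_numE.
Qed.

End finite_ae.

Section sequential_coupling.
Context {d} {S : measurableType d} {R : realType} (P : nat -> probability S R).
Local Notation Pt := (seq_prod P).
Context (f : Seq S -> R) (mf : measurable_fun setT f) (f0 : forall x, 0 <= f x)
  (f1 : (\int[Pt]_x (f x)%:E = 1)%E).
Local Open Scope ereal_scope.

Implicit Types (x y z : Seq S) (s : S).

(** The density of the law of the first n coordinates under f Pt, as a martingale in n. It is
    extended-valued because finiteness holds only almost everywhere. *)
Definition cond_dens n (x : Seq S) : \bar R :=
  \int[Pt]_z (f (seq_splice n x z))%:E.

(** The density of coordinate n given the past. Where the past has density 0 or infinity it is set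
    to 1, so that it integrates to one for every past, as a transition density must. *)
Definition cond_ratio n (x : Seq S) (s : S) : R :=
  if (0 < cond_dens n x) && (cond_dens n x < +oo)
  then (fine (cond_dens n.+1 (seq_upd n x s)) / fine (cond_dens n x))%R else 1%R.

Local Notation F := cond_dens.
Local Notation g := cond_ratio.

Let ef0 x : 0 <= (f x)%:E. Proof. by rewrite lee_fin. Qed.
Hint Resolve ef0 : core.
Let emf : measurable_fun setT (fun x => (f x)%:E). Proof. exact/measurable_EFinP. Qed.

Lemma cond_dens_ge0 n x : 0 <= F n x.
Proof. exact: integral_ge0. Qed.
Hint Resolve cond_dens_ge0 : core.

Let mfs n : measurable_fun setT (fun z : Seq S * Seq S => (f (seq_splice n z.1 z.2))%:E).
Proof. exact: (measurableT_comp emf (measurable_seq_splice n)). Qed.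

Lemma measurable_cond_dens n : measurable_fun setT (F n).
Proof.
by apply: (@measurable_fun_fubini_tonelli_F _ _ _ _ _ Pt
  (fun z : Seq S * Seq S => (f (seq_splice n z.1 z.2))%:E)).
Qed.

Lemma cond_dens_dep n : dep_lt n (F n).
Proof.
move=> x y xy; apply: eq_integral => z _; congr (f _)%:E.
by apply/funext => i; rewrite /seq_splice; case: ifP => // /xy.
Qed.

Let mFu n : measurable_fun setT (fun z : Seq S * S => F n.+1 (seq_upd n z.1 z.2)).
Proof. exact: (measurableT_comp (measurable_cond_dens n.+1) (measurable_seq_upd n)). Qed.

Let mFus n x : measurable_fun setT (fun s : S => F n.+1 (seq_upd n x s)).
Proof. exact: (measurableT_comp (mFu n) (pair1_measurable x)). Qed.

Lemma cond_dens_tower n x : \int[P n]_s F n.+1 (seq_upd n x s) = F n x.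
Proof.
have mh : measurable_fun setT
    (fun z : S * Seq S => (f (seq_splice n.+1 (seq_upd n x z.1) z.2))%:E).
  apply: (measurableT_comp emf).
  apply: measurable_to_seq => i; rewrite /seq_splice /seq_upd.
  case: (i < n.+1)%N; last exact: (measurableT_comp (measurable_coord i) measurable_snd).
  by case: (i == n); [exact: measurable_fst|exact: measurable_cst].
rewrite /cond_dens.
have -> : \int[P n]_s \int[Pt]_z (f (seq_splice n.+1 (seq_upd n x s) z))%:E =
    \int[Pt]_z \int[P n]_s (f (seq_splice n.+1 (seq_upd n x s) z))%:E.
  exact: (@fubini_tonelli _ _ _ _ _ (P n) Pt _ mh).
have m1 : measurable_fun setT (fun z : Seq S => (f (seq_splice n x z))%:E).
  exact: (measurableT_comp (mfs n) (pair1_measurable x)).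
rewrite [RHS](seq_prod_upd P n m1)//.
apply: eq_integral => z _; apply: eq_integral => s _; congr (f _)%:E.
apply/funext => i; rewrite /seq_splice /seq_upd ltnS.
by case: (ltngtP i n).
Qed.

Lemma cond_dens0 x : F 0 x = 1.
Proof. by rewrite -f1; apply: eq_integral => z _; congr (f _)%:E. Qed.

Lemma integral_dep_dens n (G : Seq S -> \bar R) : measurable_fun setT G ->
  (forall x, 0 <= G x) -> dep_lt n G ->
  \int[Pt]_x (G x * (f x)%:E) = \int[Pt]_x (G x * F n x).
Proof.
move=> mG G0 dG.
rewrite (seq_prod_splice P n); first last.
- by move=> x; rewrite mule_ge0.
- exact: emeasurable_funM.
apply: eq_integral => x _; rewrite /cond_dens -ge0_integralZl//; last first.
  exact: (measurableT_comp (mfs n) (pair1_measurable x)).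
apply: eq_integral => z _; congr (_ * _); apply: dG => i ni.
by rewrite /seq_splice ni.
Qed.

Lemma cond_dens_ae n : {ae Pt, forall x, F n x < +oo}.
Proof.
apply: ge0_integral_fin_ae => //; first exact: measurable_cond_dens.
have -> : \int[Pt]_x F n x = 1; last by rewrite ltry.
transitivity (\int[Pt]_x (1 * F n x)).
  by apply: eq_integral => x _; rewrite mul1e.
rewrite -(@integral_dep_dens n (fun=> 1))// -[RHS]f1.
by apply: eq_integral => x _; rewrite mul1e.
Qed.

Lemma cond_ratio_ge0 n x s : (0 <= g n x s)%R.
Proof. by rewrite /cond_ratio; case: ifP => // _; rewrite divr_ge0// fine_ge0. Qed.

Lemma measurable_cond_ratio n :
  measurable_fun setT (fun z : Seq S * S => g n z.1 z.2).
Proof.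
have mF1 : measurable_fun setT (fun z : Seq S * S => F n z.1).
  exact: (measurableT_comp (measurable_cond_dens n) measurable_fst).
rewrite /cond_ratio; apply: measurable_fun_ifT.
- apply: measurable_and.
    by apply: measurable_fun_lte => //; exact: measurable_cst.
  by apply: measurable_fun_lte => //; exact: measurable_cst.
- apply: measurable_funM; first exact: measurableT_comp (mFu n).
  apply: measurableT_comp; first exact: measurable_invr.
  exact: measurableT_comp mF1.
- exact: measurable_cst.
Qed.

Lemma measurable_cond_ratio_section n x : measurable_fun setT (g n x).
Proof. exact: (measurableT_comp (measurable_cond_ratio n) (pair1_measurable x)). Qed.

Lemma cond_ratio_dep n s : dep_lt n (fun x => g n x s).
Proof.
move=> x y xy; rewrite /cond_ratio (@cond_dens_dep n x y)//.
rewrite (@cond_dens_dep n.+1 (seq_upd n x s) (seq_upd n y s))//.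
move=> i; rewrite ltnS leq_eqVlt /seq_upd.
by case: eqP => //= _; exact: xy.
Qed.

(** The factorisation of the density at time n + 1 into past times ratio, in integrated form since
    it holds only almost everywhere. Where the past has density 0, the tower property forces the
    next density to vanish almost everywhere. *)
Lemma integral_cond_ratio_mul n x (h : S -> \bar R) : F n x < +oo ->
  measurable_fun setT h -> (forall s, 0 <= h s) ->
  F n x * \int[P n]_s ((g n x s)%:E * h s) =
  \int[P n]_s (F n.+1 (seq_upd n x s) * h s).
Proof.
move=> Fx mh h0.
have mg' : measurable_fun setT (fun s => (g n x s)%:E).
  by apply/measurable_EFinP; exact: measurable_cond_ratio_section.
have g0' s : 0 <= (g n x s)%:E by rewrite lee_fin cond_ratio_ge0.
have [Fx0|Fx0] := eqVneq (F n x) 0.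
  by rewrite Fx0 mul0e ge0_integral_mul_eq0// cond_dens_tower.
rewrite -ge0_integralZl//; first last.
- by move=> s _; rewrite mule_ge0.
- exact: emeasurable_funM.
apply: ge0_ae_eq_integral => //.
- by apply: measurable_funeM; exact: emeasurable_funM.
- exact: emeasurable_funM.
- by move=> s _; rewrite !mule_ge0.
- by move=> s _; rewrite !mule_ge0.
have := @ge0_integral_fin_ae _ _ _ (P n) _ (mFus n x) (fun s => cond_dens_ge0 _ _).
rewrite cond_dens_tower => /(_ Fx); apply: filterS => s /= Fs _.
rewrite muleA; congr (_ * _).
have Fgt0 : 0 < F n x by rewrite lt0e Fx0/=.
rewrite /cond_ratio Fgt0 Fx /=.
have Ffin : F n x \is a fin_num by rewrite ge0_fin_numE.
rewrite -[X in X * _]fineK// -EFinM mulrCA divff ?mulr1.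
  by rewrite fineK// ge0_fin_numE.
by apply: contra Fx0 => /eqP h'; rewrite -(fineK Ffin) h'.
Qed.

Lemma integral_cond_ratio n x : \int[P n]_s (g n x s)%:E = 1.
Proof.
have [/andP[F0 Fx]|nF] := boolP ((0 < F n x) && (F n x < +oo)); last first.
  by rewrite /cond_ratio (negbTE nF) integral_prob_cst.
have h : F n x * \int[P n]_s ((g n x s)%:E * 1) =
    \int[P n]_s (F n.+1 (seq_upd n x s) * 1).
  by apply: (@integral_cond_ratio_mul n x (fun=> 1)).
have hE : F n x * \int[P n]_s (g n x s)%:E = F n x * 1.
  rewrite mule1 -[RHS]cond_dens_tower.
  transitivity (F n x * \int[P n]_s ((g n x s)%:E * 1)).
    by congr (_ * _); apply: eq_integral => s _; rewrite mule1.
  by rewrite h; apply: eq_integral => s _; rewrite mule1.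
have Ffin : F n x \is a fin_num by rewrite ge0_fin_numE.
have F0' : fine (F n x) != 0%R by rewrite gt_eqF// fine_gt0// F0.
move: hE; rewrite -(fineK Ffin) => /(congr1 (mule ((fine (F n x))^-1)%:E)).
by rewrite !muleA -EFinM mulVf// !mul1e.
Qed.

End sequential_coupling.

(** * The coupling of two sequences and its cost *)

Section marton.
Context {d} {S : measurableType d} {R : realType} (P : nat -> probability S R).
Local Notation Pt := (seq_prod P).
Context (f : Seq S -> R) (mf : measurable_fun setT f) (f0 : forall x, 0 <= f x)
  (f1 : (\int[Pt]_x (f x)%:E = 1)%E).
Local Open Scope ereal_scope.
Implicit Types (x y z : Seq S) (s : S).

Local Notation F := (cond_dens P f).
Local Notation g := (cond_ratio P f).
Local Notation FS := (@flagged _ S).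
Implicit Types (w : Seq FS).

Definition fstseq w : Seq S := fun i => fstpt (w i).
Definition sndseq w : Seq S := fun i => sndpt (w i).

Lemma measurable_fstseq : measurable_fun setT fstseq.
Proof.
by apply: measurable_to_seq => i; exact: (measurableT_comp measurable_fstpt (measurable_coord i)).
Qed.

Lemma measurable_sndseq : measurable_fun setT sndseq.
Proof.
by apply: measurable_to_seq => i; exact: (measurableT_comp measurable_sndpt (measurable_coord i)).
Qed.

(** The kernel looks only at the past of the first sequence. The second coordinate has law [P n]
    whatever that past is, which makes the second sequence a product sample. *)
Definition marton_dens n (wz : Seq FS * FS) : R :=
  cpl_density (P n) (g n (fstseq wz.1)) wz.2.

Let marton_dens_ge0 n wz : (0 <= marton_dens n wz)%R.
Proof. by apply: cpl_density_ge0 => s; exact: cond_ratio_ge0. Qed.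

Let mgw n : measurable_fun setT (fun z : Seq FS * S => g n (fstseq z.1) z.2).
Proof.
apply: (measurableT_comp (measurable_cond_ratio P mf f0 n)
  (g := fun z : Seq FS * S => (fstseq z.1, z.2))).
apply: measurable_fun_pair; last exact: measurable_snd.
exact: (measurableT_comp measurable_fstseq measurable_fst).
Qed.

Let measurable_marton_dens n : measurable_fun setT (marton_dens n).
Proof.
have m1 : measurable_fun setT (fun wz : Seq FS * FS => g n (fstseq wz.1) wz.2.2.1).
  apply: (measurableT_comp (mgw n) (g := fun wz : Seq FS * FS => (wz.1, wz.2.2.1))).
  apply: measurable_fun_pair; first exact: measurable_fst.
  exact: (measurableT_comp measurable_fstpt measurable_snd).
have m2 : measurable_fun setT (fun wz : Seq FS * FS => g n (fstseq wz.1) wz.2.2.2).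
  apply: (measurableT_comp (mgw n) (g := fun wz : Seq FS * FS => (wz.1, wz.2.2.2))).
  apply: measurable_fun_pair; first exact: measurable_fst.
  apply: (measurableT_comp measurable_snd).
  exact: (measurableT_comp measurable_snd measurable_snd).
rewrite /marton_dens /cpl_density.
apply: measurable_funM; first exact: measurable_cst.
apply: measurable_fun_ifT.
- exact: (measurableT_comp measurable_fst measurable_snd).
- by apply: measurable_minr => //; exact: measurable_cst.
apply: measurable_funM; first apply: measurable_funM.
- apply: (measurableT_comp (@measurable_invr R)).
  apply: (measurableT_comp (g := fun wz : Seq FS * FS =>
     cpl_excess (P n) (g n (fstseq wz.1)))) => //.
  rewrite /cpl_excess.
  apply: (measurableT_comp (f := fun w : Seq FS => \int[P n]_x (Num.max (g n (fstseq w) x - 1) 0)%R%:E)); last exact: measurable_fst.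
  apply: (@measurable_fun_fubini_tonelli_F _ _ _ _ _ (P n)
    (fun z : Seq FS * S => (Num.max (g n (fstseq z.1) z.2 - 1) 0)%R%:E)).
    apply/measurable_EFinP; apply: measurable_maxr => //.
    exact: measurable_funB.
  by move=> z; rewrite lee_fin le_max lexx orbT.
- by apply: measurable_maxr => //; exact: measurable_funB.
- by apply: measurable_maxr => //; exact: measurable_funB.
Qed.

Let marton_dens_dep n t : dep_lt n (fun w => marton_dens n (w, t)).
Proof.
move=> w w' ww'; rewrite /marton_dens /=.
suff -> : g n (fstseq w) = g n (fstseq w') by [].
apply/funext => s; apply: cond_ratio_dep => i ni.
by rewrite /fstseq ww'.
Qed.

Let g0 n x s : (0 <= g n x s)%R. Proof. exact: cond_ratio_ge0. Qed.
Let mg n x : measurable_fun setT (g n x).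
Proof. exact: measurable_cond_ratio_section. Qed.
Let gi n x : \int[P n]_s (g n x s)%:E = 1. Proof. exact: integral_cond_ratio. Qed.
Let Fge0 n x : 0 <= F n x. Proof. exact: cond_dens_ge0. Qed.
Let mF n : measurable_fun setT (F n). Proof. exact: measurable_cond_dens. Qed.
Hint Resolve Fge0 : core.

Let marton_dens1 n w : \int[flagged_prob (P n)]_t (marton_dens n (w, t))%:E = 1.
Proof.
have := @integral_cpl_fstpt _ _ _ (P n) _ (mg n (fstseq w)) (g0 n (fstseq w))
  (gi n (fstseq w)) (fun=> 1) (measurable_cst _) (fun=> lee01).
under eq_integral do rewrite mule1.
move=> ->; rewrite -[RHS](gi n (fstseq w)).
by apply: eq_integral => s _; rewrite mule1.
Qed.

Definition marton_prob : probability (Seq FS) R :=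
  it_prob marton_dens_ge0 measurable_marton_dens marton_dens_dep marton_dens1 point.
Local Notation Pi := marton_prob.

Let fstseq_upd n w t : fstseq (seq_upd n w t) = seq_upd n (fstseq w) (fstpt t).
Proof. by apply/funext => i; rewrite /fstseq /seq_upd; case: ifP. Qed.
Let sndseq_upd n w t : sndseq (seq_upd n w t) = seq_upd n (sndseq w) (sndpt t).
Proof. by apply/funext => i; rewrite /sndseq /seq_upd; case: ifP. Qed.

Let dep_fstseq U n (G : Seq S -> U) : dep_lt n G -> dep_lt n (G \o fstseq).
Proof. by move=> dG w w' ww'; apply: dG => i ni; rewrite /fstseq ww'. Qed.
Let dep_sndseq U n (G : Seq S -> U) : dep_lt n G -> dep_lt n (G \o sndseq).
Proof. by move=> dG w w' ww'; apply: dG => i ni; rewrite /sndseq ww'. Qed.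

Let mupd n (G : Seq S -> \bar R) x : measurable_fun setT G ->
  measurable_fun setT (fun s => G (seq_upd n x s)).
Proof.
move=> mG; exact: (measurableT_comp (measurableT_comp mG (measurable_seq_upd n))
  (pair1_measurable x)).
Qed.

Lemma integral_marton_fst n (G : Seq S -> \bar R) : measurable_fun setT G ->
  (forall x, 0 <= G x) -> dep_lt n G ->
  \int[Pi]_w G (fstseq w) = \int[Pt]_x (G x * (f x)%:E).
Proof.
move=> mG G0 dG; rewrite (integral_dep_dens P mf f0 mG G0 dG).
elim: n G mG G0 dG => [|n ih] G mG G0 dG.
  transitivity (G point).
    rewrite -[RHS](integral_prob_cst Pi); apply: eq_integral => w _.
    exact: dG.
  rewrite -[LHS](integral_prob_cst Pt); apply: eq_integral => x _.
  by rewrite cond_dens0// mule1; exact: dG.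
have mGf : measurable_fun setT (G \o fstseq).
  exact: measurableT_comp mG measurable_fstseq.
rewrite (integral_it_step marton_dens_ge0 measurable_marton_dens
  marton_dens_dep marton_dens1 point mGf (fun w => G0 _) (dep_fstseq dG)).
(* Integrating out the last pair leaves again a function of the first sequence, now of n
   coordinates, because the first marginal of the kernel has density g. *)
pose G' x := \int[P n]_s ((g n x s)%:E * G (seq_upd n x s)).
have mG' : measurable_fun setT G'.
  apply: (@measurable_fun_fubini_tonelli_F _ _ _ _ _ (P n)
    (fun z : Seq S * S => (g n z.1 z.2)%:E * G (seq_upd n z.1 z.2))).
    apply: emeasurable_funM.
      by apply/measurable_EFinP; exact: measurable_cond_ratio.
    exact: (measurableT_comp mG (measurable_seq_upd n)).
  by move=> z; rewrite mule_ge0// lee_fin.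
have G'0 x : 0 <= G' x.
  by apply: integral_ge0 => s _; rewrite mule_ge0// lee_fin.
have dG' : dep_lt n G'.
  move=> x y xy; apply: eq_integral => s _; congr (_%:E * _).
    by apply: cond_ratio_dep => i; exact: xy.
  apply: dG => i; rewrite ltnS leq_eqVlt /seq_upd.
  by case: eqP => //= _; exact: xy.
transitivity (\int[Pi]_w G' (fstseq w)).
  apply: eq_integral => w _; rewrite /it_step /G'.
  rewrite -(integral_cpl_fstpt (mg n (fstseq w)) (g0 n (fstseq w)) (gi n (fstseq w))
    (mupd n (fstseq w) mG) (fun s => G0 _)).
  by apply: eq_integral => t _; rewrite /= fstseq_upd muleC.
rewrite ih// [in RHS](seq_prod_upd P n); first last.
- by move=> x; rewrite mule_ge0.
- exact: emeasurable_funM.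
apply: ge0_ae_eq_integral => //.
- exact: emeasurable_funM.
- apply: (@measurable_fun_fubini_tonelli_F _ _ _ _ _ (P n)
    (fun z : Seq S * S => G (seq_upd n z.1 z.2) * F n.+1 (seq_upd n z.1 z.2))).
    apply: emeasurable_funM.
      exact: (measurableT_comp mG (measurable_seq_upd n)).
    exact: (measurableT_comp (mF n.+1) (measurable_seq_upd n)).
  by move=> z; rewrite mule_ge0.
- by move=> x _; rewrite mule_ge0.
- by move=> x _; apply: integral_ge0 => s _; rewrite mule_ge0.
apply: filterS (cond_dens_ae mf f0 f1 n) => x /= Fx _.
rewrite muleC /G' (integral_cond_ratio_mul mf f0 Fx (mupd n x mG) (fun s => G0 _)).
by apply: eq_integral => s _; rewrite muleC.
Qed.

Lemma integral_marton_snd n (G : Seq S -> \bar R) : measurable_fun setT G ->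
  (forall x, 0 <= G x) -> dep_lt n G ->
  \int[Pi]_w G (sndseq w) = \int[Pt]_x G x.
Proof.
elim: n G => [|n ih] G mG G0 dG.
  transitivity (G point).
    rewrite -[RHS](integral_prob_cst Pi); apply: eq_integral => w _.
    exact: dG.
  by rewrite -[LHS](integral_prob_cst Pt); apply: eq_integral => x _; exact: dG.
have mGf : measurable_fun setT (G \o sndseq).
  exact: measurableT_comp mG measurable_sndseq.
rewrite (integral_it_step marton_dens_ge0 measurable_marton_dens
  marton_dens_dep marton_dens1 point mGf (fun w => G0 _) (dep_sndseq dG)).
pose G' x := \int[P n]_s G (seq_upd n x s).
have mG' : measurable_fun setT G'.
  apply: (@measurable_fun_fubini_tonelli_F _ _ _ _ _ (P n)
    (fun z : Seq S * S => G (seq_upd n z.1 z.2))) => //.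
  exact: (measurableT_comp mG (measurable_seq_upd n)).
have G'0 x : 0 <= G' x by apply: integral_ge0.
have dG' : dep_lt n G'.
  move=> x y xy; apply: eq_integral => s _.
  apply: dG => i; rewrite ltnS leq_eqVlt /seq_upd.
  by case: eqP => //= _; exact: xy.
rewrite (seq_prod_upd P n)// -/G' -ih//.
apply: eq_integral => w _; rewrite /it_step /G'.
rewrite -(integral_cpl_sndpt (mg n (fstseq w)) (g0 n (fstseq w)) (gi n (fstseq w))
    (mupd n (sndseq w) mG) (fun s => G0 _)).
by apply: eq_integral => t _; rewrite /= sndseq_upd muleC.
Qed.


Let ment : measurable_fun setT (@ent R). Proof. exact: measurable_ent. Qed.

Let integral_fine d' (T : measurableType d') (Q : probability T R)
    (h : T -> \bar R) : measurable_fun setT h -> (forall t, 0 <= h t) ->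
  \int[Q]_t h t < +oo -> \int[Q]_t (fine (h t))%:E = \int[Q]_t h t.
Proof.
move=> mh h0 hoo; apply: ge0_ae_eq_integral => //.
- by apply/measurable_EFinP; exact: measurableT_comp.
- by move=> t _; rewrite lee_fin fine_ge0.
- apply: filterS (ge0_integral_fin_ae mh h0 hoo) => t /= ht _.
  by rewrite fineK// ge0_fin_numE.
Qed.

Let fine_cond n x := fine (F n x).

Let fine_cond_ge0 n x : (0 <= fine_cond n x)%R. Proof. by rewrite fine_ge0. Qed.

Let measurable_fine_cond n : measurable_fun setT (fine_cond n).
Proof. exact: measurableT_comp (mF n). Qed.

(** [integral_ent_tilt] with a the past density; where that density is 0 the first term disappears
    and Jensen's inequality is enough. *)
Lemma ent_cond_step n x : F n x < +oo ->
  F n x * \int[P n]_s (ent (g n x s))%:E + (ent (fine_cond n x))%:E <=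
  \int[P n]_s (ent (fine_cond n.+1 (seq_upd n x s)))%:E.
Proof.
move=> Fx; have Ffin : F n x \is a fin_num by rewrite ge0_fin_numE.
have mFu : measurable_fun setT (fun s => F n.+1 (seq_upd n x s)) by exact: mupd.
pose u s := fine_cond n.+1 (seq_upd n x s).
have mu : measurable_fun setT u by exact: (measurableT_comp _ mFu).
have u0 s : (0 <= u s)%R by exact: fine_cond_ge0.
have ui : \int[P n]_s (u s)%:E = (fine_cond n x)%:E.
  have tower := cond_dens_tower P mf f0 n x.
  rewrite [RHS]fineK// -[RHS]tower; apply: integral_fine => //.
  by rewrite tower.
have [Fx0|Fx0] := eqVneq (F n x) 0.
  by rewrite Fx0 mul0e add0e; exact: jensen_ent.
have Fgt0 : 0 < F n x by rewrite lt0e Fx0/=.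
have a0 : (0 < fine_cond n x)%R by rewrite fine_gt0// Fgt0.
rewrite -(integral_ent_tilt mu u0 ui a0) addeC -[X in _ + X * _ <= _](fineK Ffin).
rewrite leeD2l// lee_wpmul2l ?lee_fin ?fine_ge0//.
apply: ge0_le_integral => //.
- by move=> s _; rewrite lee_fin ent_ge0.
- by apply/measurable_EFinP; exact: (measurableT_comp ment (mg n x)).
- apply/measurable_EFinP; apply: (measurableT_comp ment).
  exact: measurable_funM.
- by move=> s _; rewrite /cond_ratio Fgt0 Fx.
Qed.

Let Ent n := \int[Pt]_x (ent (fine_cond n x))%:E.

Let ment_g n : measurable_fun setT (fun x => \int[P n]_s (ent (g n x s))%:E).
Proof.
apply: (@measurable_fun_fubini_tonelli_F _ _ _ _ _ (P n)
    (fun z : Seq S * S => (ent (g n z.1 z.2))%:E)).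
  apply/measurable_EFinP; apply: (measurableT_comp ment).
  exact: measurable_cond_ratio.
by move=> z; rewrite lee_fin ent_ge0.
Qed.

Let ent_g_ge0 n x : 0 <= \int[P n]_s (ent (g n x s))%:E.
Proof. by apply: integral_ge0 => s _; rewrite lee_fin ent_ge0. Qed.

Let ment_fine n : measurable_fun setT (fun x => (ent (fine_cond n x))%:E).
Proof. by apply/measurable_EFinP; exact: measurableT_comp. Qed.

(** The integral of [ent_cond_step]: under [Pi] the first n coordinates of the first sequence have
    density [F n], which supplies the factor in front of the conditional entropy. *)
Let Ent_step n :
  \int[Pi]_w \int[P n]_s (ent (g n (fstseq w) s))%:E + Ent n <= Ent n.+1.
Proof.
have dG : dep_lt n (fun x => \int[P n]_s (ent (g n x s))%:E).
  move=> x y xy; apply: eq_integral => s _; congr (ent _)%:E.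
  by apply: cond_ratio_dep => i; exact: xy.
rewrite (@integral_marton_fst n (fun x => \int[P n]_s (ent (g n x s))%:E))//.
rewrite (integral_dep_dens P mf f0 (ment_g n) (ent_g_ge0 n) dG) /Ent.
rewrite -ge0_integralD//; first last.
- by move=> x _; rewrite lee_fin ent_ge0.
- exact: emeasurable_funM.
- by move=> x _; rewrite mule_ge0.
rewrite [leRHS](seq_prod_upd P n)//; last by move=> x; rewrite lee_fin ent_ge0.
apply: ae_ge0_le_integral => //.
- by move=> x _; rewrite adde_ge0// ?mule_ge0// lee_fin ent_ge0.
- by apply: emeasurable_funD => //; exact: emeasurable_funM.
- by move=> x _; apply: integral_ge0 => s _; rewrite lee_fin ent_ge0.
- apply: (@measurable_fun_fubini_tonelli_F _ _ _ _ _ (P n)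
    (fun z : Seq S * S => (ent (fine_cond n.+1 (seq_upd n z.1 z.2)))%:E)).
    exact: (measurableT_comp (ment_fine n.+1) (measurable_seq_upd n)).
  by move=> z; rewrite lee_fin ent_ge0.
- apply: filterS (cond_dens_ae mf f0 f1 n) => x /= Fx _.
  by rewrite muleC; exact: ent_cond_step.
Qed.

(** Jensen's inequality for the conditional expectation [F n] of f, so that no limit of densities is
    needed in the chain rule. *)
Let Ent_le n : Ent n <= \int[Pt]_x (ent (f x))%:E.
Proof.
have mef : measurable_fun setT (fun x => (ent (f x))%:E).
  by apply/measurable_EFinP; exact: measurableT_comp.
have ef0 x : 0 <= (ent (f x))%:E by rewrite lee_fin ent_ge0.
rewrite [leRHS](seq_prod_splice P n)// /Ent.
apply: ae_ge0_le_integral => //.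
- by move=> x _; rewrite lee_fin ent_ge0.
- by move=> x _; apply: integral_ge0.
- apply: (@measurable_fun_fubini_tonelli_F _ _ _ _ _ Pt
    (fun z : Seq S * Seq S => (ent (f (seq_splice n z.1 z.2)))%:E)) => //.
  exact: (measurableT_comp mef (measurable_seq_splice n)).
- apply: filterS (cond_dens_ae mf f0 f1 n) => x /= Fx _.
  apply: jensen_ent => //.
  + exact: (measurableT_comp (measurableT_comp mf (measurable_seq_splice n))
      (pair1_measurable x)).
  + by rewrite fineK// ge0_fin_numE.
Qed.

(** The increments telescope, starting from [Ent 0 >= 0]. *)
Lemma sum_ent_ratio_le N :
  \sum_(0 <= n < N) \int[Pi]_w \int[P n]_s (ent (g n (fstseq w) s))%:E <=
  \int[Pt]_x (ent (f x))%:E.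
Proof.
apply: le_trans (Ent_le N).
have E0 n : 0 <= Ent n by apply: integral_ge0 => x _; rewrite lee_fin ent_ge0.
elim: N => [|N ih]; first by rewrite big_nil.
rewrite big_nat_recr//= addeC.
by apply: le_trans (Ent_step N); rewrite leeD2l.
Qed.

Definition marton_cost (psi : nat -> S -> R) w : \bar R :=
  \sum_(n <oo) (if (w n).1 then 0 else psi n (w n).2.1 + psi n (w n).2.2)%R%:E.

Lemma integral_marton_cost (psi : nat -> S -> R) :
  (forall n, measurable_fun setT (psi n)) -> (forall n s, (0 <= psi n s)%R) ->
  \int[Pi]_w marton_cost psi w <= \int[Pt]_x (ent (f x))%:E +
    \sum_(n <oo) \int[P n]_s (expR (psi n s) - 1 - psi n s)%R%:E.
Proof.
move=> mpsi psi0.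
pose cst n (z : FS) : \bar R := (if z.1 then 0 else psi n z.2.1 + psi n z.2.2)%R%:E.
have mcst n : measurable_fun setT (cst n).
  apply/measurable_EFinP; apply: measurable_fun_ifT.
  - exact: measurable_fst.
  - exact: measurable_cst.
  - apply: measurable_funD.
      exact: (measurableT_comp (mpsi n) measurable_fstpt).
    apply: (measurableT_comp (mpsi n)).
    exact: measurableT_comp measurable_snd measurable_snd.
have cst0 n (z : FS) : 0 <= cst n z.
  by rewrite lee_fin; case: ifP => // _; rewrite addr_ge0.
have mc n : measurable_fun setT (fun w => cst n (w n)).
  exact: (measurableT_comp (mcst n) (measurable_coord n)).
pose b n := \int[P n]_s (expR (psi n s) - 1 - psi n s)%R%:E.
have eb0 n s : (0 <= expR (psi n s) - 1 - psi n s)%R.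
  by have := expR_ge1Dx (psi n s); lra.
have meb n : measurable_fun setT (fun s => (expR (psi n s) - 1 - psi n s)%R%:E).
  apply/measurable_EFinP; apply: measurable_funB => //; apply: measurable_funB => //.
  exact: measurableT_comp.
have b0 n : 0 <= b n by apply: integral_ge0 => s _; rewrite lee_fin.
have step_le n : \int[Pi]_w cst n (w n) <=
    \int[Pi]_w \int[P n]_s (ent (g n (fstseq w) s))%:E + b n.
  have dc : dep_lt n.+1 (fun w => cst n (w n)) by move=> w w' ww'; rewrite ww'.
  rewrite (integral_it_step marton_dens_ge0 measurable_marton_dens
    marton_dens_dep marton_dens1 point (mc n) (fun w => cst0 n _) dc).
  rewrite -[b n](integral_prob_cst Pi) -ge0_integralD//; last first.
    exact: (measurableT_comp (ment_g n) measurable_fstseq).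
  apply: ge0_le_integral => //.
  - by move=> w _; apply: step_ge0.
  - by apply: measurable_step => //; exact: measurable_marton_dens.
  - apply: emeasurable_funD => //.
    exact: (measurableT_comp (ment_g n) measurable_fstseq).
  move=> w _; rewrite /it_step.
  have := integral_cpl_cost (mg n (fstseq w)) (g0 n (fstseq w)) (gi n (fstseq w))
    (mpsi n) (psi0 n).
  under eq_integral do rewrite muleC.
  have -> : \int[flagged_prob (P n)]_t
     (cst n (seq_upd n w t n) * (marton_dens n (w, t))%:E) =
     \int[flagged_prob (P n)]_t (cst n t * (cpl_density (P n) (g n (fstseq w)) t)%:E).
    by apply: eq_integral => t _; rewrite /seq_upd eqxx.
  move=> /le_trans; apply.
  rewrite /b -ge0_integralD//; first last.
  - by move=> s _; rewrite lee_fin.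
  - by apply/measurable_EFinP; exact: (measurableT_comp ment (mg n _)).
  - by move=> s _; rewrite lee_fin ent_ge0.
  apply: ge0_le_integral => //.
  - by move=> s _; rewrite lee_fin mulr_ge0.
  - apply/measurable_EFinP; apply: measurable_funM => //.
    by apply: measurableT_comp => //; exact: measurable_funB.
  - apply: emeasurable_funD => //.
    by apply/measurable_EFinP; exact: (measurableT_comp ment (mg n _)).
  - by move=> s _; rewrite -EFinD lee_fin ent_young_abs.
rewrite /marton_cost integral_nneseries//; last by move=> n w _; exact: cst0.
apply: lime_le.
  by apply: is_cvg_nneseries => n *; apply: integral_ge0 => w _; exact: cst0.
apply: nearW => N.
apply: (@le_trans _ _ (\sum_(0 <= n < N)
   (\int[Pi]_w \int[P n]_s (ent (g n (fstseq w) s))%:E + b n))).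
  by apply: lee_sum => n _; exact: step_le.
rewrite big_split/=; apply: leeD; first exact: sum_ent_ratio_le.
by apply: nneseries_lim_ge => n *; exact: b0.
Qed.

End marton.

(** * Marginals of the coupling *)

Section density_probability.
Context {d} {T : measurableType d} {R : realType} (P : probability T R).
Context (f : T -> R) (mf : measurable_fun setT f) (f0 : forall x, 0 <= f x)
  (f1 : (\int[P]_x (f x)%:E = 1)%E).
Local Open Scope ereal_scope.

Definition dens_measure (A : set T) : \bar R := \int[P]_(x in A) (f x)%:E.

Let dens_measure0 : dens_measure set0 = 0.
Proof. by rewrite /dens_measure integral_set0. Qed.

Let dens_measure_ge0 A : 0 <= dens_measure A.
Proof. by apply: integral_ge0 => x _; rewrite lee_fin. Qed.

Let dens_measure_sigma_additive : semi_sigma_additive dens_measure.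
Proof.
move=> F mF tF mUF; rewrite /dens_measure ge0_integral_bigcup//.
- apply: is_cvg_nneseries => n *; exact: dens_measure_ge0.
- by apply/measurable_EFinP; exact: measurable_funTS.
- by move=> x _; rewrite lee_fin.
Qed.

HB.instance Definition _ := isMeasure.Build _ T R dens_measure
  dens_measure0 dens_measure_ge0 dens_measure_sigma_additive.

Let dens_measure_setT : dens_measure setT = 1. Proof. exact: f1. Qed.

HB.instance Definition _ := Measure_isProbability.Build _ _ R dens_measure
  dens_measure_setT.

Definition dens_prob : probability T R := dens_measure.

End density_probability.

Section sequential_transport.
Context {d} {S : measurableType d} {R : realType} (P : nat -> probability S R).
Local Notation Pt := (seq_prod P).
Context (f : Seq S -> R) (mf : measurable_fun setT f) (f0 : forall x, 0 <= f x)
  (f1 : (\int[Pt]_x (f x)%:E = 1)%E).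
Local Open Scope ereal_scope.

Let Pi := marton_prob P mf f0.

Let drect (A : nat -> set S) m : dep_lt m (EFin \o \1_(rect A m) : Seq S -> \bar R).
Proof.
apply: dep_lt_indic => x y xy; apply/propext.
by split => h i im; [rewrite -xy//|rewrite xy//]; exact: h.
Qed.

Let mrect (A : nat -> set S) m : (forall i, measurable (A i)) ->
  measurable_fun setT (EFin \o \1_(rect A m) : Seq S -> \bar R).
Proof.
move=> mA; apply/measurable_EFinP.
by apply: measurable_indic; exact: measurable_rect.
Qed.

(** Rectangles depend on finitely many coordinates, so [integral_marton_fst] applies to them, and
    they determine a probability. *)
Lemma marton_prob_fst (A : set (Seq S)) : measurable A ->
  Pi ((@fstseq _ S) @^-1` A) = \int[Pt]_(x in A) (f x)%:E.
Proof.
move=> mA.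
have [Q1 Q1E] := push_prob_exists Pi (@measurable_fstseq _ S).
rewrite -Q1E; apply: (rect_unique (mu := Q1) (nu := dens_prob mf f0 f1)) => // B m mB.
have mR := measurable_rect m mB.
have mR' : measurable ((@fstseq _ S) @^-1` (rect B m)).
  by rewrite -[X in measurable X]setTI; exact: measurable_fstseq.
rewrite Q1E; transitivity (\int[Pi]_w (EFin \o \1_(rect B m)) (fstseq w)).
  by rewrite -[LHS]/(Pi (_ @^-1` _)) -[X in Pi X]setIT -(integral_indic Pi).
rewrite (integral_marton_fst mf f0 f1 (mrect m mB) _ (@drect B m)); last first.
  by move=> x; rewrite lee_fin.
rewrite /dens_prob/= /dens_measure [RHS]integral_mkcond.
apply: eq_integral => x _; rewrite /= patchE indicE.
by case: ifP => _; rewrite ?mul1e ?mul0e.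
Qed.

Lemma marton_prob_snd (A : set (Seq S)) : measurable A ->
  Pi ((@sndseq _ S) @^-1` A) = Pt A.
Proof.
move=> mA.
have [Q1 Q1E] := push_prob_exists Pi (@measurable_sndseq _ S).
rewrite -Q1E; apply: (rect_unique (mu := Q1) (nu := Pt)) => // B m mB.
have mR := measurable_rect m mB.
have mR' : measurable ((@sndseq _ S) @^-1` (rect B m)).
  by rewrite -[X in measurable X]setTI; exact: measurable_sndseq.
rewrite Q1E; transitivity (\int[Pi]_w (EFin \o \1_(rect B m)) (sndseq w)).
  by rewrite -[LHS]/(Pi (_ @^-1` _)) -[X in Pi X]setIT -(integral_indic Pi).
rewrite (integral_marton_snd P mf f0 (mrect m mB) _ (@drect B m)); last first.
  by move=> x; rewrite lee_fin.
by rewrite integral_indic// setIT.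
Qed.

End sequential_transport.

(** * Poisson point lists *)

Section nat_integral.
Context {R : realType}.
Local Open Scope ereal_scope.

Lemma ge0_integral_nat (mu : {measure set nat -> \bar R}) (F : nat -> \bar R) :
  (forall n, 0 <= F n) -> \int[mu]_n F n = \sum_(n <oo) F n * mu [set n].
Proof.
move=> F0.
transitivity (\int[mu]_n \sum_(k <oo) (F k * (\1_[set k] n)%:E)).
  apply: eq_integral => n _; rewrite nneseries_esumT; last first.
    by move=> k; rewrite mule_ge0// lee_fin.
  rewrite (esumID [set n])//; last by move=> k _; rewrite mule_ge0// lee_fin.
  rewrite setTI esum_set1; last by rewrite mule_ge0// lee_fin.
  rewrite indicE mem_set// mule1 esum1 ?adde0// => k [_ /= kn].
  by rewrite indicE memNset ?mule0// => nk; apply: kn.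
rewrite integral_nneseries//; last by move=> k n _; rewrite mule_ge0// lee_fin.
apply: eq_eseriesr => k _; rewrite ge0_integralZl//.
by rewrite integral_indic// setIT.
Qed.

Lemma integral_poisson (rate : R) k (F : nat -> \bar R) : (0 < rate)%R ->
  (forall n, 0 <= F n) ->
  \int[poisson_prob rate k]_n F n = \sum_(n <oo) F n * (poisson_pmf rate n)%:E.
Proof.
move=> r0 F0; rewrite ge0_integral_nat//; apply: eq_eseriesr => n _.
have E : poisson_prob rate k [set n] = (poisson_pmf rate n)%:E.
  by rewrite /poisson_prob r0 esum_set1// lee_fin poisson_pmf_ge0.
by congr (_ * _); exact: E.
Qed.

Lemma nneseries_exp (x : R) : (0 <= x)%R ->
  \sum_(n <oo) (x ^+ n / n`!%:R)%:E = (expR x)%:E.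
Proof.
move=> x0; rewrite /expR -EFin_lim; last exact: is_cvg_series_exp_coeff.
by apply/congr_lim/funext => n/=; rewrite /series/= -sumEFin.
Qed.

Lemma integral_poisson0 k (F : nat -> \bar R) : (forall n, 0 <= F n) ->
  \int[poisson_prob 0 k]_n F n = F 0%N.
Proof.
move=> F0; transitivity (\int[\d_0%N]_n F n).
  have E (A : set nat) : poisson_prob (0 : R) k A = \d_0%N A.
    by rewrite /poisson_prob ltxx.
  by apply: eq_measure_integral => A _ _; exact: E.
by rewrite integral_dirac// diracT mul1e.
Qed.

Lemma poisson_generating (rate q : R) k : (0 <= rate)%R -> (0 <= q)%R ->
  \int[poisson_prob rate k]_n (q ^+ n)%:E = (expR (rate * (q - 1)))%:E.
Proof.
rewrite le_eqVlt => /predU1P[<-|r0] q0.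
  by rewrite mul0r expR0 integral_poisson0// => n; rewrite lee_fin exprn_ge0.
rewrite integral_poisson//; last by move=> n; rewrite lee_fin exprn_ge0.
transitivity (\sum_(n <oo) (expR (- rate))%:E * ((rate * q) ^+ n / n`!%:R)%:E).
  apply: eq_eseriesr => n _; rewrite -!EFinM; congr (_%:E).
  by rewrite /poisson_pmf r0 exprMn; ring.
rewrite nneseriesZl//; last first.
  by move=> n _; rewrite lee_fin divr_ge0// exprn_ge0// mulr_ge0// ltW.
rewrite nneseries_exp ?mulr_ge0// ?ltW//.
by rewrite -EFinM -expRD; congr (expR _)%:E; ring.
Qed.

Lemma nneseries_succ (f : nat -> \bar R) : (forall n, 0 <= f n) ->
  \sum_(1 <= n <oo) f n = \sum_(n <oo) f n.+1.
Proof.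
move=> f0; apply/esym/cvg_lim => //.
have : \sum_(1 <= i < n) f i @[n --> \oo] --> \sum_(1 <= n <oo) f n.
  exact: is_cvg_nneseries.
rewrite -cvg_shiftS /=.
by under eq_fun do rewrite big_add1.
Qed.

Lemma poisson_mean (rate : R) k : (0 <= rate)%R ->
  \int[poisson_prob rate k]_n (n%:R)%:E = rate%:E.
Proof.
rewrite le_eqVlt => /predU1P[<-|r0].
  by rewrite integral_poisson0.
rewrite integral_poisson//.
have p0 n : 0 <= (n%:R)%:E * (poisson_pmf rate n)%:E :> \bar R.
  by rewrite mule_ge0// lee_fin// poisson_pmf_ge0.
rewrite nneseries_recl// mul0e add0e nneseries_succ//.
transitivity (\sum_(n <oo) (rate * expR (- rate))%:E * (rate ^+ n / n`!%:R)%:E).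
  apply: eq_eseriesr => n _; rewrite -!EFinM; congr (_%:E).
  rewrite /poisson_pmf r0 factS exprS natrM; field.
  by rewrite addrC natr1 !pnatr_eq0 -lt0n fact_gt0.
rewrite nneseriesZl//; last first.
  by move=> n _; rewrite lee_fin divr_ge0// exprn_ge0// ltW.
rewrite nneseries_exp ?ltW// -EFinM -mulrA -expRD addNr expR0 mulr1//.
Qed.

End nat_integral.

Lemma measurable_fun_natX d d' (X : measurableType d) (Y : measurableType d')
    (F : nat * X -> Y) : (forall n, measurable_fun setT (fun x => F (n, x))) ->
  measurable_fun setT F.
Proof.
move=> mF _ B mB; rewrite setTI.
rewrite (_ : F @^-1` B = \bigcup_n ([set n] `*` ((fun x => F (n, x)) @^-1` B))).
  apply: bigcupT_measurable => n; apply: measurableX => //.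
  by rewrite -[X in measurable X]setTI; exact: mF.
apply/seteqP; split => [[n x] /= h|[n x] [k _ [/= <-]]//].
by exists n.
Qed.

Section poisson_list.
Context {d} {E : measurableType d} {R : realType} (p : probability E R).
Context (lam : R) (lam0 : 0 <= lam).

(** A random length together with an infinite sequence of which only that many entries count as
    points: lists of all lengths live in one product space. *)
Definition plist : Type := (nat * Seq E)%type.

Definition plist_prob : probability plist R :=
  (poisson_prob lam 0 \x seq_prod (fun=> p))%E.

Definition lsum (u : E -> R) (s : plist) : R := \sum_(r < s.1) u (s.2 r).

Lemma measurable_lsum u : measurable_fun setT u -> measurable_fun setT (lsum u).
Proof.
move=> mu; apply: measurable_fun_natX => n; rewrite /lsum /=.
apply: measurable_sum => r.
exact: (measurableT_comp mu (measurable_coord r)).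
Qed.

Lemma lsum_ge0 u s : (forall x, 0 <= u x) -> 0 <= lsum u s.
Proof. by move=> u0; exact: sumr_ge0. Qed.

Local Open Scope ereal_scope.

Lemma integral_plist (F : plist -> \bar R) : measurable_fun setT F ->
  (forall s, 0 <= F s) ->
  \int[plist_prob]_s F s =
  \int[poisson_prob lam 0]_n \int[seq_prod (fun=> p)]_x F (n, x).
Proof. by move=> mF F0; rewrite /plist_prob fubini_tonelli1. Qed.

(** The exponential moment of a compound Poisson sum: given length n it is q^n, and the Poisson
    generating function does the rest. The weight u has any sign, as [superpose_law] takes negative
    ones. *)
Lemma integral_expR_lsum (u : E -> R) (q : R) : measurable_fun setT u ->
  \int[p]_x (expR (u x))%:E = q%:E ->
  \int[plist_prob]_s (expR (lsum u s))%:E = (expR (lam * (q - 1)))%:E.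
Proof.
move=> mu uq.
have mv : measurable_fun setT (expR \o u) by exact: measurableT_comp.
have q0 : (0 <= q)%R.
  by rewrite -lee_fin -uq; apply: integral_ge0 => x _; rewrite lee_fin expR_ge0.
rewrite integral_plist; first last.
- by move=> s; rewrite lee_fin expR_ge0.
- apply/measurable_EFinP; apply: measurableT_comp => //.
  exact: measurable_lsum.
rewrite -(poisson_generating 0 lam0 q0); apply: eq_integral => n _.
transitivity (\int[seq_prod (fun=> p)]_w (\prod_(r < n) (expR \o u) (w r))%R%:E).
  by apply: eq_integral => w _; rewrite /lsum /= expR_sum.
rewrite (@seq_prod_prodf _ _ _ (fun=> p) n (fun=> expR \o u) (fun=> q))//.
  by rewrite big_const_ord iter_mulr_1.
by move=> _ x; exact: expR_ge0.
Qed.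

Lemma integral_lsum (u : E -> R) (q : R) : measurable_fun setT u ->
  (forall x, (0 <= u x)%R) -> \int[p]_x (u x)%:E = q%:E ->
  \int[plist_prob]_s (lsum u s)%:E = (lam * q)%:E.
Proof.
move=> mu u0 uq.
have q0 : 0 <= q%:E.
  by rewrite -uq; apply: integral_ge0 => x _; rewrite lee_fin.
rewrite integral_plist; first last.
- by move=> s; rewrite lee_fin lsum_ge0.
- by apply/measurable_EFinP; exact: measurable_lsum.
transitivity (\int[poisson_prob lam 0]_n (n%:R%:E * q%:E)).
  apply: eq_integral => n _; rewrite /lsum /=.
  under eq_integral do rewrite -sumEFin.
  rewrite ge0_integral_sum//; first last.
  - by move=> r w _; rewrite lee_fin.
  - move=> r; apply/measurable_EFinP.
    exact: (measurableT_comp mu (measurable_coord r)).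
  transitivity (\sum_(r < n) q%:E).
    apply: eq_bigr => r _; rewrite (seq_prod_upd (fun=> p) r)//; first last.
    - by move=> w; rewrite lee_fin.
    - apply/measurable_EFinP.
      exact: (measurableT_comp mu (measurable_coord r)).
    rewrite -[RHS](integral_prob_cst (seq_prod (fun=> p))).
    apply: eq_integral => w _; rewrite -uq.
    by apply: eq_integral => t _; rewrite /seq_upd eqxx.
  by rewrite sumEFin -EFinM sumr_const card_ord mulr_natl.
rewrite ge0_integralZr//.
by rewrite poisson_mean// EFinM.
Qed.

(** Compared with lam (qe - 1 - q), the integral of the tail against the intensity lam p, the value
    exceeds it by e^x - 1 - x at x = lam (qe - 1), a quantity of second order in lam. *)
Lemma integral_exp_tail_lsum (u : E -> R) (qe q : R) : measurable_fun setT u ->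
  (forall x, (0 <= u x)%R) -> \int[p]_x (expR (u x))%:E = qe%:E ->
  \int[p]_x (u x)%:E = q%:E ->
  \int[plist_prob]_s (expR (lsum u s) - 1 - lsum u s)%:E =
  (expR (lam * (qe - 1)) - 1 - lam * q)%:E.
Proof.
move=> mu u0 uqe uq.
have ml := measurable_lsum mu.
have tail0 s : (0 <= expR (lsum u s) - 1 - lsum u s)%R.
  by have := expR_ge1Dx (lsum u s); lra.
have mt : measurable_fun setT (fun s => (expR (lsum u s) - 1 - lsum u s)%:E).
  apply/measurable_EFinP; apply: measurable_funB => //; apply: measurable_funB => //.
  exact: measurableT_comp.
have : \int[plist_prob]_s (expR (lsum u s))%:E =
    \int[plist_prob]_s (expR (lsum u s) - 1 - lsum u s)%:E + (1 + lam * q)%:E.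
  rewrite EFinD -(integral_lsum mu u0 uq) -[in RHS](integral_prob_cst plist_prob 1%R%:E).
  have lsum0' s : (0 <= lsum u s)%R by exact: lsum_ge0.
  have mls : measurable_fun setT (fun s => (lsum u s)%:E).
    exact/measurable_EFinP.
  rewrite -ge0_integralD//; last by move=> s _; rewrite lee_fin.
  rewrite -ge0_integralD//; first last.
  - by apply: emeasurable_funD.
  - by move=> s _; rewrite adde_ge0 ?lee_fin.
  - by move=> s _; rewrite lee_fin.
  by apply: eq_integral => s _; rewrite -!EFinD; congr (_%:E); ring.
rewrite (integral_expR_lsum mu uqe).
move=> /(congr1 (fun z => z - (1 + lam * q)%:E)); rewrite addeK// => <-.
by rewrite -EFinB; congr (_%:E); ring.
Qed.

End poisson_list.

(** * Uniqueness of the law of a configuration *)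

From mathcomp Require Import finmap.

Section power_series_uniqueness.
Context {R : realType}.
Local Open Scope ereal_scope.

(** After division by t^k the leading terms are c k and e k, and the rest of the right-hand series
    is at most t / (1 - t), which is arbitrarily small. *)
Lemma nneseries_eq_coef_le (c e : nat -> R) k :
  (forall a, 0 <= c a)%R -> (forall a, 0 <= e a <= 1)%R ->
  (forall t, (0 < t < 1)%R ->
    \sum_(k <= a <oo) (t ^+ a * c a)%:E = \sum_(k <= a <oo) (t ^+ a * e a)%:E) ->
  (c k <= e k)%R.
Proof.
move=> c0 e01 h; apply/ler_addgt0Pr => x x0.
(* The solution of t / (1 - t) = x. *)
pose t : R := (x / (1 + x))%R.
have t01 : (0 < t < 1)%R.
  rewrite divr_gt0 ?addr_gt0//= ltr_pdivrMr ?addr_gt0// mul1r.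
  by rewrite ltrDr.
have [t0 t1] := andP t01.
have tx : (t / (1 - t) = x)%R.
  have h1 : (1 + x != 0)%R by rewrite gt_eqF// addr_gt0.
  have -> : (1 - t = (1 + x)^-1)%R by rewrite /t; field.
  by rewrite invrK /t -mulrA mulVf// mulr1.
have tc0 a : 0 <= (t ^+ a * c a)%:E by rewrite lee_fin mulr_ge0// exprn_ge0// ltW.
have te0 a : 0 <= (t ^+ a * e a)%:E.
  by have /andP[e0 _] := e01 a; rewrite lee_fin mulr_ge0// exprn_ge0// ltW.
have : (t ^+ k * c k)%:E <= (t ^+ k * e k)%:E + (t ^+ k * (t / (1 - t)))%:E.
  apply: (@le_trans _ _ (\sum_(k <= a <oo) (t ^+ a * c a)%:E)).
    rewrite (nneseries_split _ 1)// addn1 big_nat1 leeDl//.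
    exact: nneseries_ge0.
  rewrite h// (nneseries_split _ 1)// addn1 big_nat1 leeD2l//.
  apply: lime_le; first exact: is_cvg_nneseries.
  apply: nearW => n.
  have geo : (\sum_(k.+1 <= a < n) t ^+ a <= t ^+ k * (t / (1 - t)))%R.
    have [nk|nk] := leqP n k.+1.
      have t0' := ltW t0; have t1' : (0 <= 1 - t)%R by rewrite subr_ge0 ltW.
      by rewrite big_geq// mulr_ge0// ?exprn_ge0// divr_ge0.
    have -> : (\sum_(k.+1 <= a < n) t ^+ a =
               t ^+ k.+1 * \sum_(a < n - k.+1) t ^+ a)%R.
      rewrite mulr_sumr -{1}(add0n k.+1) big_addn big_mkord.
      by apply: eq_bigr => i _; rewrite -exprD addnC.
    rewrite exprSr -mulrA; apply: ler_wpM2l; first by rewrite exprn_ge0// ltW.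
    rewrite ler_pM2l// -div1r ler_pdivlMr ?subr_gt0//.
    have := subrX1 t (n - k.+1).
    have := exprn_ge0 (n - k.+1) (ltW t0).
    set S := (\sum_(i < _) _)%R; set T := (t ^+ _)%R => T0 hS.
    have -> : (S * (1 - t) = 1 - T)%R by rewrite mulrC -opprB mulNr -hS opprB.
    by lra.
  apply: (@le_trans _ _ (\sum_(k.+1 <= a < n) t ^+ a)%R%:E); last by rewrite lee_fin.
  rewrite -sumEFin; apply: lee_sum => a _; rewrite lee_fin.
  by have /andP[_ e1] := e01 a; rewrite ler_piMr// exprn_ge0// ltW.
rewrite -EFinD lee_fin -mulrDr ler_pM2l ?exprn_gt0// tx.
by [].
Qed.

Lemma nneseries_eq_coef (c e : nat -> R) :
  (forall a, 0 <= c a <= 1)%R -> (forall a, 0 <= e a <= 1)%R ->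
  (forall t, (0 < t < 1)%R ->
    \sum_(a <oo) (t ^+ a * c a)%:E = \sum_(a <oo) (t ^+ a * e a)%:E) ->
  forall k, c k = e k.
Proof.
move=> c01 e01 h.
have c0 a : (0 <= c a)%R by have /andP[] := c01 a.
have e0 a : (0 <= e a)%R by have /andP[] := e01 a.
elim/ltn_ind => k ih.
have h' t : (0 < t < 1)%R ->
    \sum_(k <= a <oo) (t ^+ a * c a)%:E = \sum_(k <= a <oo) (t ^+ a * e a)%:E.
  move=> t01; have [t0 t1] := andP t01.
  have := h _ t01.
  rewrite (nneseries_split _ k); last first.
    by move=> a _; rewrite lee_fin mulr_ge0// exprn_ge0// ltW.
  rewrite [in RHS](nneseries_split _ k); last first.
    by move=> a _; rewrite lee_fin mulr_ge0// exprn_ge0// ltW.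
  rewrite add0n.
  have -> : \sum_(0 <= a < k) (t ^+ a * c a)%:E = \sum_(0 <= a < k) (t ^+ a * e a)%:E.
    by rewrite !big_mkord; apply: eq_bigr => i _; rewrite ih.
  rewrite sumEFin => /(congr1 (fun z => z - (\sum_(0 <= a < k) t ^+ a * e a)%R%:E)).
  by rewrite [X in X = _ -> _]addeAC [X in _ = X -> _]addeAC !subee// !add0e.
apply/eqP; rewrite eq_le; apply/andP; split; apply: nneseries_eq_coef_le => //.
by move=> t t01; rewrite h'.
Qed.

End power_series_uniqueness.

Section counts.
Context {R : realType} {E : ptopologicalType}.
Local Open Scope ereal_scope.

Lemma cnt_cases (w : E -> nat) (B : set E) :
  @cnt R E w B = +oo \/ exists k, @cnt R E w B = (k%:R)%:E.
Proof.
have w0 x : 0 <= ((w x)%:R)%:E :> \bar R by rewrite lee_fin.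
pose S := B `&` [set x | w x != 0%N].
have -> : @cnt R E w B = \esum_(x in S) ((w x)%:R)%:E.
  rewrite /cnt /S esum_mkcondr; apply: eq_esum => x _.
  case: ifPn => //; rewrite notin_setE /= => /negP; rewrite negbK => /eqP ->//.
have [finS|infS] := pselect (finite_set S).
  right; rewrite esum_fset//; exists (\sum_(x <- finmap.enum_fset (fset_set S)) w x)%N.
  rewrite fsbig_finite//= natr_sum -sumEFin//.
left; apply/eqyP => A A0.
have [X XS Xn] := infinite_set_fset (Num.truncn A).+1 infS.
apply: esum_ge; exists [set` X]; first by split.
rewrite fsbig_finite//= set_fsetK.
apply: (@le_trans _ _ (\sum_(x <- finmap.enum_fset X) 1)).
  rewrite sumEFin lee_fin big_const_seq count_predT iter_addr_0.
  apply: (@le_trans _ _ ((Num.truncn A).+1)%:R); last by rewrite ler_nat.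
  by rewrite ltW// truncnS_gt.
rewrite big_seq [leRHS]big_seq; apply: lee_sum => x xX.
have [_ /=] : S x by exact: XS.
by rewrite lee_fin ler1n lt0n.
Qed.

(** The function e^(-x) with value 0 at +oo, so that sets with infinitely many points contribute
    nothing to the Laplace functional. *)
Definition lapl (x : \bar R) : R := if x is r%:E then expR (- r) else 0%R.

Lemma lapl0 : lapl 0 = 1%R. Proof. by rewrite /= oppr0 expR0. Qed.

Lemma laplD x y : 0 <= x -> 0 <= y -> lapl (x + y) = (lapl x * lapl y)%R.
Proof.
move: x y => [x||] [y||]//= _ _; rewrite ?mul0r ?mulr0//.
by rewrite opprD expRD.
Qed.

Lemma lapl_ge0 x : (0 <= lapl x)%R.
Proof. by case: x => //= x; exact: expR_ge0. Qed.

Lemma lapl_le1 x : 0 <= x -> (lapl x <= 1)%R.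
Proof. by case: x => //= x; rewrite lee_fin => x0; rewrite expR_le1 oppr_le0. Qed.

Lemma measurable_lapl : measurable_fun setT lapl.
Proof.
rewrite (_ : lapl = fun x => if (-oo < x) && (x < +oo) then expR (- fine x) else 0%R).
  apply: measurable_fun_ifT => //.
    by apply: measurable_and; apply: measurable_fun_lte.
  by do 2 apply: measurableT_comp => //.
by apply/funext => -[x||]//=; rewrite ltNyr ltry.
Qed.

(** In the variable e^(-s) the Laplace transform of a count is a power series whose coefficients are
    the indicators of its values; integration turns them into probabilities. *)
Lemma lapl_count_series (w : E -> nat) B (s : R) : (0 < s)%R ->
  (lapl (s%:E * @cnt R E w B))%:E =
  \sum_(a <oo) (expR (- s) ^+ a * (@cnt R E w B == (a%:R)%:E)%:R)%:E.
Proof.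
move=> s0.
have p0 a : 0 <= (expR (- s) ^+ a * (@cnt R E w B == (a%:R)%:E)%:R)%:E.
  by rewrite lee_fin mulr_ge0// exprn_ge0// expR_ge0.
have [->|[k ->]] := cnt_cases w B.
  by rewrite gt0_muley ?lte_fin// eseries0// => a _ _; rewrite mulr0.
rewrite (@nneseriesD1 _ _ k)//.
rewrite eqxx mulr1 eseries0 ?adde0.
  by rewrite /= -expRM_natr mulNr.
move=> a _ /= ak; rewrite (_ : _ == _ = false) ?mulr0//.
by apply/negbTE; rewrite eqe eqr_nat eq_sym.
Qed.

End counts.

Section config_law.
Context {R : realType} {E : ptopologicalType}.
Local Open Scope ereal_scope.
Implicit Types (w : Omega R E).

Lemma cfg_cnt_ge0 w B : 0 <= cfg_cnt w B.
Proof. by apply: esum_ge0 => x _; rewrite lee_fin. Qed.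
Hint Resolve cfg_cnt_ge0 : core.

Lemma measurable_cfg_cnt (B : set E) : (@open E).-sigma.-measurable B ->
  measurable_fun setT (fun w => cfg_cnt w B).
Proof.
move=> mB _ A mA; rewrite setTI; apply: sub_sigma_algebra.
exists B; first exact: mB.
by exists A => //; apply/seteqP; split => w; [exact: set_mem|exact: mem_set].
Qed.

Fixpoint wcount (l : seq (R * set E)) w : \bar R :=
  if l is (s, B) :: l' then s%:E * cfg_cnt w B + wcount l' w else 0.

Context (loc : set (set E)).
Context (loc_meas : forall B, loc B -> (@open E).-sigma.-measurable B).

Fixpoint loc_weights (l : seq (R * set E)) : Prop :=
  if l is (s, B) :: l' then [/\ (0 < s)%R, loc B & loc_weights l'] else True.

Fixpoint count_event (l : seq (nat * set E)) : set (Omega R E) :=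
  if l is (k, B) :: l' then
    [set w | cfg_cnt w B = (k%:R)%:E] `&` count_event l' else setT.

Fixpoint loc_counts (l : seq (nat * set E)) : Prop :=
  if l is (k, B) :: l' then loc B /\ loc_counts l' else True.

Lemma wcount_ge0 l w : loc_weights l -> 0 <= wcount l w.
Proof.
elim: l => [//|[s B] l ih] /= [s0 _ /ih l0].
by rewrite adde_ge0// mule_ge0// lee_fin ltW.
Qed.

Lemma measurable_wcount l : loc_weights l -> measurable_fun setT (wcount l).
Proof.
elim: l => [_|[s B] l ih] /=; first exact: measurable_cst.
move=> [s0 /loc_meas mB /ih ml]; apply: emeasurable_funD => //.
by apply: measurable_funeM; exact: measurable_cfg_cnt.
Qed.

(** The events fixing finitely many counts; the sets may overlap, so that concatenating lists gives
    stability under intersection. *)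
Definition count_system : set (set (Omega R E)) :=
  [set G | exists l, loc_counts l /\ G = count_event l].

Lemma count_system_setI : setI_closed count_system.
Proof.
move=> _ _ [l [ll ->]] [l' [ll' ->]]; exists (l ++ l'); split.
  by elim: l ll => [//|[k B] l ih] /= [lB /ih].
by elim: l {ll} => [|[k B] l ih] /=; rewrite ?setTI// -setIA ih.
Qed.

Context (loc_cover : forall B, (@open E).-sigma.-measurable B ->
  exists F : (set E)^nat, [/\ trivIset setT F, forall j, loc (F j) &
    B = \bigcup_j F j]).

Lemma count_system_sigma : @measurable _ (Omega R E) = <<s count_system >>.
Proof.
apply/seteqP; split; last first.
  apply: smallest_sub; first exact: sigma_algebra_measurable.
  move=> _ [l [ll ->]]; elim: l ll => [_|[k B] l ih] /=; first exact: measurableT.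
  move=> [lB /ih ml]; apply: measurableI => //.
  rewrite (_ : [set w | _] = setT `&` ((fun w => cfg_cnt w B) @^-1` [set (k%:R)%:E])).
    by apply: measurable_cfg_cnt => //; exact: loc_meas.
  by rewrite setTI.
pose T' := g_sigma_algebraType count_system.
have mcount B k : loc B -> <<s count_system >>
    [set w : Omega R E | cfg_cnt w B = (k%:R)%:E].
  move=> lB; apply: sub_sigma_algebra; exists [:: (k, B)]; split => //=.
  by rewrite setIT.
have mloc B : loc B -> measurable_fun [set: T'] (fun w : T' => cfg_cnt (w : Omega R E) B).
  move=> lB _ A mA; rewrite setTI.
  (* A count is a natural number or +oo, so its preimages are built from the countably many events
     of [count_system] and the complement of their union. *)
  pose U := \bigcup_(k in [set k | A (k%:R)%:E])
    [set w : T' | cfg_cnt (w : Omega R E) B = (k%:R)%:E].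
  pose V := ~` \bigcup_k [set w : T' | cfg_cnt (w : Omega R E) B = (k%:R)%:E].
  have mU : measurable (U : set T').
    by apply: (@bigcup_measurable _ T') => k _; exact: (mcount _ _ lB).
  have mV : measurable (V : set T').
    apply: (@measurableC _ T'); apply: (@bigcupT_measurable _ T') => k.
    exact: (mcount _ _ lB).
  rewrite (_ : _ @^-1` A = U `|` (if `[< A +oo >] then V else set0)).
    by apply: measurableU => //; case: ifP.
  apply/seteqP; split => w /=.
    move=> Aw; have [woo|[k wk]] := @cnt_cases R E (proj1_sig (w : config R E)) B.
      right; rewrite asboolT; last by rewrite -woo.
      by move=> [k _ /=]; rewrite /cfg_cnt woo.
    by left; exists k => //=; rewrite -wk.
  move=> [[k /= Ak ->//]|]; case: asboolP => // Aoo nV.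
  have [woo|[k wk]] := @cnt_cases R E (proj1_sig (w : config R E)) B.
    by rewrite /cfg_cnt woo.
  by exfalso; apply: nV; exists k.
apply: smallest_sub; first exact: (@sigma_algebra_measurable _ T').
move=> _ [B mB [A mA <-]].
have [F [tF lF BE]] := loc_cover mB.
have mB' : measurable_fun [set: T'] (fun w : T' => cfg_cnt (w : Omega R E) B).
  rewrite (_ : (fun w => _) = fun w : T' => \sum_(j <oo) cfg_cnt (w : Omega R E) (F j)).
    apply: ge0_emeasurable_sum => [j w _ _|j _]; first exact: cfg_cnt_ge0.
    exact: mloc.
  apply/funext => w; rewrite BE /cfg_cnt /cnt.
  by apply: nneseries_sum_bigcup => // x; rewrite lee_fin.
have := mB' measurableT A mA; rewrite setTI.
by rewrite (_ : _ @^-1` A = [set w | cfg_cnt w B \in A])//;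
  apply/seteqP; split => w; [exact: mem_set|exact: set_mem].
Qed.

Context (mu nu : probability (Omega R E) R).
Context (lapl_eq : forall l, loc_weights l ->
  \int[mu]_w (lapl (wcount l w))%:E = \int[nu]_w (lapl (wcount l w))%:E).

(** Interpolates between the Laplace functional (Z = 1) and the indicator of a count event. Since l
    is arbitrary, a factor e^(-s w(B)) can be adjoined for every s > 0, and comparing the
    coefficients in e^(-s) replaces it by the indicator of one value of w(B). *)
Let good (Z : Omega R E -> R) := [/\ measurable_fun setT Z,
  forall w, (0 <= Z w <= 1)%R &
  forall l, loc_weights l -> \int[mu]_w (Z w * lapl (wcount l w))%:E =
                             \int[nu]_w (Z w * lapl (wcount l w))%:E].

Let mlapl l : loc_weights l -> measurable_fun setT (fun w => lapl (wcount l w)).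
Proof. by move=> ll; exact: (measurableT_comp measurable_lapl (measurable_wcount ll)). Qed.

Let good_step Z k B : good Z -> loc B ->
  good (fun w => Z w * (cfg_cnt w B == (k%:R)%:E)%:R)%R.
Proof.
move=> [mZ Z01 HZ] lB.
have mind a : measurable_fun setT
    (fun w : Omega R E => (cfg_cnt w B == (a%:R)%:E)%:R : R).
  have mc := measurable_cfg_cnt (loc_meas lB).
  rewrite (_ : (fun w => _) = \1_[set w | cfg_cnt w B = (a%:R)%:E]).
    apply: measurable_indic.
    rewrite (_ : [set w | _] = setT `&` ((fun w => cfg_cnt w B) @^-1` [set (a%:R)%:E])).
      exact: mc.
    by rewrite setTI.
  apply/funext => w; rewrite indicE; congr ((nat_of_bool _)%:R).
  by apply/idP/idP => [/eqP h|/set_mem /= ->]; [exact/mem_set|exact: eqxx].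
have Z0 w : (0 <= Z w)%R by have /andP[] := Z01 w.
have Z1 w : (Z w <= 1)%R by have /andP[] := Z01 w.
have ZB01 a w : (0 <= Z w * (cfg_cnt w B == (a%:R)%:E)%:R <= 1)%R.
  by case: eqP => _; rewrite ?mulr1 ?mulr0 ?lexx ?ler01 ?Z0 ?Z1.
split => // [|l ll].
  exact: measurable_funM.
have L01 w : (0 <= lapl (wcount l w) <= 1)%R.
  by rewrite lapl_ge0 lapl_le1// wcount_ge0.
pose f a w := (Z w * (cfg_cnt w B == (a%:R)%:E)%:R * lapl (wcount l w))%R.
have f01 a w : (0 <= f a w <= 1)%R.
  have /andP[z0 z1] := ZB01 a w; have /andP[l0 l1] := L01 w.
  by rewrite /f mulr_ge0//= mulr_ile1.
have mf a : measurable_fun setT (f a).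
  by apply: measurable_funM; [exact: measurable_funM|exact: mlapl].
have int01 (P : probability (Omega R E) R) a :
    exists2 c, (0 <= c <= 1)%R & \int[P]_w (f a w)%:E = c%:E.
  have i0 : 0 <= \int[P]_w (f a w)%:E.
    by apply: integral_ge0 => w _; rewrite lee_fin; have /andP[] := f01 a w.
  have i1 : \int[P]_w (f a w)%:E <= 1.
    rewrite -[leRHS](integral_prob_cst P); apply: ge0_le_integral => //.
    - by move=> w _; rewrite lee_fin; have /andP[] := f01 a w.
    - exact/measurable_EFinP.
    - by move=> w _; rewrite lee_fin; have /andP[] := f01 a w.
  have ifin : \int[P]_w (f a w)%:E \is a fin_num.
    by rewrite ge0_fin_numE// (le_lt_trans i1)// ltry.
  exists (fine (\int[P]_w (f a w)%:E)); last by rewrite fineK.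
  by rewrite -!lee_fin fineK// i0 i1.
have /choice[c cP] : forall a, exists c, (0 <= c <= 1)%R /\ \int[mu]_w (f a w)%:E = c%:E.
  by move=> a; have [c ? ?] := int01 mu a; exists c.
have /choice[e eP] : forall a, exists c, (0 <= c <= 1)%R /\ \int[nu]_w (f a w)%:E = c%:E.
  by move=> a; have [c' ? ?] := int01 nu a; exists c'.
suff ce : forall a, c a = e a by rewrite (cP k).2 (eP k).2 ce.
apply: nneseries_eq_coef => [a|a|t /andP[t0 t1]].
- exact: (cP a).1.
- exact: (eP a).1.
(* Turns the power series variable t into e^(-s). *)
pose s := (- ln t)%R.
have s0 : (0 < s)%R by rewrite oppr_gt0 ln_lt0// t0.
have ts : expR (- s) = t by rewrite opprK lnK.
have ser (P : probability (Omega R E) R) (c' : nat -> R) :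
    (forall a, \int[P]_w (f a w)%:E = (c' a)%:E) ->
    \sum_(a <oo) (t ^+ a * c' a)%:E =
    \int[P]_w (Z w * lapl (wcount ((s, B) :: l) w))%:E.
  move=> c'E.
  transitivity (\int[P]_w \sum_(a <oo) ((t ^+ a)%:E * (f a w)%:E)).
    rewrite integral_nneseries//.
    - apply: eq_eseriesr => a _; rewrite ge0_integralZl//.
      + by rewrite c'E.
      + exact/measurable_EFinP.
      + by move=> w _; rewrite lee_fin; have /andP[] := f01 a w.
      + by rewrite lee_fin exprn_ge0// ltW.
    - by move=> a; apply: measurable_funeM; exact/measurable_EFinP.
    - move=> a w _; rewrite mule_ge0// lee_fin; first by rewrite exprn_ge0// ltW.
      by have /andP[] := f01 a w.
  apply: eq_integral => w _; rewrite [wcount _ _]/=.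
  rewrite laplD//; last 2 first.
  - by rewrite mule_ge0// lee_fin ltW.
  - exact: wcount_ge0.
  rewrite [X in (X)%:E](_ : _ = (Z w * lapl (wcount l w)) *
     lapl (s%:E * cfg_cnt w B))%R; last by ring.
  rewrite EFinM lapl_count_series// -nneseriesZl; last first.
    by move=> a _; rewrite lee_fin mulr_ge0// exprn_ge0// expR_ge0.
  apply: eq_eseriesr => a _; rewrite -!EFinM; congr (_%:E).
  by rewrite ts /f /cfg_cnt; ring.
rewrite (ser mu c (fun a => (cP a).2)) (ser nu e (fun a => (eP a).2)).
by apply: HZ; split.
Qed.

Lemma config_law_unique A : measurable A -> mu A = nu A.
Proof.
move=> mA.
apply: (@measure_unique _ R (Omega R E) _ (fun=> setT) count_system_sigma
  count_system_setI _ _ mu nu _ _ A mA).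
- by move=> _; exists [::].
- by rewrite bigcup_const//; exists point.
- move=> _ [l [ll ->]].
  have [Z [[mZ Z01 HZ] ZE]] : exists Z, good Z /\ forall w, Z w = \1_(count_event l) w.
    elim: l ll => [_|[k B] l ih] /=.
      exists (fun=> 1%R); split; last by move=> w; rewrite indicT.
      split; [exact: measurable_cst|by move=> _; rewrite ler01 lexx|].
      by move=> l ll; under eq_integral do rewrite mul1r;
        under [in RHS]eq_integral do rewrite mul1r; exact: lapl_eq.
    move=> [lB /ih [Z [gZ ZE]]].
    exists (fun w => Z w * (cfg_cnt w B == (k%:R)%:E)%:R)%R; split; first exact: good_step.
    move=> w; rewrite ZE !indicE in_setI mulrC -natrM mulnb; congr (_%:R)%R.
    congr (nat_of_bool (_ && _)).
    by apply/idP/idP => [/eqP h|/set_mem /= ->]; [exact/mem_set|exact: eqxx].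
  have mc : measurable (count_event l).
    by rewrite count_system_sigma; apply: sub_sigma_algebra; exists l.
  have h (P : probability (Omega R E) R) :
      P (count_event l) = \int[P]_w (Z w * lapl (wcount [::] w))%:E.
    transitivity (\int[P]_w (\1_(count_event l) w)%:E).
      by rewrite integral_indic// setIT.
    by apply: eq_integral => w _; rewrite /= oppr0 expR0 mulr1 ZE.
  by transitivity (\int[mu]_w (Z w * lapl (wcount [::] w))%:E);
    [exact: h|rewrite HZ//; exact/esym/h].
- move=> _; rewrite [X in X < _](_ : _ = 1) ?ltry//; exact: probability_setT.
Qed.

End config_law.

(** * The Laplace functional of a Poisson measure *)

Lemma esumZl (R : realType) (I : choiceType) (s : R) (a : I -> \bar R) (D : set I) :
  0 < s -> (forall i, 0 <= a i)%E ->
  (\esum_(i in D) (s%:E * a i) = s%:E * \esum_(i in D) a i)%E.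
Proof.
move=> s0 a0.
have le (r : R) (b : I -> \bar R) : 0 < r -> (forall i, 0 <= b i)%E ->
    (\esum_(i in D) (r%:E * b i) <= r%:E * \esum_(i in D) b i)%E.
  move=> r0 b0; apply: ge_ereal_sup => _ [X [finX XD] <-].
  rewrite -ge0_mule_fsumr//; apply: lee_wpmul2l; first by rewrite lee_fin ltW.
  by apply: esum_ge; exists X.
apply/eqP; rewrite eq_le le//=.
have sa0 i : (0 <= s%:E * a i)%E by rewrite mule_ge0// lee_fin ltW.
have := le s^-1 _ _ sa0; rewrite invr_gt0 => /(_ s0).
under eq_esum do rewrite muleA -EFinM mulVf ?gt_eqF// mul1e.
move=> h; apply: (@le_trans _ _ (s%:E * (s^-1%:E * \esum_(i in D) (s%:E * a i)))%E).
  by apply: lee_wpmul2l => //; rewrite lee_fin ltW.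
by rewrite muleA -EFinM divff ?gt_eqF// mul1e.
Qed.

Section weights.
Context {R : realType} {E : ptopologicalType}.
Implicit Types (l : seq (R * set E)).

Fixpoint lweight l (x : E) : R :=
  if l is (s, B) :: l' then s * \1_B x + lweight l' x else 0.

(** All subset sums of the weights: a finite list containing every value of [lweight l]. *)
Fixpoint lvalues l : seq R :=
  if l is (s, B) :: l' then lvalues l' ++ [seq s + v | v <- lvalues l'] else [:: 0].

Lemma lweight_values l x : lweight l x \in lvalues l.
Proof.
elim: l => [|[s B] l ih] /=; first exact: mem_head.
rewrite mem_cat indicE; case: (x \in B) => /=.
  by rewrite mulr1 map_f ?orbT.
by rewrite mulr0 add0r ih.
Qed.

Definition lrange l : seq R := [seq v <- undup (lvalues l) | v != 0].

Lemma lweight_levels l x :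
  lweight l x = \sum_(c <- lrange l) c * (lweight l x == c)%:R.
Proof.
set u := lweight l x.
have [u0|u0] := eqVneq u 0.
  rewrite big_seq big1 ?u0// => c; rewrite mem_filter => /andP[c0 _].
  by rewrite eq_sym (negbTE c0) mulr0.
have ur : u \in lrange l by rewrite mem_filter u0 mem_undup lweight_values.
rewrite (bigD1_seq u)//=; last by rewrite filter_uniq// undup_uniq.
rewrite eqxx mulr1 big1 ?addr0// => c cu.
by rewrite eq_sym (negbTE cu) mulr0.
Qed.

Local Open Scope ereal_scope.

Lemma wcount_lweight l (loc : set (set E)) (w : Omega R E) : loc_weights loc l ->
  wcount l w = \esum_(x in [set: E]) (lweight l x * (proj1_sig w x)%:R)%:E.
Proof.
have lw0 l' x : loc_weights loc l' -> (0 <= lweight l' x)%R.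
  elim: l' => [//|[s B] l' ih] /= [s0 _ /ih]; rewrite indicE => l0.
  by rewrite addr_ge0// mulr_ge0// ltW.
elim: l => [_|[s B] l ih] /=.
  by rewrite esum1// => x _; rewrite mul0r.
move=> [s0 _ ll]; rewrite ih//.
have z0 x : 0 <= (if x \in B then ((proj1_sig w x)%:R)%:E else 0) :> \bar R.
  by case: ifP => // _; rewrite lee_fin.
transitivity (\esum_(x in [set: E]) (s%:E * (if x \in B then ((proj1_sig w x)%:R)%:E else 0)
    + (lweight l x * (proj1_sig w x)%:R)%:E)); last first.
  apply: eq_esum => x _; rewrite indicE; case: (x \in B).
    by rewrite -EFinM -EFinD mulr1 mulrDl.
  by rewrite mule0 add0e mulr0 add0r.
rewrite esumD; first last.
- by move=> x _; rewrite lee_fin mulr_ge0// lw0.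
- by move=> x _; rewrite mule_ge0// lee_fin ltW.
rewrite esumZl//.
by rewrite -esum_mkcond.
Qed.

Lemma lweight_ge0 (loc : set (set E)) l x : loc_weights loc l -> (0 <= lweight l x)%R.
Proof.
elim: l => [//|[s B] l ih] /= [s0 _ /ih]; rewrite indicE => l0.
by rewrite addr_ge0// mulr_ge0// ltW.
Qed.

Lemma measurable_lweight (loc : set (set E)) l :
  (forall B, loc B -> (@open E).-sigma.-measurable B) -> loc_weights loc l ->
  measurable_fun [set: borel E] (lweight l).
Proof.
move=> lm; elim: l => [_|[s B] l ih] /=; first exact: measurable_cst.
move=> [s0 /lm mB /ih ml]; apply: measurable_funD => //.
by apply: measurable_funM => //; exact: measurable_indic.
Qed.

Lemma lrange_gt0 (loc : set (set E)) l c : loc_weights loc l -> c \in lrange l -> (0 < c)%R.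
Proof.
move=> ll; rewrite mem_filter mem_undup => /andP[c0 cl].
rewrite lt_neqAle eq_sym c0/=.
elim: l ll c {c0} cl => [_ c|[s B] l ih /= [s0 _ /ih {}ih] c]; first by rewrite inE => /eqP ->.
rewrite mem_cat => /orP[/ih//|/mapP[v vl ->]].
by apply: addr_ge0; [exact: ltW|exact: ih].
Qed.

(** The sets in l may overlap, whereas independence is given for disjoint sets; the level sets of
    the total weight are disjoint and carry the same sum. *)
Lemma wcount_levels l (loc : set (set E)) (w : Omega R E) : loc_weights loc l ->
  wcount l w =
  \sum_(c <- lrange l) c%:E * cfg_cnt w [set x | lweight l x = c].
Proof.
move=> ll; rewrite (wcount_lweight w ll).
have c0 c : c \in lrange l -> (0 < c)%R by exact: lrange_gt0 ll.
transitivity (\esum_(x in [set: E]) \sum_(c <- lrange l)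
   (c%:E * (if x \in [set x | lweight l x = c] then ((proj1_sig w x)%:R)%:E else 0))).
  apply: eq_esum => x _.
  rewrite [X in (X * _)%:E]lweight_levels mulr_suml -sumEFin.
  apply: eq_bigr => c _; case: eqP => h.
    by rewrite mem_set// mulr1 EFinM.
  by rewrite memNset// mulr0 mul0r mule0.
have z0 c x : 0 <= (if x \in [set x | lweight l x = c]
                    then ((proj1_sig w x)%:R)%:E else 0) :> \bar R.
  by case: ifP => // _; rewrite lee_fin.
rewrite big_seq; under eq_esum do rewrite big_seq.
rewrite esum_sum; last first.
  by move=> x c _ cl; rewrite mule_ge0// lee_fin ltW// c0.
apply: eq_bigr => c cl; rewrite esumZl//; last exact: c0.
by rewrite -esum_mkcond.
Qed.

End weights.

Section poisson_laplace.
Context {R : realType} {E : ptopologicalType}.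
Context (m : {measure set (borel E) -> \bar R}) (P0 : probability (Omega R E) R).
Context (P0_poisson : poisson_measure m P0).
Local Open Scope ereal_scope.
Implicit Types (w : Omega R E) (B : nat -> set E) (s : nat -> R) (a : nat -> nat).

(** The first k factors are Laplace factors, the others prescribe exact counts; k = 0 is the product
    formula of the Poisson axioms and k = n the Laplace functional. *)
Let mix B s a k n w : R := (\prod_(i < n)
  (if (i < k)%N then lapl ((s i)%:E * cfg_cnt w (B i))
   else (cfg_cnt w (B i) == ((a i)%:R)%:E)%:R))%R.

Let pois (i : nat) (B : nat -> set E) (k : nat) : R :=
  (expR (- fine (m (B i))) * (fine (m (B i))) ^+ k / (k`!)%:R)%R.

Let pois_ge0 i B k : (0 <= pois i B k)%R.
Proof. by rewrite /pois divr_ge0// mulr_ge0 ?expR_ge0// exprn_ge0// fine_ge0. Qed.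

Let pois_lapl i B t : (0 <= t)%R ->
  \sum_(b <oo) (t ^+ b * pois i B b)%:E = (expR (- fine (m (B i)) * (1 - t)))%:E.
Proof.
move=> t0; set lam := fine (m (B i)).
have lam0 : (0 <= lam)%R by exact: fine_ge0.
transitivity (\sum_(b <oo) ((expR (- lam))%:E * ((lam * t) ^+ b / b`!%:R)%:E)).
  apply: eq_eseriesr => b _; rewrite -EFinM; congr (_%:E).
  by rewrite /pois exprMn -/lam; ring.
rewrite nneseriesZl; last first.
  by move=> b _; rewrite lee_fin divr_ge0// exprn_ge0// mulr_ge0.
rewrite nneseries_exp ?mulr_ge0//.
by rewrite -EFinM -expRD; congr (expR _)%:E; ring.
Qed.

Let measurable_mix B s a k n : (forall i, (@open E).-sigma.-measurable (B i)) ->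
  measurable_fun setT (mix B s a k n).
Proof.
move=> mB; rewrite /mix.
apply: measurable_prod => i _; have mc := measurable_cfg_cnt (R := R) (mB i).
case: (i < k)%N.
  apply: (measurableT_comp measurable_lapl).
  exact: measurable_funeM.
rewrite (_ : (fun w => _) = \1_[set w | cfg_cnt w (B i) = ((a i)%:R)%:E]).
  apply: measurable_indic.
  rewrite (_ : [set w | _] = setT `&` ((fun w => cfg_cnt w (B i)) @^-1` [set ((a i)%:R)%:E])).
    exact: mc.
  by rewrite setTI.
apply/funext => w; rewrite indicE; congr ((nat_of_bool _)%:R)%R.
by apply/idP/idP => [/eqP h|/set_mem /= ->]; [exact/mem_set|exact: eqxx].
Qed.

Let mix_ge0 B s a k n w : (0 <= mix B s a k n w)%R.
Proof. by apply: prodr_ge0 => i _; case: ifP => // _; exact: lapl_ge0. Qed.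

Let integral_mix B s a k n : (forall i, (@open E).-sigma.-measurable (B i)) ->
  (forall i, m (B i) < +oo) -> trivIset setT B -> (forall i, (0 < s i)%R) ->
  (k <= n)%N ->
  \int[P0]_w (mix B s a k n w)%:E = (\prod_(i < n)
    (if (i < k)%N then expR (- fine (m (B i)) * (1 - expR (- s i)))
     else pois i B (a i)))%R%:E.
Proof.
move=> mB fB tB s0.
elim: k a => [|k ih] a kn.
  have [ax1 ax2] := P0_poisson.
  have := ax2 n (fun i : 'I_n => B i) (fun i : 'I_n => [set ((a i)%:R)%:E]) (fun i => mB i).
  have tB' (i j : 'I_n) : i != j -> B i `&` B j = set0.
    by move=> ij; have /trivIsetP := tB; apply.
  move=> /(_ tB' (fun=> emeasurable_set1 _)).
  have evE (i : 'I_n) : [set w : Omega R E | cfg_cnt w (B i) \in [set ((a i)%:R)%:E]]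
      = [set w | cfg_cnt w (B i) = ((a i)%:R)%:E].
    by apply/seteqP; split => w /=; rewrite in_setE.
  under eq_bigcapr do rewrite evE.
  under eq_bigr do rewrite evE ax1//.
  move=> h; transitivity (P0 (\bigcap_(i in [set: 'I_n])
      [set w | cfg_cnt w (B i) = ((a i)%:R)%:E])); last exact: h.
  have mcap : measurable (\bigcap_(i in [set: 'I_n])
      [set w : Omega R E | cfg_cnt w (B i) = ((a i)%:R)%:E]).
    apply: fin_bigcap_measurable => // i _.
    rewrite (_ : [set w | _] = setT `&` ((fun w => cfg_cnt w (B i)) @^-1` [set ((a i)%:R)%:E])).
      exact: (measurable_cfg_cnt (mB i)).
    by rewrite setTI.
  transitivity (\int[P0]_w (\1_(\bigcap_(i in [set: 'I_n])
      [set w | cfg_cnt w (B i) = ((a i)%:R)%:E]) w)%:E); last first.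
    by rewrite integral_indic// setIT.
  apply: eq_integral => w _; congr (_%:E); rewrite /mix /= indicE.
  case: (boolP (w \in _)) => [/set_mem h'|h'].
    by rewrite big1// => i _; rewrite (h' i I) eqxx.
  have [i hi] : exists i : 'I_n, cfg_cnt w (B i) != ((a i)%:R)%:E.
    apply: contrapT => nex; move: h'; rewrite notin_setE; apply => i _ /=.
    by apply/eqP; apply: contrapT => hi; apply: nex; exists i; exact/negP.
  by rewrite (bigD1 i)//= (negbTE hi) mul0r.
pose t := expR (- s k); have t0 : (0 <= t)%R by exact: expR_ge0.
pose K := Ordinal kn.
pose c := (\prod_(i < n | i != K)
    (if (i < k)%N then expR (- fine (m (B i)) * (1 - expR (- s i)))
     else pois i B (a i)))%R.
have c0 : (0 <= c)%R.
  by apply: prodr_ge0 => i _; case: ifP => _ //; exact: expR_ge0.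
have neK (i : 'I_n) : i != K -> (i == k :> nat) = false.
  by move=> iK; apply/negbTE; apply: contra iK => /eqP h; exact/eqP/val_inj.
(* The new Laplace factor is expanded over the values b of the count at k, and each term falls under
   the induction hypothesis with the prescribed count changed to b. *)
transitivity (\int[P0]_w \sum_(b <oo) ((t ^+ b)%:E * (mix B s (seq_upd k a b) k n w)%:E)).
  apply: eq_integral => w _.
  pose Z := (\prod_(i < n | i != K)
    (if (i < k)%N then lapl ((s i)%:E * cfg_cnt w (B i))
     else (cfg_cnt w (B i) == ((a i)%:R)%:E)%:R))%R.
  have ZE b : mix B s (seq_upd k a b) k n w = (Z * (cfg_cnt w (B k) == (b%:R)%:E)%:R)%R.
    rewrite /mix (bigD1 K)//= ltnn /seq_upd eqxx mulrC; congr (_ * _)%R.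
    by apply: eq_bigr => i /neK ->.
  have -> : mix B s a k.+1 n w = (Z * lapl ((s k)%:E * cfg_cnt w (B k)))%R.
    rewrite /mix (bigD1 K)//= ltnSn mulrC; congr (_ * _)%R.
    by apply: eq_bigr => i /neK ik; rewrite ltnS leq_eqVlt ik.
  rewrite EFinM lapl_count_series// -nneseriesZl; last first.
    by move=> b _; rewrite lee_fin mulr_ge0// exprn_ge0.
  by apply: eq_eseriesr => b _; rewrite ZE -!EFinM; congr (_%:E); rewrite /t; ring.
rewrite integral_nneseries//; first last.
- by move=> b w _; rewrite mule_ge0// lee_fin ?exprn_ge0.
- by move=> b; apply: measurable_funeM; apply/measurable_EFinP; exact: measurable_mix.
transitivity (\sum_(b <oo) (c%:E * (t ^+ b * pois k B b)%:E)).
  apply: eq_eseriesr => b _; rewrite ge0_integralZl//; first last.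
  - by rewrite lee_fin exprn_ge0.
  - by move=> w _; rewrite lee_fin.
  - by apply/measurable_EFinP; exact: measurable_mix.
  rewrite ih; last exact: ltnW.
  rewrite -!EFinM; congr (_%:E); rewrite (bigD1 K)//= ltnn /seq_upd eqxx.
  rewrite mulrA mulrC; congr (_ * _)%R.
  by apply: eq_bigr => i /neK ->.
rewrite nneseriesZl; last first.
  by move=> b _; rewrite lee_fin mulr_ge0// exprn_ge0.
rewrite pois_lapl// -EFinM; congr (_%:E).
rewrite [in RHS](bigD1 K)//= ltnSn mulrC; congr (_ * _)%R.
by apply: eq_bigr => i /neK ik; rewrite [in RHS]ltnS [in RHS]leq_eqVlt ik.
Qed.

Lemma poisson_lapl_disjoint B s n : (forall i, (@open E).-sigma.-measurable (B i)) ->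
  (forall i, m (B i) < +oo) -> trivIset setT B -> (forall i, (0 < s i)%R) ->
  \int[P0]_w (lapl (\sum_(i < n) (s i)%:E * cfg_cnt w (B i)))%:E =
  (expR (- \sum_(i < n) (1 - expR (- s i)) * fine (m (B i))))%:E.
Proof.
move=> mB fB tB s0.
have := @integral_mix B s (fun=> 0%N) n n mB fB tB s0 (leqnn n).
have -> : (\prod_(i < n) (if (i < n)%N then expR (- fine (m (B i)) * (1 - expR (- s i)))
     else pois i B 0) = expR (- \sum_(i < n) (1 - expR (- s i)) * fine (m (B i))))%R.
  rewrite -sumrN expR_sum; apply: eq_bigr => i _; rewrite ltn_ord.
  by congr expR; ring.
move=> <-; apply: eq_integral => w _; congr (_%:E).
rewrite /mix; under [RHS]eq_bigr do rewrite ltn_ord.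
elim: n => [|n ih]; first by rewrite !big_ord0 lapl0.
rewrite !big_ord_recr/= laplD ?ih//.
  by apply: sume_ge0 => i _; rewrite mule_ge0 ?cfg_cnt_ge0// lee_fin ltW.
by rewrite mule_ge0 ?cfg_cnt_ge0// lee_fin ltW.
Qed.

Lemma poisson_lapl (loc : set (set E)) (l : seq (R * set E)) :
  (forall B : set E, loc B -> (@open E).-sigma.-measurable B) ->
  (forall B : set E, loc B -> m B < +oo) -> loc_weights loc l ->
  exists2 c : R, \int[m]_x (1 - expR (- lweight l x))%:E = c%:E &
    \int[P0]_w (lapl (wcount l w))%:E = (expR (- c))%:E.
Proof.
move=> lm lf ll.
pose r := lrange l; pose n := size r.
(* The finite families are continued by weight 1 and the empty set, which keeps positivity and
   disjointness for all indices. *)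
pose s i := if (i < n)%N then (nth 0 r i)%R else 1%R.
pose B i : set E := if (i < n)%N then [set x | lweight l x = nth 0%R r i] else set0.
have mu := measurable_lweight lm ll.
have mB i : (@open E).-sigma.-measurable (B i).
  rewrite /B; case: ifP => // _.
  rewrite (_ : [set x | _] = setT `&` (lweight l @^-1` [set nth 0%R r i])).
    exact: mu.
  by rewrite setTI.
have s0 i : (0 < s i)%R.
  rewrite /s; case: ifP => // ir; apply: (lrange_gt0 ll); exact: mem_nth.
have supp_fin : m [set x | lweight l x != 0%R] < +oo.
  elim: l ll {r n s B mu mB s0} => [_|[s B] l ih] /=.
    rewrite (_ : [set x | _] = set0) ?measure0//.
    by apply/seteqP; split => x //=; rewrite eqxx.
  move=> [s0 lB ll]; have mu := measurable_lweight lm ll.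
  have m1 : measurable ([set x | lweight l x != 0%R] : set (borel E)).
    rewrite (_ : [set x | _] = setT `&` (lweight l @^-1` [set~ 0%R])).
      by apply: mu => //; exact: measurableC.
    by rewrite setTI; apply/seteqP; split => x /=; [move=> /eqP|move=> /eqP].
  have sub : [set x | s * \1_B x + lweight l x != 0%R]%R `<=`
     B `|` [set x | lweight l x != 0%R].
    move=> x /=; rewrite indicE; case: (boolP (x \in B)) => [/set_mem|_]; first by left.
    by rewrite mulr0 add0r => ?; right.
  have mu' := measurable_lweight lm (l := (s, B) :: l) (And3 s0 lB ll).
  have m2 : measurable ([set x | s * \1_B x + lweight l x != 0%R]%R : set (borel E)).
    rewrite (_ : [set x | _] = setT `&` (lweight ((s, B) :: l) @^-1` [set~ 0%R])).
      by apply: mu' => //; exact: measurableC.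
    by rewrite setTI; apply/seteqP; split => x /=; [move=> /eqP|move=> /eqP].
  have mB := lm _ lB.
  apply: le_lt_trans (lte_add_pinfty (lf _ lB) (ih ll)).
  apply: (@le_trans _ _ (m (B `|` [set x | lweight l x != 0%R]))); last first.
    exact: measureU2.
  apply: le_measure; [exact/mem_set|apply/mem_set; exact: measurableU|exact: sub].
have r0 i : (i < n)%N -> nth 0%R r i != 0%R.
  by move=> ir; have := mem_nth 0%R ir; rewrite mem_filter => /andP[].
have msupp : measurable ([set x | lweight l x != 0%R] : set (borel E)).
  rewrite (_ : [set x | _] = setT `&` (lweight l @^-1` [set~ 0%R])).
    by apply: mu => //; exact: measurableC.
  by rewrite setTI; apply/seteqP; split => x /=; [move=> /eqP|move=> /eqP].
have fB i : m (B i) < +oo.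
  rewrite /B; case: ifP => ir; last by rewrite measure0.
  apply: le_lt_trans supp_fin; apply: le_measure.
  - by apply/mem_set; have := mB i; rewrite /B ir.
  - exact/mem_set.
  - by move=> x /= ->; exact: r0.
have tB : trivIset setT B.
  apply/trivIsetP => i j _ _ ij; apply/seteqP; split => // x [].
  rewrite /B; case: ifP => // ir; case: ifP => // jr /= -> /eqP.
  by rewrite nth_uniq// ?(negbTE ij)// filter_uniq// undup_uniq.
exists (\sum_(i < n) (1 - expR (- s i)) * fine (m (B i)))%R; last first.
  rewrite -(poisson_lapl_disjoint n mB fB tB s0).
  apply: eq_integral => w _; rewrite (wcount_levels w ll); congr (lapl _)%:E.
  rewrite (big_nth 0%R) big_mkord; apply: eq_bigr => i _.
  by rewrite /s /B ltn_ord.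
have e0 i : (0 <= 1 - expR (- s i))%R.
  by rewrite subr_ge0 expR_le1 oppr_le0 ltW.
transitivity (\int[m]_x \sum_(i < n) ((1 - expR (- s i))%:E * (\1_(B i) x)%:E)).
  apply: eq_integral => x _.
  have [u0|u0] := eqVneq (lweight l x) 0%R.
    rewrite u0 oppr0 expR0 subrr big1// => i _.
    rewrite indicE memNset ?mule0// /B ltn_ord /= u0 => /esym/eqP.
    by apply/negP; rewrite r0.
  have ur : lweight l x \in r by rewrite mem_filter u0 mem_undup lweight_values.
  have kn : (index (lweight l x) r < n)%N by rewrite index_mem.
  rewrite (bigD1 (Ordinal kn))//= big1 ?adde0.
    by rewrite indicE mem_set ?mule1 /s ?kn ?nth_index// /B kn /= nth_index.
  move=> i ik; rewrite indicE memNset ?mule0// /B ltn_ord /= => h.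
  move/eqP: ik; apply; apply: val_inj => /=.
  by rewrite h index_uniq// filter_uniq// undup_uniq.
rewrite ge0_integral_sum//; first last.
- by move=> i x _; rewrite mule_ge0// lee_fin.
- by move=> i; apply: measurable_funeM; apply/measurable_EFinP; exact: measurable_indic.
rewrite -sumEFin; apply: eq_bigr => i _.
rewrite ge0_integralZl//.
- by rewrite integral_indic// setIT EFinM fineK// ge0_fin_numE.
- by apply/measurable_EFinP; exact: measurable_indic.
- by rewrite lee_fin.
Qed.

End poisson_laplace.

(** * Cells *)

Section clopen_exhaustion.
Context {R : realType} {E : completePseudoMetricType R}.
Context (E_lc : locally_compact [set: E]).

(** The bound 1 makes the set of radii bounded, so that its supremum exists even if all balls are
    relatively compact. *)
Definition good_radius (x : E) : set R :=
  [set r | 0 < r <= 1 /\ exists K, compact K /\ ball x r `<=` K].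

Lemma good_radius_ex x : exists r, good_radius x r.
Proof.
have [U /= nU [cU _]] := E_lc (I : [set: E] x).
have {}nU : nbhs x U.
  have nU' : nbhs x [set y | [set: E] y -> U y] by exact: nU.
  by apply: filterS nU' => y /(_ I).
have /nbhs_ballP[e /= e0 eU] := nU.
exists (Num.min e 1); split.
  by rewrite lt_min e0 ltr01 ge_min lexx orbT.
exists U; split => //; apply: subset_trans eU; apply: le_ball.
by rewrite ge_min lexx.
Qed.

Lemma good_radius_sub x y r r' : good_radius x r -> 0 < r' ->
  ball x (r - r') y -> r' <= r -> good_radius y r'.
Proof.
move=> [/andP[r0 r1] [K [cK bK]]] r'0 xy r'r; split.
  by rewrite r'0 (le_trans r'r).
exists K; split => // z yz; apply: bK.
by have := ball_triangle xy yz; rewrite subrK.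
Qed.

(** An enlargement by a fixed fraction of the admissible radius: large enough that iterating it
    yields a closed union, small enough to stay inside a compact set. *)
Definition half_nbhd (L : set E) : set E :=
  [set y | exists x r, [/\ L x, good_radius x r & ball x (r / 2) y]].

Lemma half_nbhd_compact L : compact L ->
  exists K, compact K /\ half_nbhd L `<=` K.
Proof.
move=> cL.
pose rho x := sup (good_radius x).
have hs x : has_sup (good_radius x).
  split; first exact: good_radius_ex.
  by exists 1 => r [/andP[]].
have rho_ub x r : good_radius x r -> r <= rho x by apply: (ub_le_sup (hs x).2).
have rho0 x : 0 < rho x.
  have [r gr] := good_radius_ex x; apply: lt_le_trans (rho_ub _ _ gr).
  by have [/andP[]] := gr.
(* The supremum need not be a good radius itself; three quarters of it lie below some good one. *)
have /choice[k kP] : forall x, exists K, compact K /\ ball x (3 / 4 * rho x) `<=` K.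
  move=> x.
  have e0 : 0 < rho x / 4 by rewrite divr_gt0.
  have [r gr hr] := sup_adherent e0 (hs x).
  have [_ [K [cK bK]]] := gr; exists K; split => //.
  apply: subset_trans bK; apply: le_ball; apply/ltW.
  by apply: le_lt_trans hr; rewrite -/(rho x); lra.
pose f x := (ball x (rho x / 8))^°.
have e8 x : 0 < rho x / 8 by rewrite divr_gt0.
have cL' : cover_compact L by rewrite -compact_cover.
have Lc : L `<=` cover setT f.
  by move=> x Lx; exists x => //; exact: nbhsx_ballx.
have [D _ LD] := cL' E setT f (fun x _ => @open_interior _ _) Lc.
exists (\big[setU/set0]_(x <- finmap.enum_fset D) k x); split.
  apply: (big_ind (fun A : set E => compact A)) => [||x _]; [exact: compact0|by move=> A B; exact: compactU|].
  exact: (kP x).1.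
move=> y [x' [r' [Lx' gr' yb]]].
have [x /= xD xx'] := LD _ Lx'.
have {}xx' := interior_subset xx'.
rewrite -bigcup_seq; exists x => //=; apply: (kP x).2.
(* As x' lies within rho x / 8 of x, the radius r' - rho x / 8 is good at x. Then y is within (1/8 +
   9/16) rho x = 11/16 rho x of x, below the 3/4 rho x of [kP]. *)
have hr' : r' <= 9 / 8 * rho x.
  have [h|h] := leP r' (rho x / 8); first by have := rho0 x; lra.
  have : good_radius x (r' - rho x / 8).
    apply: (good_radius_sub gr'); first by rewrite subr_gt0.
      by rewrite subKr; exact: ball_sym.
    by have := rho0 x; lra.
  by move=> /rho_ub; lra.
apply: le_ball (ball_triangle xx' yb).
by have := rho0 x; lra.
Qed.

(** Each L n is a neighbourhood-wise enlargement of the previous one, so the union is open, and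
    closed by the choice of [half_nbhd]. A compact K meets it in a compact set, which is covered by
    finitely many interiors. *)
Lemma clopen_exhaustion (C : (set E)^nat) : (forall n, compact (C n)) ->
  exists L : (set E)^nat, [/\ forall n, compact (L n),
    forall n, C n `<=` L n, nondecreasing_seq L &
    forall K, compact K -> exists J, K `&` \bigcup_n L n `<=` L J].
Proof.
move=> cC.
have nxt (L : set E) : exists K, compact L -> compact K /\ half_nbhd L `<=` K.
  have [cL|ncL] := pselect (compact L); last by exists set0.
  by have [K hK] := half_nbhd_compact cL; exists K.
have [g gP] := choice nxt.
pose L := fix L n := if n is n'.+1 then C n'.+1 `|` (L n' `|` g (L n')) else C 0%N.
have cL n : compact (L n).
  elim: n => [|n ih]; first exact: cC.
  by apply: compactU; [exact: cC|apply: compactU => //; exact: (gP _ ih).1].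
have LS n : L n `<=` L n.+1 by move=> x Lx; right; left.
have hL n : half_nbhd (L n) `<=` L n.+1.
  by move=> x hx; right; right; exact: (gP _ (cL n)).2.
have ndL : nondecreasing_seq L by apply/nondecreasing_seqP => n; apply/subsetPset.
pose U := \bigcup_n L n.
have L_int n x : L n x -> nbhs x (L n.+1).
  move=> Lx; have [r gr] := good_radius_ex x.
  have r0 : 0 < r by have [/andP[]] := gr.
  apply: filterS (nbhsx_ballx x (r / 2) _); last by rewrite divr_gt0.
  by move=> y xy; apply: hL; exists x, r.
have cU : closed U.
  move=> y clU; have [r gr] := good_radius_ex y.
  have r0 : 0 < r by have [/andP[]] := gr.
  have r40 : 0 < r / 4 by rewrite divr_gt0.
  (* At a point x within r/4 of y the radius 3r/4 is good, and its half 3r/8 exceeds r/4, so the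
     next enlargement contains y. *)
  have [x [[n _ Lx] xy]] := clU _ (nbhsx_ballx y (r / 4) r40).
  exists n.+1 => //; apply: hL; exists x, (3 / 4 * r); split => //.
    apply: (good_radius_sub gr); [by lra| |by lra].
    by rewrite (_ : r - 3 / 4 * r = r / 4)//; lra.
  by apply: le_ball (ball_sym xy); lra.
exists L; split => //.
- by case=> [|n] x Cx //; left.
- move=> K cK.
  have cKU : compact (K `&` U) by exact: compact_closedI.
  have cKU' : cover_compact (K `&` U) by rewrite -compact_cover.
  have KUc : K `&` U `<=` cover setT (fun n => (L n)^°).
    by move=> x [_ [n _ Lx]]; exists n.+1 => //; exact: L_int.
  have [D _ KD] := cKU' nat setT (fun n => (L n)^°) (fun n _ => @open_interior _ _) KUc.
  exists (\max_(n <- finmap.enum_fset D) n)%N => x xKU.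
  have [n /= nD xn] := KD _ xKU.
  have := interior_subset xn; apply/subsetPset/ndL.
  exact: (@leq_bigmax_seq _ _ xpredT id n nD isT).
Qed.

End clopen_exhaustion.

Section block_index.
Context {R : realType} (k : nat -> nat) (k_gt0 : forall j, (0 < k j)%N).

Let c n := (\sum_(j < n) k j)%N.

Let cS n : c n.+1 = (c n + k n)%N. Proof. by rewrite /c big_ord_recr. Qed.

Let c_ge n : (n <= c n)%N.
Proof.
elim: n => [//|n ih]; rewrite cS -addn1; apply: leq_add => //.
Qed.

Let c_mono n n' : (n <= n')%N -> (c n <= c n')%N.
Proof.
move=> nn'; rewrite -(subnKC nn'); elim: (n' - n)%N => [|d ih]; first by rewrite addn0.
by rewrite addnS cS (leq_trans ih)// leq_addr.
Qed.

(** Enumerates the naturals with j repeated k j times, the copies of j occupying the indices from c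
    j to c j.+1 - 1. The first clause keeps the repeated cells locally finite. *)
Lemma block_index_ex : exists J : nat -> nat,
  (forall j0, exists i0, forall i, (i0 <= i)%N -> (j0 <= J i)%N) /\
  forall G : nat -> \bar R, (forall j, 0 <= G j)%E ->
    (\sum_(i <oo) G (J i) = \sum_(j <oo) (k j)%:R%:E * G j)%E.
Proof.
have ex i : exists j, (i < c j.+1)%N by exists i; rewrite (leq_trans _ (c_ge i.+1)).
pose J i := ex_minn (ex i).
have Jlt i : (i < c (J i).+1)%N by rewrite /J; case: ex_minnP.
have Jge i : (c (J i) <= i)%N.
  rewrite /J; case: ex_minnP => -[|j] _ hj; first by rewrite /c big_ord0.
  by rewrite leqNgt; apply/negP => /hj; rewrite ltnn.
have Jeq i n : (c n <= i < c n.+1)%N -> J i = n.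
  move=> /andP[h1 h2]; apply/eqP; rewrite eqn_leq; apply/andP; split.
    by rewrite /J; case: ex_minnP => j _; apply.
  rewrite leqNgt; apply/negP => h; have := Jlt i.
  by rewrite ltnNge (leq_trans _ h1)// c_mono.
exists J; split.
  move=> j0; exists (c j0) => i ci; rewrite leqNgt; apply/negP => h.
  by have := Jlt i; rewrite ltnNge (leq_trans _ ci)// c_mono.
move=> G G0.
have kG0 j : (0 <= (k j)%:R%:E * G j)%E by rewrite mule_ge0// lee_fin.
have block n : (\sum_(0 <= i < c n) G (J i) = \sum_(0 <= j < n) (k j)%:R%:E * G j)%E.
  elim: n => [|n ih]; first by rewrite /c big_ord0 !big_nil.
  rewrite [RHS]big_nat_recr//= -ih (big_cat_nat (n := c n))//=; last exact: c_mono.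
  congr (_ + _)%E.
  transitivity (\sum_(c n <= i < c n.+1) G n)%E.
    by apply: eq_big_nat => i hi; rewrite (Jeq _ n).
  rewrite big_const_nat cS addKn; elim: (k n) => [|q ih']; first by rewrite mul0e.
  by rewrite iterS ih' -[in RHS]natr1 EFinD ge0_muleDl ?lee_fin// mul1e addeC.
apply/eqP; rewrite eq_le; apply/andP; split.
- apply: lime_le; first by apply: is_cvg_nneseries => n *; exact: G0.
  apply: nearW => n; apply: (@le_trans _ _ (\sum_(0 <= i < c n) G (J i))%E).
    rewrite [leRHS](big_cat_nat (n := n))//=.
    by rewrite leeDl// sume_ge0.
  by rewrite block; apply: nneseries_lim_ge => *; exact: kG0.
- apply: lime_le; first by apply: is_cvg_nneseries => n *; exact: kG0.
  apply: nearW => n; rewrite -block.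
  by apply: nneseries_lim_ge => *; exact: G0.
Qed.

End block_index.

Section cells.
Context {R : realType} {E : completePseudoMetricType R}.
Context (E_hausdorff : hausdorff_space E) (E_lc : locally_compact [set: E]).
Context (m : {measure set (borel E) -> \bar R}).
Context (m_sfin : sigma_finite [set: borel E] m) (m_radon : radon_measure m).
Local Open Scope ereal_scope.

Lemma compact_measurable (K : set E) : compact K -> (@open E).-sigma.-measurable K.
Proof.
move=> cK; have cl := compact_closed E_hausdorff cK.
rewrite -(setCK K); apply: (@measurableC _ (borel E)).
by apply: sub_sigma_algebra; exact: closed_openC.
Qed.

(** Inner regularity exhausts each finite piece F n by compact sets up to 1 / (j + 1); the countably
    many pairs (n, j) are put in one sequence. *)
Lemma conull_compacts : exists C : (set E)^nat,
  (forall n, compact (C n)) /\ m (~` \bigcup_n C n) = 0.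
Proof.
have [F FT Ffin] := m_sfin; have [mK mB] := m_radon.
have inner n j : exists K : set E, [/\ compact K, K `<=` F n &
    m (F n `\` K) <= (j.+1%:R^-1)%:E].
  have [mF Fn] := Ffin n.
  have ffin : ereal_sup [set m K | K in [set K : set E | compact K /\ K `<=` F n]] \is a fin_num.
    by rewrite -mB// ge0_fin_numE.
  have e0 : (0 < j.+1%:R^-1 :> R)%R by rewrite invr_gt0.
  have [_ [K [cK KF] <-] hK] := ub_ereal_sup_adherent e0 ffin.
  exists K; split => //; move: hK; rewrite -mB// => hK.
  have mKm := compact_measurable cK.
  rewrite measureD//.
  rewrite setIidr// leeBlDr; last by rewrite ge0_fin_numE// mK.
  by rewrite addeC -leeBlDr// ltW.
have /choice[K KP] : forall nj : nat * nat, exists K : set E, [/\ compact K, K `<=` F nj.1 &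
    m (F nj.1 `\` K) <= (nj.2.+1%:R^-1)%:E] by move=> [n j]; exact: inner.
pose C p : set E := if @choice.unpickle (nat * nat)%type p is Some nj then K nj else set0.
have cC n : compact (C n).
  by rewrite /C; case: choice.unpickle => [nj|]; [have [] := KP nj|exact: compact0].
exists C; split => //.
have mC n := compact_measurable (cC n).
have mU : measurable (~` \bigcup_n C n : set (borel E)).
  by apply: measurableC; exact: bigcupT_measurable.
have null n : m (F n `\` \bigcup_n C n) = 0.
  apply/eqP; rewrite eq_le measure_ge0 andbT.
  apply/lee_addgt0Pr => e e0; rewrite add0e.
  have [j hj] : exists j : nat, (j.+1%:R^-1 <= e)%R.
    exists (Num.truncn e^-1); rewrite -[leRHS]invrK lef_pV2 ?posrE ?invr_gt0//.
    by rewrite ltW// truncnS_gt.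
  apply: (@le_trans _ _ (j.+1%:R^-1)%:E); last by rewrite lee_fin.
  have [cK KF hK] := KP (n, j).
  apply: le_trans hK; apply: le_measure.
  - apply/mem_set; apply: measurableD; first exact: (Ffin n).1.
    exact: bigcupT_measurable.
  - apply/mem_set; apply: measurableD; first exact: (Ffin n).1.
    exact: compact_measurable.
  - move=> x [Fx nC]; split => // Kx; apply: nC.
    by exists (choice.pickle (n, j)) => //; rewrite /C choice.pickleK.
have -> : ~` (\bigcup_n C n) = \bigcup_n (F n `\` \bigcup_n C n).
  by rewrite -setD_bigcupl -FT setTD.
apply/eqP; rewrite eq_le measure_ge0 andbT.
have mFC n : (@open E).-sigma.-measurable (F n `\` \bigcup_n C n).
  by apply: (@measurableD _ (borel E)); [exact: (Ffin n).1|exact: bigcupT_measurable].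
apply: (@le_trans _ _ (\sum_(n <oo) m (F n `\` \bigcup_n C n))).
  by apply: measure_sigma_subadditive => //; exact: bigcup_measurable.
by rewrite eseries0// => n _ _; rewrite /= null.
Qed.

Lemma cells_ex (g : E -> R) (C delta : R) :
  measurable_fun [set: borel E] g -> (forall x, 0 <= g x <= C)%R -> (0 < delta)%R ->
  exists A : nat -> set E, exists w : nat -> R,
  [/\ forall i, (@open E).-sigma.-measurable (A i),
      forall i, (0 <= w i)%R, forall i, m (A i) < +oo,
      forall i, exists2 K, compact K & A i `<=` K &
      forall K, compact K -> exists I, forall i, (I <= i)%N -> A i `&` K = set0] /\
  (forall f : E -> \bar R, (forall x, 0 <= f x) -> measurable_fun [set: borel E] f ->
     \sum_(i <oo) (w i)%:E * \int[m]_(x in A i) f x = \int[m]_x f x) /\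
  \sum_(i <oo) (expR (w i * fine (\int[m]_(x in A i) (g x)%:E)) - 1 -
       w i * fine (\int[m]_(x in A i) (g x)%:E))%:E <= delta%:E.
Proof.
move=> mg gC d0; have [mK _] := m_radon.
have [C' [cC C0]] := conull_compacts.
have [L [cL CL ndL KL]] := clopen_exhaustion E_lc cC.
pose B := seqD L.
have mL n := compact_measurable (cL n).
have mB n : measurable (B n : set (borel E)).
  by rewrite /B; case: n => [|n] //=; exact: measurableD.
have BL n : B n `<=` L n by rewrite /B; case: n => [|n] /=; [|exact: subDsetl].
have tB : trivIset setT B by exact: trivIset_seqD.
have BE : \bigcup_n B n = \bigcup_n L n by rewrite /B eq_bigcup_seqD.
have mBfin n : m (B n) < +oo.
  by apply: le_lt_trans (mK _ (cL n)); apply: le_measure; [exact/mem_set|exact/mem_set|exact: BL].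
have null : m (~` \bigcup_n B n) = 0.
  apply/eqP; rewrite eq_le measure_ge0 andbT -C0 BE; apply: le_measure.
  - by apply/mem_set/measurableC; exact: bigcupT_measurable.
  - by apply/mem_set/measurableC/bigcupT_measurable => n; exact: compact_measurable.
  - by apply: subsetC => x [n _ Cx]; exists n => //; exact: CL.
pose a j := fine (\int[m]_(x in B j) (g x)%:E).
have a0 j : (0 <= a j)%R.
  by apply/fine_ge0/integral_ge0 => x _; rewrite lee_fin; have /andP[] := gC x.
pose ex j := (expR (a j) - 1 - a j)%R.
have ex0 j : (0 <= ex j)%R.
  by rewrite /ex; have := expR_ge1Dx (a j); lra.
(* By [exp_tail_scale] with r = 1 / k the k copies together cost at most k (1/k)^2 ex j = ex j / k,
   which this k brings below the j-th term of a geometric series of sum delta. *)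
pose k j := (Num.truncn (ex j / (delta / (2 ^ j.+1)%:R))).+1.
have dj j : (0 < delta / (2 ^ j.+1)%:R)%R by rewrite divr_gt0// ltr0n expn_gt0.
have kj j : (ex j / (k j)%:R <= delta / (2 ^ j.+1)%:R)%R.
  rewrite ler_pdivrMr ?ltr0n// mulrC -ler_pdivrMr//.
  by rewrite ltW// truncnS_gt.
have [J [Jlim JE]] := @block_index_ex R k (fun=> erefl).
exists (fun i => B (J i)), (fun i => (k (J i))%:R^-1)%R; split; [split|split].
- by move=> i; exact: mB.
- by move=> i; rewrite invr_ge0.
- by move=> i; exact: mBfin.
- by move=> i; exists (L (J i)).
(* The shift to j0 + 1 is due to [B j.+1] having [L j] removed, and [L j] contains [L j0] once j >=
   j0. *)
- move=> K cK; have [j0 hj] := KL K cK; have [i0 hi] := Jlim j0.+1.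
  exists i0 => i /hi; case: (J i) => [//|j] jj.
  apply/seteqP; split => // x [[Lx nLx] Kx]; apply: nLx.
  have Lj : L j0 `<=` L j by apply/subsetPset/ndL.
  by apply: Lj; apply: hj; split => //; exists j.+1.
- move=> f f0 mf.
  have fB j : 0 <= ((k j)%:R^-1)%:E * \int[m]_(x in B j) f x.
    by rewrite mule_ge0 ?lee_fin ?invr_ge0//; exact: integral_ge0.
  rewrite (JE (fun j => ((k j)%:R^-1)%:E * \int[m]_(x in B j) f x))//.
  transitivity (\sum_(j <oo) \int[m]_(x in B j) f x).
    by apply: eq_eseriesr => j _; rewrite muleA -EFinM divff ?pnatr_eq0// mul1e.
  transitivity (\int[m]_(x in \bigcup_j B j) f x).
    by apply/esym/ge0_integral_bigcup => //; exact: measurable_funTS.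
  rewrite [RHS](@ge0_negligible_integral _ _ _ m setT (~` \bigcup_n B n))//.
  + by rewrite setTD setCK.
  + by apply: measurableC; exact: bigcupT_measurable.
- rewrite (JE (fun j => (expR ((k j)%:R^-1 * a j) - 1 - (k j)%:R^-1 * a j)%:E)); last first.
    by move=> j; rewrite lee_fin; have := expR_ge1Dx ((k j)%:R^-1 * a j)%R; lra.
  apply: le_trans (epsilon_trick0 xpredT (ltW d0)).
  apply: lee_nneseries => j _.
    by rewrite mule_ge0 ?lee_fin//; have := expR_ge1Dx ((k j)%:R^-1 * a j)%R; lra.
  rewrite -EFinM lee_fin; apply: le_trans (kj j).
  have k1 : (0 <= ((k j)%:R^-1 : R) <= 1)%R.
    by apply/andP; rewrite invr_ge0 ler0n invf_le1 ?ler1n ?ltr0n.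
  have := exp_tail_scale k1 (a0 j); rewrite -/(ex j) => h.
  apply: (@le_trans _ _ ((k j)%:R * ((k j)%:R^-1 ^+ 2 * ex j))%R).
    by apply: ler_wpM2l.
  by rewrite le_eqVlt; apply/orP; left; apply/eqP; field; rewrite pnatr_eq0.
Qed.

End cells.

(** * Superposition *)

Lemma exchange_esum (R : realType) (I J : choiceType) (a : I -> J -> \bar R) :
  (forall i j, 0 <= a i j)%E ->
  (\esum_(i in [set: I]) \esum_(j in [set: J]) a i j =
   \esum_(j in [set: J]) \esum_(i in [set: I]) a i j)%E.
Proof.
move=> a0; rewrite !esum_esum//.
rewrite (reindex_esum ([set: J] `*`` (fun=> [set: I])) _ (fun k => (k.2, k.1)))//.
split => //.
- by move=> [i j] [i' j'] _ _ /= [-> ->].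
- by move=> [i j] _; exists (j, i).
Qed.

Lemma nneseries_ord (R : realType) (f : nat -> \bar R) n : (forall i, 0 <= f i)%E ->
  (forall i, (n <= i)%N -> f i = 0%E) ->
  (\sum_(i <oo) f i = \sum_(i < n) f i)%E.
Proof.
move=> f0 fn; rewrite (nneseries_split 0 n)// add0n eseries0 ?adde0; last first.
  by move=> i ni _; exact: fn.
by rewrite big_mkord.
Qed.

Section superposition.
Context {R : realType} {E : ptopologicalType}.
Context (A : nat -> set E) (mA : forall i, (@open E).-sigma.-measurable (A i)).
Context (A_loc : forall K, compact K -> exists I, forall i, (I <= i)%N -> A i `&` K = set0).
Local Notation S := (@plist _ (borel E)).
Implicit Types (X : Seq S) (u : E -> R).

Let idx_ex x : exists I, forall i, (I <= i)%N -> A i `&` [set x] = set0.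
Proof. by apply: A_loc; exact: compact_set1. Qed.

Let idx x := sval (cid (idx_ex x)).

Let idxP x i : (idx x <= i)%N -> x \notin A i.
Proof.
move=> /(svalP (cid (idx_ex x))) h; apply/negP => /set_mem Ax.
by have : (A i `&` [set x]) x by []; rewrite h.
Qed.

Definition cut u i (x : borel E) : R := u x * \1_(A i) x.

(** No cell of index [idx x] or more contains x, so the multiplicity is a finite sum. Points of list
    i outside [A i] are dropped, which makes the result locally finite for every X and not only
    almost surely. *)
Definition superpose_fun X (x : E) : nat :=
  (\sum_(i < idx x) \sum_(r < (X i).1) (((X i).2 r == x) && (x \in A i)))%N.

Lemma esum_superpose X u : (forall x, 0 <= u x) ->
  (\esum_(x in [set: E]) (u x * (superpose_fun X x)%:R)%:E =
   \sum_(i <oo) (lsum (cut u i) (X i))%:E)%E.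
Proof.
move=> u0.
pose a x i : \bar R := (\sum_(r < (X i).1)
  (u x * (((X i).2 r == x) && (x \in A i))%:R)%:E)%E.
have a0 x i : (0 <= a x i)%E.
  by apply: sume_ge0 => r _; rewrite lee_fin mulr_ge0.
transitivity (\esum_(x in [set: E]) \esum_(i in [set: nat]) a x i)%E.
  apply: eq_esum => x _; rewrite -nneseries_esumT// (@nneseries_ord _ _ (idx x))//; last first.
    move=> i /idxP/negbTE xA; rewrite /a big1// => r _.
    by rewrite xA andbF mulr0.
  rewrite /superpose_fun natr_sum mulr_sumr -sumEFin; apply: eq_bigr => i _.
  rewrite natr_sum mulr_sumr -sumEFin; exact: eq_bigr.
rewrite exchange_esum// -nneseries_esumT; last by move=> i; exact: esum_ge0.
apply: eq_eseriesr => i _; rewrite /a esum_sum; last first.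
  by move=> x r _ _; rewrite lee_fin mulr_ge0.
rewrite /lsum -sumEFin; apply: eq_bigr => r _.
set y := (X i).2 r.
rewrite -(@esum_set1 R E y (fun x => (cut u i x)%:E)); last first.
  by rewrite lee_fin mulr_ge0.
rewrite [RHS]esum_mkcond; apply: eq_esum => x _.
have [<-|yx] := eqVneq y x.
  by rewrite (mem_set (A := [set y]))// /cut indicE.
by rewrite (memNset (A := [set y])) ?mulr0// => /= xy; move: yx; rewrite xy eqxx.
Qed.

Lemma cnt_superpose X (B : set E) :
  @cnt R E (superpose_fun X) B =
  (\sum_(i <oo) (lsum (cut \1_B i) (X i))%:E)%E.
Proof.
rewrite -esum_superpose// /cnt esum_mkcond; apply: eq_esum => x _.
by rewrite indicE; case: (x \in B); rewrite ?mul1r ?mul0r.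
Qed.

Let lsum_u0 u (s : S) i : (forall x, 0 <= u x) ->
  (0 <= (lsum (cut u i) s)%:E)%E.
Proof. by move=> u0; rewrite lee_fin lsum_ge0// => x; exact: mulr_ge0. Qed.

Let lsum_eq0 u (s : S) i (B : set E) : (forall x, x \notin B -> u x = 0) ->
  A i `&` B = set0 -> lsum (cut u i) s = 0.
Proof.
move=> uB AB; rewrite /lsum big1// => r _; set y := s.2 r.
case: (boolP (y \in B)) => yB; last by rewrite /cut uB// mul0r.
rewrite /cut indicE memNset ?mulr0// => Ay.
have : (A i `&` B) y by split => //; exact: set_mem.
by rewrite AB.
Qed.

Lemma superpose_radon X : @radon_config R E (superpose_fun X).
Proof.
move=> K cK; rewrite cnt_superpose; have [I hI] := A_loc cK.
rewrite (@nneseries_ord _ _ I).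
- by rewrite sumEFin ltry.
- by move=> i; exact: lsum_u0.
- move=> i /hI AK; rewrite (@lsum_eq0 _ _ _ K)// => x xK.
  by rewrite indicE (negbTE xK).
Qed.

Definition superpose X : Omega R E := exist _ _ (superpose_radon X).

Lemma measurable_cut u i : measurable_fun [set: borel E] u ->
  measurable_fun [set: borel E] (cut u i).
Proof. by move=> mu; apply: measurable_funM => //; exact: measurable_indic. Qed.

Lemma measurable_lsum_cut u : measurable_fun [set: borel E] u -> (forall x, 0 <= u x) ->
  measurable_fun [set: Seq S] (fun X : Seq S => \sum_(i <oo) (lsum (cut u i) (X i))%:E)%E.
Proof.
move=> mu u0; apply: ge0_emeasurable_sum => [i X _ _|i _]; first exact: lsum_u0.
apply/measurable_EFinP.
exact: (measurableT_comp (measurable_lsum (measurable_cut i mu)) (measurable_coord i)).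
Qed.

Lemma measurable_superpose : measurable_fun setT superpose.
Proof.
apply: (@measurability _ _ (Seq S) (Omega R E) setT superpose (@config_gen R E)) => // _ [_ [B /= mB [Y mY <-]] <-].
rewrite setTI (_ : superpose @^-1` _ = setT `&`
  (fun X : Seq S => \sum_(i <oo) (lsum (cut \1_B i) (X i))%:E)%E @^-1` Y).
  by apply: measurable_lsum_cut => //; exact: measurable_indic.
rewrite setTI; apply/seteqP; split => X /=; rewrite /cfg_cnt /= cnt_superpose.
  by move=> /set_mem.
by move=> ?; exact/mem_set.
Qed.

End superposition.

(** The multiplied form also covers cells of measure 0, where both sides vanish and a point mass is
    taken. *)
Lemma normalized_restr_exists d (T : measurableType d) (R : realType)
    (m : {measure set T -> \bar R}) (A : set T) : measurable A -> (m A < +oo)%E ->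
  exists p : probability T R, forall F : T -> \bar R,
    (forall x, 0 <= F x)%E -> measurable_fun setT F ->
    ((fine (m A))%:E * \int[p]_x F x = \int[m]_(x in A) F x)%E.
Proof.
move=> mA Afin.
exists (mnormalize (mrestr m mA) (dirac point)) => F F0 mF.
have mFin : m A \is a fin_num by rewrite ge0_fin_numE.
have [A0|A0] := eqVneq (m A) 0%E.
  rewrite A0 mul0e; apply/esym.
  transitivity (\int[mzero]_(x in A) F x)%E; last exact: integral_measure_zero.
  apply: eq_measure_integral => B mB BA; apply/eqP; rewrite eq_le measure_ge0 andbT.
  rewrite -[leRHS]A0; apply: le_measure => //; exact/mem_set.
have c0 : 0 <= (fine (m A))^-1 by rewrite invr_ge0 fine_ge0.
have pE B : mnormalize (mrestr m mA) (dirac point) B =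
    (m (B `&` A) * ((fine (m A))^-1)%:E)%E.
  rewrite /mnormalize /= /mrestr setTI (negbTE A0) /=.
  by rewrite lt_eqF.
rewrite -(setUv A) ge0_integral_setU//; first last.
- by apply/disj_setPS => x [].
- by rewrite setUv.
- exact: measurableC.
have -> : (\int[mnormalize (mrestr m mA) (dirac point)]_(x in ~` A) F x = 0)%E.
  transitivity (\int[mzero]_(x in ~` A) F x)%E; last exact: integral_measure_zero.
  apply: eq_measure_integral => B mB BA; rewrite [LHS]pE.
  by rewrite (_ : B `&` A = set0) ?measure0 ?mul0e//; apply/disjoints_subset.
rewrite adde0 (eq_measure_integral (mscale (NngNum c0) m)); last first.
  by move=> B mB BA; rewrite [LHS]pE setIidl// /mscale/= muleC.
rewrite ge0_integral_mscale//; last exact: measurable_funTS.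
by rewrite muleA -EFinM divff ?mul1e// fine_eq0.
Qed.

(** * The superposition of independent Poisson lists is a Poisson configuration *)

Section superposition_law.
Context {R : realType} {E : ptopologicalType} (m : {measure set (borel E) -> \bar R}).
Context (A : nat -> set E) (w : nat -> R) (p : nat -> probability (borel E) R).
Context (mA : forall i, (@open E).-sigma.-measurable (A i)) (w0 : forall i, 0 <= w i).
Context (A_fin : forall i, (m (A i) < +oo)%E).
Context (A_cpt : forall i, exists2 K, compact K & A i `<=` K).
Context (A_loc : forall K, compact K -> exists I, forall i, (I <= i)%N -> A i `&` K = set0).
Context (cells_integral : forall f : E -> \bar R, (forall x, 0 <= f x)%E ->
  measurable_fun [set: borel E] f ->
  (\sum_(i <oo) (w i)%:E * \int[m]_(x in A i) f x = \int[m]_x f x)%E).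
Context (pE : forall i (F : borel E -> \bar R), (forall x, 0 <= F x)%E -> measurable_fun setT F ->
  ((fine (m (A i)))%:E * \int[p i]_x F x = \int[m]_(x in A i) F x)%E).
Local Open Scope ereal_scope.

Definition cell_rate i : R := (w i * fine (m (A i)))%R.

Lemma cell_rate_ge0 i : (0 <= cell_rate i)%R.
Proof. by rewrite mulr_ge0// fine_ge0. Qed.

Lemma cell_rateE i (F : borel E -> \bar R) : (forall x, 0 <= F x) -> measurable_fun setT F ->
  (cell_rate i)%:E * \int[p i]_x F x = (w i)%:E * \int[m]_(x in A i) F x.
Proof. by move=> F0 mF; rewrite EFinM -muleA pE. Qed.

Definition cell_prob i : probability (@plist _ (borel E)) R := plist_prob (p i) (cell_rate i).

(** The test sets are those meeting finitely many cells, rather than the relatively compact ones: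
    the cells cover E only up to a null set, and E minus all cells must be reachable by countably
    many test sets. *)
Definition bounded_cells : set (set E) := [set B | (@open E).-sigma.-measurable B /\
  exists I, forall i, (I <= i)%N -> A i `&` B = set0].

Let loc_sub (B C : set E) : (@open E).-sigma.-measurable B -> bounded_cells C ->
  B `<=` C -> bounded_cells B.
Proof.
move=> mB [_ [I hI]] BC; split => //; exists I => i /hI AC.
by apply/seteqP; split => // x [Ax /BC Cx]; rewrite -AC.
Qed.

Let bounded_cell i : bounded_cells (A i).
Proof.
split => //; have [K cK AK] := A_cpt i; have [I hI] := A_loc cK.
exists I => j /hI Aj; apply/seteqP; split => // x [Ajx /AK Kx].
by rewrite -Aj.
Qed.

Let bounded_cells_cover B : (@open E).-sigma.-measurable B ->
  exists F : nat -> set E, [/\ trivIset setT F, forall j, bounded_cells (F j) & B = \bigcup_j F j].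
Proof.
move=> mB.
pose D := seqDU A.
have mD j : (@open E).-sigma.-measurable (D j).
  apply: (@measurableD _ (borel E)) => //.
  by apply: bigsetU_measurable.
have mU : (@open E).-sigma.-measurable (\bigcup_i A i) by exact: bigcupT_measurable.
(* Piece 0 lies outside all cells and so meets none of them; the other pieces lie in a single cell
   each. *)
pose F j := if j is k.+1 then B `&` D k else B `\` \bigcup_i A i.
have DA : \bigcup_i D i = \bigcup_i A i by rewrite -seqDU_bigcup_eq.
have DsA k : D k `<=` A k by exact: subset_seqDU.
exists F; split.
- apply/trivIsetP => -[|i] [|j] _ _ //= ij.
  + by apply/seteqP; split => // x [[_ nA] [_ /DsA Ax]]; apply: nA; exists j.
  + by apply/seteqP; split => // x [[_ /DsA Ax] [_ nA]]; apply: nA; exists i.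
  + have /trivIsetP/(_ i j I I ij) Dij := trivIset_seqDU A.
    by apply/seteqP; split => // x [[_ Dix] [_ Djx]]; rewrite -Dij.
- case=> [|k] /=.
    split; first exact: (@measurableD _ (borel E)).
    exists 0%N => i _; apply/seteqP; split => // x [Aix [_ nA]].
    by apply: nA; exists i.
  apply: (loc_sub _ (bounded_cell k)); first exact: (@measurableI _ (borel E)).
  by move=> x [_ /DsA].
- apply/seteqP; split => [x Bx|x [[|k] _ /= []]//].
  have [[i _ Ax]|nA] := pselect ((\bigcup_i A i) x); last by exists 0%N.
  have [k _ Dx] : (\bigcup_i D i) x by rewrite DA; exists i.
  by exists k.+1.
Qed.

Let bounded_cells_fin B : bounded_cells B -> m B < +oo.
Proof.
move=> [mB [I hI]].
pose f : borel E -> \bar R := EFin \o (\1_B : borel E -> R).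
have f0 x : 0 <= f x by rewrite lee_fin.
have mBi : measurable_fun [set: borel E] f.
  by apply/measurable_EFinP; exact: measurable_indic.
have <- : \int[m]_x f x = m B by rewrite integral_indic// setIT.
rewrite -cells_integral//.
have t0 i : 0 <= (w i)%:E * \int[m]_(x in A i) f x.
  by rewrite mule_ge0 ?lee_fin//; exact: integral_ge0.
have tE i : \int[m]_(x in A i) f x = m (B `&` A i).
  by rewrite integral_indic.
rewrite (@nneseries_ord _ _ I)//; last first.
  by move=> i /hI AB; rewrite tE setIC AB measure0 mule0.
apply: lte_sum_pinfty => i _; rewrite tE; apply: lte_mul_pinfty => //.
  by rewrite lee_fin.
apply: le_lt_trans (A_fin i); apply: le_measure; first exact/mem_set/measurableI.
  exact/mem_set.
exact: subIsetr.
Qed.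

Let lweight_bounded l : loc_weights bounded_cells l ->
  exists n, forall i x, (n <= i)%N -> A i x -> lweight l x = 0%R :> R.
Proof.
elim: l => [_|[s B] l ih] /=; first by exists 0%N.
move=> [_ [_ [I hI]] /ih[n hn]]; exists (maxn I n) => i x.
rewrite geq_max => /andP[Ii ni] Ax; rewrite (hn i)// addr0 indicE memNset ?mulr0//.
move=> Bx; have : (A i `&` B) x by [].
by rewrite hI.
Qed.

Let integral_expRN_cut (u : E -> R) i : measurable_fun [set: borel E] u ->
  (forall x, 0 <= u x)%R ->
  exists q : R, \int[p i]_x (expR (- cut A u i x))%:E = q%:E /\
    (cell_rate i * (1 - q))%:E = (w i)%:E * \int[m]_(x in A i) (1 - expR (- u x))%:E.
Proof.
move=> mu u0.
have mc := measurable_cut mA i mu.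
have mexp : measurable_fun [set: borel E] (fun x => expR (- cut A u i x)).
  by apply: measurableT_comp => //; exact: measurableT_comp.
have c0 x : (0 <= cut A u i x)%R by exact: mulr_ge0.
have me : measurable_fun [set: borel E] (fun x => (expR (- cut A u i x))%:E).
  exact/measurable_EFinP.
have mF : measurable_fun [set: borel E] (fun x => (1 - expR (- cut A u i x))%:E).
  by apply/measurable_EFinP; exact: measurable_funB.
have F0 x : 0 <= (1 - expR (- cut A u i x))%:E.
  by rewrite lee_fin subr_ge0 expR_le1 oppr_le0.
have e0 x : 0 <= (expR (- cut A u i x))%:E by rewrite lee_fin expR_ge0.
have sum1 : \int[p i]_x (1 - expR (- cut A u i x))%:E +
    \int[p i]_x (expR (- cut A u i x))%:E = 1.
  rewrite -ge0_integralD// -[RHS](integral_prob_cst (p i)).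
  by apply: eq_integral => x _; rewrite -EFinD subrK.
have fin_e : \int[p i]_x (expR (- cut A u i x))%:E \is a fin_num.
  rewrite ge0_fin_numE; last exact: integral_ge0.
  apply: (@le_lt_trans _ _ 1); last exact: ltry.
  by rewrite -sum1 leeDr// integral_ge0.
exists (fine (\int[p i]_x (expR (- cut A u i x))%:E)); rewrite fineK//; split => //.
rewrite EFinM EFinB fineK// -[X in X - _]sum1 addeK// cell_rateE//.
congr (_ * _); apply: eq_integral => x /set_mem Ax.
by rewrite /cut indicE mem_set// mulr1.
Qed.

(** Both Laplace functionals equal exp (- int (1 - e^(-u)) dm). The weight u of a list of test sets
    vanishes on all but finitely many cells, which reduces the product side to finitely many
    lists. *)
Lemma superpose_law (P0 : probability (Omega R E) R) : poisson_measure m P0 ->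
  forall B, measurable B -> seq_prod cell_prob (@superpose R _ _ A_loc @^-1` B) = P0 B.
Proof.
move=> P0_poisson B mB.
have mT := @measurable_superpose R _ _ mA A_loc.
have [Q QE] := push_prob_exists (seq_prod cell_prob) mT.
rewrite -QE; apply: (config_law_unique (loc := bounded_cells)) => //.
  by move=> C [].
move=> l ll.
have lm C : bounded_cells C -> (@open E).-sigma.-measurable C by case.
have [c cE ->] := poisson_lapl P0_poisson lm bounded_cells_fin ll.
have mu := measurable_lweight lm ll.
have u0 x : (0 <= lweight l x)%R by exact: lweight_ge0 ll.
rewrite (ge0_integral_transfer mT (fun A _ => QE A)); first last.
- by move=> z; rewrite lee_fin lapl_ge0.
- apply/measurable_EFinP; apply: (measurableT_comp measurable_lapl).
  exact: measurable_wcount ll.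
have [n hn] := lweight_bounded ll.
have cut0 i x : (n <= i)%N -> cut A (lweight l) i x = 0%R.
  move=> ni; rewrite /cut indicE; case: (boolP (x \in A i)) => [/set_mem Ax|_].
    by rewrite (hn i)// mul0r.
  by rewrite mulr0.
have /choice[q qE] : forall i, exists q : R,
    \int[p i]_x (expR (- cut A (lweight l) i x))%:E = q%:E /\
    (cell_rate i * (1 - q))%:E =
      (w i)%:E * \int[m]_(x in A i) (1 - expR (- lweight l x))%:E.
  by move=> i; exact: integral_expRN_cut.
have -> : c = (\sum_(i < n) cell_rate i * (1 - q i))%R.
  apply: EFin_inj; rewrite -cE -sumEFin -cells_integral; first last.
  - apply/measurable_EFinP; apply: measurable_funB => //.
    by apply: measurableT_comp => //; exact: measurableT_comp.
  - by move=> x; rewrite lee_fin subr_ge0 expR_le1 oppr_le0.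
  rewrite (@nneseries_ord _ _ n).
  - by apply: eq_bigr => i _; rewrite (qE i).2.
  - move=> i; apply: mule_ge0; first by rewrite lee_fin.
    by apply: integral_ge0 => x _; rewrite lee_fin subr_ge0 expR_le1 oppr_le0.
  - move=> i ni; rewrite integral0_eq ?mule0// => x Ax.
    by rewrite (hn i)// oppr0 expR0 subrr.
transitivity (\int[seq_prod cell_prob]_X
   (\prod_(i < n) expR (lsum (fun x => - cut A (lweight l) i x)%R (X i)))%:E).
  apply: eq_integral => X _; congr (_%:E).
  rewrite (wcount_lweight _ ll) /= (esum_superpose A_loc)//.
  rewrite (@nneseries_ord _ _ n); first last.
  - by move=> i ni; rewrite /lsum big1// => r _; exact: cut0.
  - by move=> i; rewrite lee_fin; apply: lsum_ge0 => x; exact: mulr_ge0.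
  rewrite sumEFin /= -sumrN expR_sum; apply: eq_bigr => i _.
  by rewrite /lsum sumrN.
rewrite (@seq_prod_prodf _ _ _ cell_prob n
  (fun i s => expR (lsum (fun x => - cut A (lweight l) i x)%R s))
  (fun i => expR (cell_rate i * (q i - 1))%R)).
- rewrite -expR_sum -sumrN; congr (expR _)%:E.
  by apply: eq_bigr => i _; ring.
- move=> i; apply: measurableT_comp => //; apply: measurable_lsum.
  by apply: measurableT_comp => //; exact: measurable_cut.
- by move=> i s; exact: expR_ge0.
- move=> i; apply: integral_expR_lsum; first exact: cell_rate_ge0.
    by apply: measurableT_comp => //; exact: measurable_cut.
  exact: (qE i).1.
Qed.

End superposition_law.

Section superposition_distance.
Context {R : realType} {E : ptopologicalType}.
Context (A : nat -> set E).
Context (A_loc : forall K, compact K -> exists I, forall i, (I <= i)%N -> A i `&` K = set0).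
Local Notation S := (@plist _ (borel E)).
Implicit Types (X Y : Seq S) (u : E -> R).

(* On the coordinates where X and Y agree both may be replaced by the empty list
   without changing the difference of the superpositions. *)
Lemma superpose_dist X Y (b : nat -> bool) u : (forall x, 0 <= u x) ->
  (forall i, b i -> X i = Y i) ->
  (\esum_(x in [set: E])
     (u x * `|((superpose_fun A_loc X x)%:R - (superpose_fun A_loc Y x)%:R)|)%:E <=
   \sum_(i <oo) (if b i then 0
     else lsum (cut A u i) (X i) + lsum (cut A u i) (Y i))%:E)%E.
Proof.
move=> u0 XY.
pose mask Z : Seq S := fun i => if b i then (0%N, point) else Z i.
have c0 i x : 0 <= cut A u i x by exact: mulr_ge0.
have maskE Z i : lsum (cut A u i) (mask Z i) = if b i then 0 else lsum (cut A u i) (Z i).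
  by rewrite /mask; case: (b i) => //; rewrite /lsum big_ord0.
have cancel x : (superpose_fun A_loc X x + superpose_fun A_loc (mask Y) x =
    superpose_fun A_loc Y x + superpose_fun A_loc (mask X) x)%N.
  rewrite /superpose_fun -!big_split /=; apply: eq_bigr => i _.
  rewrite /mask; have [bi|_] := boolP (b i); first by rewrite (XY i bi).
  by rewrite addnC.
apply: (@le_trans _ _ (\esum_(x in [set: E])
   ((u x * (superpose_fun A_loc (mask X) x)%:R)%:E +
    (u x * (superpose_fun A_loc (mask Y) x)%:R)%:E)%E)).
  apply: le_esum => x _; rewrite -EFinD lee_fin -mulrDr ler_wpM2l//.
  have /(congr1 (fun k => k%:R : R)) := cancel x; rewrite !natrD => h.
  have -> : (superpose_fun A_loc X x)%:R - (superpose_fun A_loc Y x)%:R =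
    (superpose_fun A_loc (mask X) x)%:R - (superpose_fun A_loc (mask Y) x)%:R :> R by lra.
  by apply: le_trans (ler_normB _ _) _; rewrite !ger0_norm.
rewrite esumD; last 2 first.
- by move=> x _; rewrite lee_fin mulr_ge0.
- by move=> x _; rewrite lee_fin mulr_ge0.
rewrite !esum_superpose// -nneseriesD; last 2 first.
- by move=> i _; rewrite lee_fin lsum_ge0.
- by move=> i _; rewrite lee_fin lsum_ge0.
apply: lee_nneseries => i _.
  by rewrite -EFinD lee_fin addr_ge0// lsum_ge0.
by rewrite -EFinD !maskE; case: (b i); rewrite ?addr0.
Qed.

End superposition_distance.

(* D need not be measurable: its integral is then a supremum over the simple
   functions below it. *)
Lemma ge0_integral_transfer_le d1 d2 (X : measurableType d1) (Y : measurableType d2)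
    (R : realType) (P : probability X R) (Q : probability Y R) (phi : X -> Y) :
  measurable_fun setT phi ->
  (forall A, measurable A -> Q A = P (phi @^-1` A)) ->
  forall (D : Y -> \bar R) (C : X -> \bar R), (forall y, 0 <= D y)%E ->
  measurable_fun setT C -> (forall x, D (phi x) <= C x)%E ->
  (\int[Q]_y D y <= \int[P]_x C x)%E.
Proof.
move=> mphi QP D C D0 mC DC.
rewrite ge0_integralTE//; apply: ge_ereal_sup => _ [h /= hD <-].
have mh : measurable_fun setT (EFin \o h).
  by apply/measurable_EFinP; exact: measurable_funPT.
rewrite -integralT_nnsfun (ge0_integral_transfer mphi QP)//; last first.
  by move=> y; rewrite lee_fin.
apply: ge0_le_integral => //.
- by move=> x _; rewrite lee_fin.
- exact: (measurableT_comp mh mphi).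
- by move=> x _; apply: le_trans (hD _) (DC x).
Qed.

(** * The transport bound *)

Lemma expR_tail_ge0 (R : realType) (t : R) : 0 <= expR t - 1 - t.
Proof. by have := expR_ge1Dx t; lra. Qed.

Lemma expR_sub1_ge0 (R : realType) (t : R) : 0 <= t -> 0 <= expR t - 1.
Proof. by move=> t0; have := expR_ge1Dx t; lra. Qed.

Lemma ge0_bounded_integral_fin d (T : measurableType d) (R : realType)
    (mu : {measure set T -> \bar R}) (A : set T) (F : T -> R) (C : R) :
  measurable A -> (mu A < +oo)%E -> measurable_fun setT F -> (forall x, 0 <= F x <= C) ->
  (\int[mu]_(x in A) (F x)%:E \is a fin_num)%E.
Proof.
move=> mA Afin mF FC.
have F0 x : 0 <= F x by have /andP[] := FC x.
rewrite ge0_fin_numE; last by apply: integral_ge0 => x _; rewrite lee_fin.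
apply: (@le_lt_trans _ _ (\int[mu]_(x in A) C%:E)%E).
  apply: ge0_le_integral => //.
  - by move=> x _; rewrite lee_fin.
  - by apply/measurable_EFinP; exact: measurable_funTS.
  - by move=> x _; rewrite lee_fin; have /andP[] := FC x.
rewrite integral_cst//; have [a ->] : exists a : R, mu A = a%:E.
  by exists (fine (mu A)); rewrite fineK// ge0_fin_numE.
by rewrite -EFinM ltry.
Qed.

Lemma measurable_marton_cost d (S : measurableType d) (R : realType) (psi : nat -> S -> R) :
  (forall n, measurable_fun setT (psi n)) -> (forall n s, 0 <= psi n s) ->
  measurable_fun setT (marton_cost psi).
Proof.
move=> mpsi psi0; rewrite /marton_cost; apply: ge0_emeasurable_sum => [n w _ _|n _].
  by rewrite lee_fin; case: ifP => // _; rewrite addr_ge0.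
apply/measurable_EFinP.
have mc : measurable_fun setT
    (fun z : @flagged _ S => if z.1 then 0 else psi n z.2.1 + psi n z.2.2).
  apply: measurable_fun_ifT; [exact: measurable_fst|exact: measurable_cst|].
  apply: measurable_funD.
    exact: (measurableT_comp (mpsi n) measurable_fstpt).
  apply: (measurableT_comp (mpsi n)).
  exact: measurableT_comp measurable_snd measurable_snd.
exact: (measurableT_comp mc (measurable_coord n)).
Qed.

Section transport_bound.
Context {R : realType} {E : completePseudoMetricType R}.
Context (E_hausdorff : hausdorff_space E) (E_lc : locally_compact [set: E]).
Context (m : {measure set (borel E) -> \bar R}).
Context (m_sfin : sigma_finite [set: borel E] m) (m_radon : radon_measure m).
Context (P0 Q : probability (Omega R E) R) (P0_poisson : poisson_measure m P0).
Context (f : Omega R E -> R) (mf : measurable_fun setT f) (f0 : forall w, 0 <= f w).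
Context (Qf : forall A, measurable A -> (Q A = \int[P0]_(w in A) (f w)%:E)%E).
Context (phi : E -> R) (mphi : measurable_fun [set: borel E] phi) (M : R).
Context (phi0 : forall x, 0 <= phi x) (phi_le : forall x, phi x <= M).
Local Open Scope ereal_scope.

Lemma transport_bound (s delta : R) : (0 < s)%R -> (0 < delta)%R ->
  s%:E * W1 (d_phi phi) Q P0 <=
  \int[P0]_w (ent (f w))%:E + \int[m]_x (expR (s * phi x) - 1 - s * phi x)%:E + delta%:E.
Proof.
move=> s0 d0.
pose u x := (s * phi x)%R.
have mu : measurable_fun [set: borel E] u by exact: measurable_funM.
have u0 x : (0 <= u x)%R by rewrite mulr_ge0// ltW.
have uM x : (u x <= s * M)%R by rewrite ler_pM2l.
have mexp : measurable_fun [set: borel E] (fun x => expR (u x)) by exact: measurableT_comp.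
have mg : measurable_fun [set: borel E] (fun x => expR (u x) - 1)%R.
  exact: measurable_funB.
have g0 x : (0 <= expR (u x) - 1 <= expR (s * M))%R.
  by rewrite expR_sub1_ge0//= lerBlDr (le_trans (y := expR (s * M)))// ?ler_expR// lerDl.
have [A [w [[mA w0 A_fin A_cpt A_loc] [cells_int cells_le]]]] :=
  cells_ex E_hausdorff E_lc m_sfin m_radon mg g0 d0.
have /choice[p pE] : forall i, exists p : probability (borel E) R, forall F : borel E -> \bar R,
    (forall x, 0 <= F x) -> measurable_fun setT F ->
    (fine (m (A i)))%:E * \int[p]_x F x = \int[m]_(x in A i) F x.
  by move=> i; exact: normalized_restr_exists.
have law := superpose_law mA w0 A_fin A_cpt A_loc cells_int pE P0_poisson.
pose P := cell_prob m A w p; pose T := @superpose R _ _ A_loc.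
have mT : measurable_fun setT T by exact: measurable_superpose.
have lawE (F : Omega R E -> \bar R) : measurable_fun setT F -> (forall z, 0 <= F z) ->
    \int[P0]_z F z = \int[seq_prod P]_X F (T X).
  by move=> mF F0; apply: ge0_integral_transfer => // B mB; exact/esym/law.
pose ft X := f (T X).
have mft : measurable_fun setT ft by exact: (measurableT_comp mf mT).
have ft0 X : (0 <= ft X)%R by exact: f0.
have mfE : measurable_fun setT (EFin \o f) by exact/measurable_EFinP.
have ft1 : \int[seq_prod P]_X (ft X)%:E = 1.
  rewrite -(lawE (EFin \o f))//.
  transitivity (Q setT); last exact: probability_setT.
  exact/esym/Qf.
pose psi i := lsum (cut A u i).
have c0 i x : (0 <= cut A u i x)%R by exact: mulr_ge0.
have mc i : measurable_fun [set: borel E] (cut A u i) by exact: measurable_cut.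
have mpsi i : measurable_fun setT (psi i) by exact: measurable_lsum.
have psi0 i S : (0 <= psi i S)%R by exact: lsum_ge0.
have cost := integral_marton_cost mft ft0 ft1 mpsi psi0.
(* Separates the value of [integral_exp_tail_lsum] into the part linear in w i, which sums to the
   integral over E, and the excess controlled by delta. *)
have block i : \int[P i]_S (expR (psi i S) - 1 - psi i S)%:E =
    (expR (w i * fine (\int[m]_(x in A i) (expR (u x) - 1)%:E)) - 1
      - w i * fine (\int[m]_(x in A i) (expR (u x) - 1)%:E))%:E +
    (w i)%:E * \int[m]_(x in A i) (expR (u x) - 1 - u x)%:E.
  have pfin : p i setT < +oo.
    by rewrite [X in X < _](_ : _ = 1) ?ltry//; exact: probability_setT.
  have cM x : (cut A u i x <= s * M)%R.
    rewrite /cut indicE; case: (x \in A i); rewrite ?mulr1//.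
    by rewrite mulr0 (le_trans (u0 x)).
  have mec : measurable_fun [set: borel E] (fun x => expR (cut A u i x)).
    exact: measurableT_comp.
  have mec1 : measurable_fun [set: borel E] (fun x => expR (cut A u i x) - 1)%R.
    exact: measurable_funB.
  have ec1 x : (0 <= expR (cut A u i x) - 1)%R.
    exact: expR_sub1_ge0.
  have finqe : \int[p i]_x (expR (cut A u i x))%:E \is a fin_num.
    apply: (@ge0_bounded_integral_fin _ _ _ _ _ _ (expR (s * M))) => // x.
    by rewrite expR_ge0/= ler_expR.
  have finq : \int[p i]_x (cut A u i x)%:E \is a fin_num.
    by apply: (@ge0_bounded_integral_fin _ _ _ _ _ _ (s * M)) => // x; rewrite c0 cM.
  have finA : \int[m]_(x in A i) (expR (u x) - 1)%:E \is a fin_num.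
    exact: (@ge0_bounded_integral_fin _ _ _ _ _ _ (expR (s * M))).
  have finB : \int[m]_(x in A i) (u x)%:E \is a fin_num.
    by apply: (@ge0_bounded_integral_fin _ _ _ _ _ _ (s * M)) => // x; rewrite u0 uM.
  pose qe := fine (\int[p i]_x (expR (cut A u i x))%:E).
  pose q := fine (\int[p i]_x (cut A u i x)%:E).
  pose a := fine (\int[m]_(x in A i) (expR (u x) - 1)%:E).
  pose b := fine (\int[m]_(x in A i) (u x)%:E).
  have cutE x : x \in A i -> cut A u i x = u x.
    by move=> Ax; rewrite /cut indicE Ax mulr1.
  have rate_e : (cell_rate m A w i * (qe - 1) = w i * a)%R.
    apply: EFin_inj; rewrite !EFinM /a (fineK finA).
    have -> : (qe - 1)%:E = \int[p i]_x (expR (cut A u i x) - 1)%:E.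
      have : \int[p i]_x (expR (cut A u i x) - 1)%:E + 1 = qe%:E.
        rewrite -[X in _ + X](integral_prob_cst (p i)) -ge0_integralD//; first last.
        - exact/measurable_EFinP.
        - by move=> x _; rewrite lee_fin.
        rewrite /qe fineK//; apply: eq_integral => x _.
        by rewrite -EFinD subrK.
      by move=> /(congr1 (fun z => z - 1)); rewrite addeK// => ->.
    rewrite -muleA pE//; last exact/measurable_EFinP.
    by congr (_ * _); apply: eq_integral => x Ax; rewrite cutE.
  have rate_u : (cell_rate m A w i * q = w i * b)%R.
    apply: EFin_inj; rewrite !EFinM /b /q (fineK finB) (fineK finq).
    rewrite -muleA pE; [|by move=> x; rewrite lee_fin|exact/measurable_EFinP].
    by congr (_ * _); apply: eq_integral => x Ax; rewrite cutE.
  have tailE : \int[m]_(x in A i) (expR (u x) - 1 - u x)%:E = (a - b)%:E.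
    have tail0 x : (0 <= expR (u x) - 1 - u x)%R by exact: expR_tail_ge0.
    have : \int[m]_(x in A i) (expR (u x) - 1 - u x)%:E + b%:E = a%:E.
      rewrite /a /b !fineK// -ge0_integralD//; first last.
      - by apply/measurable_EFinP; exact: measurable_funTS.
      - by move=> x _; rewrite lee_fin.
      - by apply/measurable_EFinP/measurable_funTS; exact: measurable_funB.
      - by move=> x _; rewrite lee_fin.
      by apply: eq_integral => x _; rewrite -EFinD subrK.
    by move=> /(congr1 (fun z => z - b%:E)); rewrite addeK// => ->.
  transitivity ((expR (w i * a) - 1 - w i * a)%:E + (w i)%:E * (a - b)%:E); last first.
    by rewrite -tailE.
  rewrite /P /cell_prob /psi (integral_exp_tail_lsum (cell_rate_ge0 m A w0 i) (mc i) (c0 i)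
    (esym (fineK finqe)) (esym (fineK finq))) -/qe -/q rate_e rate_u.
  by rewrite -EFinM -EFinD; congr (_%:E); ring.
have total : \sum_(i <oo) \int[P i]_S (expR (psi i S) - 1 - psi i S)%:E <=
    \int[m]_x (expR (u x) - 1 - u x)%:E + delta%:E.
  have tail0 x : (0 <= expR (u x) - 1 - u x)%R by exact: expR_tail_ge0.
  under eq_eseriesr do rewrite block.
  rewrite nneseriesD; last 2 first.
  - by move=> i _; rewrite lee_fin expR_tail_ge0.
  - by move=> i _; rewrite mule_ge0 ?lee_fin//; apply: integral_ge0 => x _; rewrite lee_fin.
  rewrite cells_int//; first by rewrite [leRHS]addeC leeD2r.
  by apply/measurable_EFinP; exact: measurable_funB.
pose Pi := marton_prob P mft ft0.
pose th z : Omega R E * Omega R E := (T (fstseq z), T (sndseq z)).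
have mth : measurable_fun setT th.
  apply/measurable_fun_pairP; split.
    exact: (measurableT_comp mT (@measurable_fstseq _ _)).
  exact: (measurableT_comp mT (@measurable_sndseq _ _)).
have [pi piE] := push_prob_exists Pi mth.
have pi_cpl : coupling pi Q P0.
  split=> B mB.
  - have mTB : measurable (T @^-1` B).
      by rewrite -[X in measurable X]setTI; exact: mT.
    transitivity (Pi ((@fstseq _ _) @^-1` (T @^-1` B))).
      transitivity (Pi (th @^-1` (B `*` setT))); first exact: piE.
      by congr (Pi _); apply/seteqP; split => z /=; [case|].
    transitivity (\int[seq_prod P]_(X in T @^-1` B) (ft X)%:E).
      exact: marton_prob_fst.
    transitivity (\int[P0]_(z in B) (f z)%:E); last exact/esym/Qf.
    rewrite [LHS]integral_mkcond [RHS]integral_mkcond (lawE (_ \_ B)).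
    + by apply: eq_integral => X _; rewrite !patchE.
    + by apply/(measurable_restrictT _ mB)/measurable_funTS.
    + by move=> z; rewrite patchE; case: ifP => // _; rewrite lee_fin.
  - have mTB : measurable (T @^-1` B).
      by rewrite -[X in measurable X]setTI; exact: mT.
    transitivity (Pi ((@sndseq _ _) @^-1` (T @^-1` B))).
      transitivity (Pi (th @^-1` (setT `*` B))); first exact: piE.
      by congr (Pi _); apply/seteqP; split => z /=; [case|].
    transitivity (seq_prod P (T @^-1` B)); last exact: law.
    exact: marton_prob_snd.
have W1le : W1 (d_phi phi) Q P0 <= \int[pi]_z d_phi phi z.1 z.2.
  by apply: ereal_inf_lbound; exists pi.
have ment_f : measurable_fun setT (fun z => (ent (f z))%:E).
  by apply/measurable_EFinP; exact: measurableT_comp measurable_ent mf.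
apply: (@le_trans _ _ (\int[Pi]_z marton_cost psi z)); last first.
  apply: le_trans cost _; rewrite -addeA; apply: leeD; last exact: total.
  rewrite -(lawE (fun z => (ent (f z))%:E))//.
  by move=> z; rewrite lee_fin ent_ge0.
have cost0 z : 0 <= marton_cost psi z.
  apply: nneseries_ge0 => i _ _; rewrite lee_fin; case: ifP => // _.
  by rewrite addr_ge0.
have mcost : measurable_fun setT (fun z => marton_cost psi z) by exact: measurable_marton_cost.
have phid0 (x : E) (r : R) : 0 <= (phi x * `|r|)%:E by rewrite lee_fin mulr_ge0.
(* The factor s is moved to the side of [marton_cost], which is measurable; for d_phi only the
   one-sided transfer is at hand. *)
rewrite muleC -lee_pdivlMr//; apply: le_trans W1le _.
rewrite muleC -ge0_integralZl//; last by rewrite lee_fin invr_ge0 ltW.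
apply: (ge0_integral_transfer_le mth) => //.
- by move=> y; exact: esum_ge0.
- exact: measurable_funeM.
move=> z; rewrite muleC lee_pdivlMr// muleC /d_phi -esumZl//.
under eq_esum do rewrite -EFinM mulrA.
(* Where the flag is set the two lists are equal by the choice of [sndpt]. *)
have := @superpose_dist R E A A_loc (fstseq z) (sndseq z) (fun i => (z i).1) u u0.
move=> h; apply: le_trans (h _) _.
  by move=> i zi; rewrite /fstseq /sndseq /fstpt /sndpt zi.
rewrite /marton_cost le_eqVlt; apply/orP; left; apply/eqP.
apply: eq_eseriesr => i _; congr (_%:E).
by rewrite /fstseq /sndseq /fstpt /sndpt; case: (z i) => -[].
Qed.

End transport_bound.

(** * Relative entropy and densities *)

Section relative_entropy.
Context {d} {T : measurableType d} {R : realType} (nu mu : probability T R).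
Local Open Scope ereal_scope.

Let dominates : abs_cont nu mu -> nu `<< mu.
Proof.
move=> numu A A0 B mB BA; apply: numu => //; exact: A0.
Qed.

Lemma density_exists : abs_cont nu mu -> exists f, is_density nu mu f.
Proof.
move=> /dominates numu.
have [g [g0 gfin gi gE]] := radon_nikodym_sigma_finite numu.
exists (fine \o g); split; [|split].
- have /measurable_EFinP : measurable_fun setT (EFin \o (fine \o g)).
    rewrite (_ : EFin \o _ = g); first exact: measurable_int gi.
    by apply/funext => x /=; rewrite fineK.
  by [].
- by move=> x; exact: fine_ge0.
- move=> A mA; rewrite gE//; apply: eq_integral => x _.
  by rewrite /= fineK.
Qed.

Context (f : T -> R) (df : is_density nu mu f).

Let mf : measurable_fun setT f. Proof. by have [] := df. Qed.
Let f0 x : (0 <= f x)%R. Proof. by have [_ []] := df. Qed.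
Let nuE A : measurable A -> nu A = \int[mu]_(x in A) (f x)%:E.
Proof. by have [_ [_]] := df; exact. Qed.
Let mfE : measurable_fun setT (EFin \o f). Proof. exact/measurable_EFinP. Qed.

Lemma integral_density : \int[mu]_x (f x)%:E = 1.
Proof. by transitivity (nu setT); [exact/esym/nuE|exact: probability_setT]. Qed.

(** The Radon-Nikodym derivative agrees almost everywhere with the given f, because both integrate
    to nu on every measurable set. *)
Lemma ge0_integral_density (F : T -> \bar R) : (forall x, 0 <= F x) ->
  measurable_fun setT F -> \int[nu]_x F x = \int[mu]_x (F x * (f x)%:E).
Proof.
move=> F0 mF.
have numu : nu `<< mu.
  apply: dominates => A mA muA; rewrite nuE//.
  apply/eqP; rewrite eq_le integral_ge0 ?andbT; last by move=> x _; rewrite lee_fin.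
  rewrite -(integral_measure_zero A (EFin \o f)).
  rewrite (eq_measure_integral mzero)// => B mB BA.
  apply/eqP; rewrite eq_le measure_ge0 andbT -[leRHS]muA.
  by apply: le_measure; [exact/mem_set|exact/mem_set|].
rewrite -(Radon_Nikodym_SigmaFinite.change_of_variables numu F0 measurableT mF).
set g := Radon_Nikodym_SigmaFinite.f nu mu.
have gi : mu.-integrable setT g by exact: Radon_Nikodym_SigmaFinite.f_integrable.
have gf : ae_eq mu setT g (EFin \o f).
  apply: integral_ae_eq => // B _ mB.
  transitivity (nu B); last exact: nuE.
  exact/esym/Radon_Nikodym_SigmaFinite.f_integral.
have mg : measurable_fun setT g by exact: measurable_int gi.
apply: ae_eq_integral => //.
- exact: emeasurable_funM.
- exact: emeasurable_funM.
- exact: ae_eqe_mul2l.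
Qed.

(** The right side is a difference of positive and negative parts. The negative part is finite, so
    the identity can be stated as a sum of nonnegative integrals and then cancelled, also for
    infinite entropy. *)
Lemma integral_ent_density :
  \int[mu]_x (ent (f x))%:E = \int[nu]_x (ln (f x))%:E.
Proof.
have mL : measurable_fun setT (fun x => (ln (f x))%:E).
  by apply/measurable_EFinP; exact: measurableT_comp (@measurable_ln R) mf.
rewrite [RHS]integralE (ge0_integral_density (funepos_ge0 _) (measurable_funepos mL)).
rewrite (ge0_integral_density (funeneg_ge0 _) (measurable_funeneg mL)).
pose a x := (Num.max (ln (f x)) 0 * f x)%R.
pose b x := (Num.max (- ln (f x)) 0 * f x)%R.
have a0 x : (0 <= a x)%R by rewrite mulr_ge0// le_max lexx orbT.
have b0 x : (0 <= b x)%R by rewrite mulr_ge0// le_max lexx orbT.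
have ma : measurable_fun setT (fun x => (a x)%:E).
  apply/measurable_EFinP; apply: measurable_funM => //.
  by apply: measurable_maxr => //; exact: measurableT_comp (@measurable_ln R) mf.
have mb : measurable_fun setT (fun x => (b x)%:E).
  apply/measurable_EFinP; apply: measurable_funM => //.
  apply: measurable_maxr => //; apply: measurableT_comp => //.
  exact: measurableT_comp (@measurable_ln R) mf.
have ment : measurable_fun setT (fun x => (ent (f x))%:E).
  by apply/measurable_EFinP; exact: measurableT_comp (@measurable_ent R) mf.
have -> : \int[mu]_x (((fun x => (ln (f x))%:E)^\+ x) * (f x)%:E) = \int[mu]_x (a x)%:E.
  by apply: eq_integral => x _; rewrite funeposE -EFin_max.
have -> : \int[mu]_x (((fun x => (ln (f x))%:E)^\- x) * (f x)%:E) = \int[mu]_x (b x)%:E.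
  by apply: eq_integral => x _; rewrite funenegE -EFinN -EFin_max.
(* Nonnegativity of [ent] gives - u ln u <= 1 - u <= 1. *)
have b1 x : (b x <= 1)%R.
  have := ent_ge0 (f0 x); have := f0 x; rewrite /b /ent.
  by case: (leP (- ln (f x)) 0)%R => _; [lra|nra].
have bfin : \int[mu]_x (b x)%:E \is a fin_num.
  rewrite ge0_fin_numE; last by apply: integral_ge0 => x _; rewrite lee_fin.
  apply: (@le_lt_trans _ _ (\int[mu]_x 1)); last by rewrite integral_prob_cst ltry.
  by apply: ge0_le_integral => // x _; rewrite lee_fin.
have : \int[mu]_x (ent (f x))%:E + \int[mu]_x (b x)%:E + \int[mu]_x (f x)%:E =
    \int[mu]_x (a x)%:E + \int[mu]_x 1.
  have ent0 x : 0 <= (ent (f x))%:E by rewrite lee_fin ent_ge0.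
  have b0' x : 0 <= (b x)%:E by rewrite lee_fin.
  have eb0 x : 0 <= (ent (f x))%:E + (b x)%:E by exact: adde_ge0.
  have meb : measurable_fun setT (fun x => (ent (f x))%:E + (b x)%:E).
    exact: emeasurable_funD.
  have f0' x : 0 <= (f x)%:E by rewrite lee_fin.
  have a0' x : 0 <= (a x)%:E by rewrite lee_fin.
  rewrite -ge0_integralD// -ge0_integralD// -ge0_integralD//.
  apply: eq_integral => x _; rewrite -!EFinD; congr (_%:E).
  rewrite /ent /a /b; move: (ln (f x)) => l.
  case: (leP (- l) 0)%R => l1; case: (leP l 0)%R => l2; try lra.
  by (have -> : l = 0%R by lra); ring.
rewrite integral_prob_cst integral_density => /(congr1 (fun z => z - 1)).
by rewrite !addeK// => <-; rewrite addeK.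
Qed.

End relative_entropy.

(** * From the linear bounds to the entropy inequality *)

Lemma continuous_borel_measurable (R : realType) (E : ptopologicalType) (f : E -> R) :
  continuous f -> measurable_fun [set: borel E] f.
Proof.
move=> /continuousP cf.
apply: (measurability _ (RGenOpens.measurableE R)) => _ [_ [a [b ->] <-]].
rewrite setTI; apply: sub_sigma_algebra; exact/cf/interval_open.
Qed.

(* The choice s = ln (1 + W / c) / M maximises s W - (c / M) (e^(sM) - 1 - sM). *)
Lemma hc_of_linear_bounds (R : realType) (M c W H : R) : 0 < M -> 0 <= c -> 0 <= W ->
  0 <= H ->
  (forall s, 0 < s -> s * W <= H + c / M * (expR (s * M) - 1 - s * M)) ->
  M^-1 * (c * h (W / c)) <= H.
Proof.
move=> M0 c0 W0 H0 hyp.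
have [->|cn0] := eqVneq c 0; first by rewrite mul0r mulr0.
have {cn0}c0 : 0 < c by rewrite lt_def cn0.
have [->|Wn0] := eqVneq W 0.
  by rewrite mul0r /h addr0 ln1 mulr0 subr0 !mulr0.
have {Wn0}W0 : 0 < W by rewrite lt_def Wn0.
have r0 : 0 < W / c by rewrite divr_gt0.
set L := ln (1 + W / c).
have L0 : 0 < L by rewrite ln_gt0// ltrDl.
have := hyp (L / M) (divr_gt0 L0 M0).
rewrite divfK ?gt_eqF// lnK; last by rewrite posrE addr_gt0.
move=> le; rewrite -subr_ge0 in le; rewrite -subr_ge0 /h -/L.
rewrite (_ : H - _ = H + c / M * (1 + W / c - 1 - L) - L / M * W)//.
by field; rewrite !gt_eqF.
Qed.

Section main.
Context {R : realType} {E : completePseudoMetricType R}.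
Context (m : {measure set (borel E) -> \bar R}).
Context (phi : E -> R) (M : R) (mphi : measurable_fun [set: borel E] phi).
Context (M0 : 0 < M) (phi0 : forall x, 0 <= phi x) (phi_le : forall x, phi x <= M).
Local Open Scope ereal_scope.

Lemma integral_exp_tail_scale (s : R) : (0 < s)%R ->
  \int[m]_x (expR (s * phi x) - 1 - s * phi x)%:E <=
  ((M ^+ 2)^-1 * (expR (s * M) - 1 - s * M))%:E * \int[m]_x ((phi x) ^+ 2)%:E.
Proof.
move=> s0.
have k0 : (0 <= (M ^+ 2)^-1 * (expR (s * M) - 1 - s * M))%R.
  by rewrite mulr_ge0 ?expR_tail_ge0// invr_ge0 exprn_ge0// ltW.
have mu : measurable_fun [set: borel E] (fun x => s * phi x)%R by exact: measurable_funM.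
have m2 : measurable_fun [set: borel E] (fun x => ((phi x) ^+ 2)%:E).
  by apply/measurable_EFinP; exact: measurable_funX.
rewrite -ge0_integralZl//; first last.
  by move=> x _; rewrite lee_fin sqr_ge0.
apply: ge0_le_integral => //.
- by move=> x _; rewrite lee_fin expR_tail_ge0.
- apply/measurable_EFinP; apply: measurable_funB => //; apply: measurable_funB => //.
  exact: measurableT_comp.
- by apply: emeasurable_funM.
- move=> x _; rewrite -EFinM lee_fin.
  have -> : (s * phi x = phi x / M * (s * M))%R by field; rewrite gt_eqF.
  have r01 : (0 <= phi x / M <= 1)%R.
    apply/andP; split; first exact: divr_ge0 (phi0 x) (ltW M0).
    by rewrite ler_pdivrMr// mul1r.
  have sM0 : (0 <= s * M)%R by rewrite mulr_ge0// ltW.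
  apply: le_trans (exp_tail_scale r01 sM0) _.
  by rewrite exprMn exprVn le_eqVlt; apply/orP; left; apply/eqP; ring.
Qed.

End main.

Lemma W1_ge0 d (T : measurableType d) (R : realType) (D : T -> T -> \bar R)
    (mu nu : probability T R) : (forall x y, 0 <= D x y)%E -> (0 <= W1 D mu nu)%E.
Proof.
by move=> D0; apply: le_ereal_inf_tmp => _ [pi _ <-]; exact: integral_ge0.
Qed.

Theorem theorem2p4 (R : realType) (E : completePseudoMetricType R)
    (E_hausdorff : hausdorff_space E)
    (E_lc : locally_compact [set: E])
    (m : {measure set (borel E) -> \bar R})
    (m_sfin : sigma_finite [set: borel E] m)
    (m_radon : radon_measure m)
    (P0 : probability (Omega R E) R)
    (P0_poisson : poisson_measure m P0)
    (phi : E -> R) (M : R)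
    (phi_cont : continuous phi)
    (phi_bnd : exists C : R, forall x, `|phi x| <= C)
    (phi_pos : forall x, 0 < phi x)
    (phi_le : forall x, phi x <= M)
    (sigma2_fin : (\int[m]_x ((phi x) ^+ 2)%:E < +oo)%E) :
  let c := fine (\int[m]_x ((phi x) ^+ 2)%:E) / M in
  forall Q : probability (Omega R E) R,
    ((M^-1)%:E * hc c (W1 (d_phi phi) Q P0) <= rel_entropy Q P0)%E.
Proof.
move=> c Q.
have mphi := continuous_borel_measurable phi_cont.
have phi0 x : 0 <= phi x by exact: ltW.
(* E is pointed, so the bounds on phi can be read at one point. *)
have M0 : 0 < M := lt_le_trans (phi_pos (point : E)) (phi_le point).
pose S := fine (\int[m]_x ((phi x) ^+ 2)%:E)%E.
have S0 : 0 <= S by apply/fine_ge0/integral_ge0 => x _; rewrite lee_fin sqr_ge0.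
have SE : (\int[m]_x ((phi x) ^+ 2)%:E = S%:E)%E.
  by rewrite fineK// ge0_fin_numE// integral_ge0// => x _; rewrite lee_fin sqr_ge0.
have [->|Hfin] := eqVneq (rel_entropy Q P0) +oo%E; first exact: leey.
have QP0 : abs_cont Q P0.
  by apply: contrapT => nac; move: Hfin; rewrite /rel_entropy asboolF// eqxx.
(* The very density chosen inside [rel_entropy], so that no comparison between versions is
   required. *)
pose f := xget (fun=> 0) (is_density Q P0).
have df : is_density Q P0 f.
  by have [g dg] := density_exists QP0; rewrite /f; apply: (@xgetPex _ (fun=> 0) (is_density Q P0)); exists g.
have [mf [f0 Qf]] := df.
have HE : rel_entropy Q P0 = (\int[P0]_w (ent (f w))%:E)%E.
  by rewrite (integral_ent_density df) /rel_entropy asboolT.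
have H0 : (0 <= rel_entropy Q P0)%E.
  by rewrite HE; apply: integral_ge0 => w _; rewrite lee_fin ent_ge0.
have [H Hr] : exists r, rel_entropy Q P0 = r%:E.
  by exists (fine (rel_entropy Q P0)); rewrite fineK// ge0_fin_numE// ltey.
rewrite Hr lee_fin in H0.
have bound s : 0 < s -> (s%:E * W1 (d_phi phi) Q P0 <=
    (H + c / M * (expR (s * M) - 1 - s * M))%:E)%E.
  move=> s0; apply/lee_addgt0Pr => e e0.
  apply: le_trans (transport_bound E_hausdorff E_lc m_sfin m_radon P0_poisson mf f0 Qf
    mphi phi0 phi_le s0 e0) _.
  rewrite leeD2r// -HE Hr EFinD leeD2l//.
  apply: le_trans (integral_exp_tail_scale m mphi M0 phi0 phi_le s0) _.
  rewrite SE -EFinM lee_fin le_eqVlt; apply/orP; left; apply/eqP.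
  by rewrite /c -/S; field; rewrite gt_eqF.
have W0 : (0 <= W1 (d_phi phi) Q P0)%E.
  apply: W1_ge0 => x y; apply: esum_ge0 => z _.
  by rewrite lee_fin mulr_ge0.
(* The bound at s = 1 has a finite right side, since the entropy is finite in this branch. *)
have [W WE] : exists r, W1 (d_phi phi) Q P0 = r%:E.
  exists (fine (W1 (d_phi phi) Q P0)); rewrite fineK// ge0_fin_numE//.
  by rewrite -[X in (X < _)%E]mul1e; apply: le_lt_trans (bound 1 ltr01) (ltry _).
rewrite WE lee_fin in W0.
rewrite Hr WE /hc -EFinM lee_fin.
apply: hc_of_linear_bounds => //; first by rewrite divr_ge0// ltW.
by move=> s /bound; rewrite WE -EFinM lee_fin.
Qed.
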